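(* Let $W=\wedge^2(\mathbb{C}^6)^*\otimes\mathbb{C}^3=\mathfrak{h}_1\subset\mathfrak{e}_7$ and, for $l\in W$, let $\sigma(l)\in\mathfrak{gl}(\mathfrak{e}_7)$ be the adjoint action of $l$ on $\mathfrak{e}_7$. Then $\sigma(l)^3$ maps $W$ to itself, and the kernel of $\sigma(l)^3|_W$ is three-dimensional if and only if $l$ is in the first family.
   Context: Write $\mathfrak{g}_{-1}=\mathbb{C}^6$, $\mathfrak{g}_{-2}=\mathbb{C}^3$, $W=\wedge^2\mathfrak{g}_{-1}^*\otimes\mathfrak{g}_{-2}$, $S'=SL(\mathfrak{g}_{-1}^* )\times SL(\mathfrak{g}_{-2})$ with Lie algebra $\mathfrak{s}'$. The complex simple Lie algebra $\mathfrak{e}_7$ has a $\mathbb{Z}/3$-grading $\mathfrak{e}_7=\mathfrak{h}_{-1}\oplus\mathfrak{h}_0\oplus\mathfrak{h}_1$, $[\mathfrak{h}_i,\mathfrak{h}_j]\subset\mathfrak{h}_{i+j\bmod 3}$, with $\mathfrak{h}_{-1}=W^*$, $\mathfrak{h}_0=\mathfrak{s}'$, $\mathfrak{h}_1=W$. Here $\mathfrak{h}_0$ acts naturally on $W$ and $W^*$; the bracket $\wedge^2\mathfrak{h}_1\to\mathfrak{h}_{-1}$ is the tensor product of the symmetric map $\odot^2(\wedge^2\mathfrak{g}_{-1}^* )\to\wedge^4\mathfrak{g}_{-1}^*\cong\wedge^2\mathfrak{g}_{-1}$ and the skew map $\wedge^2\mathfrak{g}_{-2}\cong\mathfrak{g}_{-2}^*$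 (identifications by volume forms); minus the dual of this map gives $\wedge^2\mathfrak{h}_{-1}\to\mathfrak{h}_1$; and $\mathfrak{h}_1\times\mathfrak{h}_{-1}\to\mathfrak{h}_0$ is given by trace-free parts of the natural contractions. An element of $W$ is semisimple (nilpotent) if it is so in $\mathfrak{e}_7$. Let $a^1,\dots,a^6$ be a basis of $\mathfrak{g}_{-1}^*$, $b_1,b_2,b_3$ a basis of $\mathfrak{g}_{-2}$, and $$u_1=a^1\wedge a^2\otimes b_1+a^3\wedge a^4\otimes b_2+a^5\wedge a^6\otimes b_3,$$ $$u_2=a^5\wedge a^4\otimes b_1+a^1\wedge a^6\otimes b_2+a^3\wedge a^2\otimes b_3,$$ $$u_3=a^3\wedge a^6\otimes b_1+a^5\wedge a^2\otimes b_2+a^1\wedge a^4\otimes b_3.$$ The first family is the set of elements of $W$ that are $S'$-conjugate to some $\lambda_1u_1+\lambda_2u_2+\lambda_3u_3$, $\lambda_i\in\mathbb{C}$, with $\lambda_i\ne0$, $\lambda_i^3\neq\lambda_j^3$ for $i\ne j$, and $(\lambda_1^3+\lambda_2^3+\lambda_3^3)^3-(3\lambda_1\lambda_2\lambda_3)^3\neq0$. All such elements are semisimple. *)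

(* Defs.v *)
From HB Require Import structures.
From mathcomp Require Import all_boot all_order all_algebra all_fingroup.
From mathcomp Require Import reals complex.
Set Implicit Arguments.
Unset Strict Implicit.
Unset Printing Implicit Defensive.
Import Order.TTheory GRing.Theory Num.Theory.
Local Open Scope ring_scope.

(* Alternating bilinear forms (or bivectors) on F^n, by their skew matrices. *)
Definition sympart (F : numFieldType) n (M : 'M[F]_n) : 'M[F]_n := M + M^T.

Lemma sympart_is_linear (F : numFieldType) n : linear (@sympart F n).
Proof. by move=> c A B; rewrite /sympart linearP /= scalerDr addrACA. Qed.
HB.instance Definition _ (F : numFieldType) n :=
  GRing.isLinear.Build F 'M[F]_n 'M[F]_n _ (@sympart F n)
    (@sympart_is_linear F n).

Definition altv (F : numFieldType) n : {vspace 'M[F]_n} :=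
  lker (linfun (@sympart F n)).

Definition slv (F : numFieldType) n : {vspace 'M[F]_n} :=
  lker (linfun (@mxtrace F n : 'M[F]_n -> F^o)).

Notation alt F n := (subvs_of (altv F n)).
Notation sl F n := (subvs_of (slv F n)).

Lemma altvP (F : numFieldType) n (M : 'M[F]_n) :
  reflect (M^T = - M) (M \in altv F n).
Proof.
rewrite memv_ker lfunE /= /sympart addrC addr_eq0; exact: eqP.
Qed.

Lemma slvP (F : numFieldType) n (M : 'M[F]_n) :
  reflect (\tr M = 0) (M \in slv F n).
Proof. rewrite memv_ker lfunE /=; exact: eqP. Qed.

Lemma trmx_alt (F : numFieldType) n (p : alt F n) : (vsval p)^T = - vsval p.
Proof. exact/altvP/subvsP. Qed.

Fact wedge_alt (F : numFieldType) n (x y : 'cV[F]_n) :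
  x *m y^T - y *m x^T \in altv F n.
Proof. by apply/altvP; rewrite linearB /= !trmx_mul !trmxK opprB. Qed.
Definition wedge (F : numFieldType) n (x y : 'cV[F]_n) : alt F n :=
  Subvs (wedge_alt x y).

Fact congr_alt (F : numFieldType) n (g : 'M[F]_n) (p : alt F n) :
  g *m vsval p *m g^T \in altv F n.
Proof.
by apply/altvP; rewrite !trmx_mul trmxK trmx_alt mulNmx mulmxN mulmxA.
Qed.
Definition alt_congr (F : numFieldType) n (g : 'M[F]_n) (p : alt F n) :
  alt F n := Subvs (congr_alt g p).

Fact der_alt (F : numFieldType) n (A : 'M[F]_n) (p : alt F n) :
  A *m vsval p + vsval p *m A^T \in altv F n.
Proof.
apply/altvP; rewrite linearD /= !trmx_mul trmxK trmx_alt.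
by rewrite mulNmx mulmxN opprD addrC.
Qed.
Definition alt_der (F : numFieldType) n (A : 'M[F]_n) (p : alt F n) :
  alt F n := Subvs (der_alt A p).

(* /\^2 (F^6)^* x /\^2 (F^6)^* -> /\^4 (F^6)^* = /\^2 F^6 (and dually), for
   the standard volume form; for instance (e^0 /\ e^1, e^2 /\ e^3) is sent to
   e_4 /\ e_5.  Each term of the wedge product occurs 4 times in the sum. *)
Definition star_mx (F : numFieldType) (p q : 'M[F]_6) : 'M[F]_6 :=
  \matrix_(i, j) ((\sum_(s : 'S_6 | (s 4 == i) && (s 5 == j))
    (-1) ^+ s * p (s 0) (s 1) * q (s 2) (s 3)) / 4).

Fact star_alt (F : numFieldType) (p q : alt F 6) :
  star_mx (vsval p) (vsval q) \in altv F 6.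
Proof.
apply/altvP/matrixP => i j; rewrite !mxE -mulNr -sumrN; congr (_ / _).
rewrite (reindex_inj (mulgI (tperm (4 : 'I_6) 5))) /=.
apply: eq_big => [s|s _].
  by rewrite !permM tpermL tpermR andbC.
by rewrite !permM !tpermD // odd_mul_tperm (_ : 4 != 5) // addTb signrN !mulNr.
Qed.
Definition star (F : numFieldType) (p q : alt F 6) : alt F 6 :=
  Subvs (star_alt p q).

(* The element \sum_k w_k (x) e_k of /\^2 (F^6)^* (x) F^3 is the family of its
   components w_k; likewise for the dual space /\^2 F^6 (x) (F^3)^*.  The
   pairing of xi and w is \sum_k \sum_(i < j) xi_k i j * w_k i j. *)
Definition W (F : numFieldType) := {ffun 'I_3 -> alt F 6}.
Definition Wd (F : numFieldType) := {ffun 'I_3 -> alt F 6}.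
HB.instance Definition _ (F : numFieldType) := Vector.on (W F).
HB.instance Definition _ (F : numFieldType) := Vector.on (Wd F).

Definition tensor (F : numFieldType) (p : alt F 6) (v : 'cV[F]_3) : W F :=
  [ffun k => v k 0 *: p].

(* g acts on (F^6)^*, written as column vectors in the dual basis. *)
Definition actS (F : numFieldType) (g : 'M[F]_6) (h : 'M[F]_3) (w : W F) :
  W F := [ffun k => \sum_m h k m *: alt_congr g (w m)].

Definition der (F : numFieldType) (A : 'M[F]_6) (B : 'M[F]_3)
    (w : {ffun 'I_3 -> alt F 6}) : {ffun 'I_3 -> alt F 6} :=
  [ffun k => alt_der A (w k) + \sum_m B k m *: w m].

(* The first factor acts on (F^6)^*, the second one on F^3. *)
Definition h0 (F : numFieldType) := (sl F 6 * sl F 3)%type.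
HB.instance Definition _ (F : numFieldType) := Vector.on (h0 F).

Definition actW (F : numFieldType) (X : h0 F) (w : W F) : W F :=
  der (vsval X.1) (vsval X.2) w.
Definition actWd (F : numFieldType) (X : h0 F) (xi : Wd F) : Wd F :=
  der (- (vsval X.1)^T) (- (vsval X.2)^T) xi.

Fact comm_sl (F : numFieldType) n (A B : 'M[F]_n) :
  A *m B - B *m A \in slv F n.
Proof. by apply/slvP; rewrite linearB /= mxtrace_mulC subrr. Qed.
Definition sl_br (F : numFieldType) n (A B : sl F n) : sl F n :=
  Subvs (comm_sl (vsval A) (vsval B)).

Definition h0_br (F : numFieldType) (X Y : h0 F) : h0 F :=
  (sl_br X.1 Y.1, sl_br X.2 Y.2).

Fact tracefree_sl (F : numFieldType) n (A : 'M[F]_n.+1) :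
  A - (\tr A / n.+1%:R)%:M \in slv F n.+1.
Proof.
apply/slvP; rewrite linearB /= mxtrace_scalar -(mulr_natr (_ / _)) divfK ?subrr //.
by rewrite pnatr_eq0.
Qed.
Definition tracefree (F : numFieldType) n (A : 'M[F]_n.+1) : sl F n.+1 :=
  Subvs (tracefree_sl A).

(* (p (x) v, q (x) w) |-> star (p, q) (x) (v x w), with /\^2 F^3 = (F^3)^*
   by the standard volume form, and the same formula for the dual spaces. *)
Definition cross (F : numFieldType) (w z : {ffun 'I_3 -> alt F 6}) :
    {ffun 'I_3 -> alt F 6} :=
  [ffun k => \sum_(t : 'S_3 | t 2 == k) (-1) ^+ t *: star (w (t 0)) (z (t 1))].

(* On decomposable elements, (p (x) v, q (x) f) |-> (f(v) * (contraction of p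
   and q over one index), <p, q> * v (x) f), followed by trace-free parts. *)
Definition contr (F : numFieldType) (w : W F) (xi : Wd F) : h0 F :=
  (tracefree (\sum_k vsval (w k) *m (vsval (xi k))^T),
   tracefree (\matrix_(a, c)
     (\sum_(i < 6) \sum_(j < 6 | (i < j)%N) vsval (w a) i j * vsval (xi c) i j))).

Definition e7 (F : numFieldType) := (Wd F * h0 F * W F)%type.
HB.instance Definition _ (F : numFieldType) := Vector.on (e7 F).

(* The order of the summands is h_(-1), h_0, h_1; the normalizations of the
   components are those for which the Jacobi identity holds. *)
Definition e7_br (F : numFieldType) (x y : e7 F) : e7 F :=
  let: (xi, X, w) := x in
  let: (eta, Y, z) := y in
  (cross w z + actWd X eta - actWd Y xi,
   h0_br X Y + contr w eta - contr z xi,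
   - cross xi eta + actW X z - actW Y w).

Lemma alt_der_is_linear (F : numFieldType) n (A : 'M[F]_n) :
  linear (alt_der A).
Proof.
move=> c p q; apply/val_inj; rewrite /= !linearP /= mulmxDl -scalemxAl.
by rewrite scalerDr addrACA.
Qed.

Lemma alt_derDl (F : numFieldType) n c (A B : 'M[F]_n) p :
  alt_der (c *: A + B) p = c *: alt_der A p + alt_der B p.
Proof.
apply/val_inj; rewrite /= linearP /= mulmxDl mulmxDr -scalemxAl -scalemxAr.
by rewrite scalerDr addrACA.
Qed.

Lemma star_is_linear (F : numFieldType) (p : alt F 6) : linear (star p).
Proof.
move=> c q r; apply/val_inj/matrixP => i j; rewrite /= !mxE mulrA -mulrDl.
congr (_ / _); rewrite mulr_sumr -big_split /=; apply: eq_bigr => s _.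
by rewrite !mxE mulrDr mulrCA.
Qed.

Lemma der_is_linear (F : numFieldType) A B : linear (@der F A B).
Proof.
move=> c w z; apply/ffunP => k; rewrite !ffunE alt_der_is_linear scalerDr.
rewrite addrACA; congr (_ + _); rewrite scaler_sumr -big_split /=.
by apply: eq_bigr => m _; rewrite !ffunE scalerDr !scalerA mulrC.
Qed.

Lemma derDl (F : numFieldType) c A A' B B' w :
  @der F (c *: A + A') (c *: B + B') w = c *: der A B w + der A' B' w.
Proof.
apply/ffunP => k; rewrite !ffunE alt_derDl scalerDr addrACA; congr (_ + _).
rewrite scaler_sumr -big_split /=.
by apply: eq_bigr => m _; rewrite !mxE scalerDl scalerA.
Qed.

Lemma cross_is_linear (F : numFieldType) w : linear (@cross F w).
Proof.
move=> c z z'; apply/ffunP => k; rewrite !ffunE scaler_sumr -big_split /=.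
apply: eq_bigr => t _.
by rewrite !ffunE star_is_linear scalerDr !scalerA mulrC.
Qed.

Lemma tracefreeP (F : numFieldType) n c (A B : 'M[F]_n.+1) :
  tracefree (c *: A + B) = c *: tracefree A + tracefree B.
Proof.
apply/val_inj; rewrite /= linearP /= mulrDl raddfD /= opprD scalerBr addrACA.
by rewrite -mulrA scale_scalar_mx.
Qed.

Lemma contrDr (F : numFieldType) c (w : W F) (xi eta : Wd F) :
  contr w (c *: xi + eta) = c *: contr w xi + contr w eta.
Proof.
congr (_, _) => /=; rewrite -tracefreeP; congr tracefree.
  rewrite scaler_sumr -big_split; apply: eq_bigr => k _ /=.
  by rewrite !ffunE /= linearP /= mulmxDr scalemxAr.
apply/matrixP => a b; rewrite !mxE mulr_sumr -big_split; apply: eq_bigr => i _.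
rewrite /= mulr_sumr -big_split; apply: eq_bigr => j _ /=.
by rewrite !ffunE !mxE mulrDr mulrCA.
Qed.

Lemma contrDl (F : numFieldType) c (w z : W F) (xi : Wd F) :
  contr (c *: w + z) xi = c *: contr w xi + contr z xi.
Proof.
congr (_, _) => /=; rewrite -tracefreeP; congr tracefree.
  rewrite scaler_sumr -big_split; apply: eq_bigr => k _ /=.
  by rewrite !ffunE /= mulmxDl scalemxAl.
apply/matrixP => a b; rewrite !mxE mulr_sumr -big_split; apply: eq_bigr => i _.
rewrite /= mulr_sumr -big_split; apply: eq_bigr => j _ /=.
by rewrite !ffunE !mxE mulrDl mulrA.
Qed.

Lemma h0_br_is_linear (F : numFieldType) (X : h0 F) : linear (h0_br X).
Proof.
move=> c Y Z; congr (_, _); apply/val_inj => /=.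
  by rewrite linearP /= mulmxDl -scalemxAl opprD scalerBr addrACA.
by rewrite linearP /= mulmxDl -scalemxAl opprD scalerBr addrACA.
Qed.

Lemma actW_is_linear (F : numFieldType) (X : h0 F) : linear (actW X).
Proof. exact: der_is_linear. Qed.

Lemma actWd_is_linear (F : numFieldType) (X : h0 F) : linear (actWd X).
Proof. exact: der_is_linear. Qed.

Lemma actWDl (F : numFieldType) c (X Y : h0 F) w :
  actW (c *: X + Y) w = c *: actW X w + actW Y w.
Proof. exact: derDl. Qed.

Lemma actWdDl (F : numFieldType) c (X Y : h0 F) xi :
  actWd (c *: X + Y) xi = c *: actWd X xi + actWd Y xi.
Proof.
rewrite /actWd -derDl; congr (der _ _ xi);
  by rewrite -[RHS]opprK opprD opprK -scalerN opprK /= [in LHS]linearP.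
Qed.

Lemma e7_br_is_linear (F : numFieldType) (x : e7 F) : linear (e7_br x).
Proof.
case: x => [[xi X] w] c [[eta Y] z] [[eta' Y'] z'].
have lin3 (V : lmodType F) (a b d a' b' d' : V) :
    c *: a + a' + (c *: b + b') - (c *: d + d') =
    c *: (a + b - d) + (a' + b' - d').
  by rewrite scalerBr scalerDr opprD (addrACA (c *: a)) (addrACA (c *: a + _)).
congr (_, _, _) => /=.
- by rewrite cross_is_linear actWd_is_linear actWdDl lin3.
- by rewrite h0_br_is_linear contrDr contrDl lin3.
- by rewrite cross_is_linear opprD -scalerN actW_is_linear actWDl lin3.
Qed.
HB.instance Definition _ (F : numFieldType) (x : e7 F) :=
  GRing.isLinear.Build F (e7 F) (e7 F) _ (e7_br x) (@e7_br_is_linear F x).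

Definition inW (F : numFieldType) (w : W F) : e7 F := (0, 0, w).

Lemma inW_is_linear (F : numFieldType) : linear (@inW F).
Proof.
by move=> c w z; congr (_, _, _); rewrite /= scaler0 addr0.
Qed.
HB.instance Definition _ (F : numFieldType) :=
  GRing.isLinear.Build F (W F) (e7 F) _ (@inW F) (@inW_is_linear F).

Definition h1 (F : numFieldType) : {vspace e7 F} := limg (linfun (@inW F)).

Definition sigma (F : numFieldType) (l : W F) : 'End(e7 F) :=
  linfun (e7_br (inW l)).

Definition sigma3 (F : numFieldType) (l : W F) : 'End(e7 F) :=
  (sigma l \o sigma l \o sigma l)%VF.

(* a^i /\ a^j (x) b_k, with indices starting from 1 *)
Definition abk (F : numFieldType) (a : 6.-tuple 'cV[F]_6)
    (b : 3.-tuple 'cV[F]_3) (i j k : nat) : W F :=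
  tensor (wedge a`_i.-1 a`_j.-1) b`_k.-1.

Definition u1 (F : numFieldType) (a : 6.-tuple 'cV[F]_6)
    (b : 3.-tuple 'cV[F]_3) : W F :=
  abk a b 1 2 1 + abk a b 3 4 2 + abk a b 5 6 3.
Definition u2 (F : numFieldType) (a : 6.-tuple 'cV[F]_6)
    (b : 3.-tuple 'cV[F]_3) : W F :=
  abk a b 5 4 1 + abk a b 1 6 2 + abk a b 3 2 3.
Definition u3 (F : numFieldType) (a : 6.-tuple 'cV[F]_6)
    (b : 3.-tuple 'cV[F]_3) : W F :=
  abk a b 3 6 1 + abk a b 5 2 2 + abk a b 1 4 3.

Definition conjS (F : numFieldType) (w z : W F) : Prop :=
  exists (g : 'M[F]_6) (h : 'M[F]_3),
    [/\ \det g = 1, \det h = 1 & z = actS g h w].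

Definition first_family (F : numFieldType) (a : 6.-tuple 'cV[F]_6)
    (b : 3.-tuple 'cV[F]_3) (l : W F) : Prop :=
  exists t1 t2 t3 : F,
    [/\ [/\ t1 != 0, t2 != 0 & t3 != 0],
        [/\ t1 ^+ 3 != t2 ^+ 3, t1 ^+ 3 != t3 ^+ 3 & t2 ^+ 3 != t3 ^+ 3],
        (t1 ^+ 3 + t2 ^+ 3 + t3 ^+ 3) ^+ 3 - (3 * t1 * t2 * t3) ^+ 3 != 0 &
        conjS (t1 *: u1 a b + t2 *: u2 a b + t3 *: u3 a b) l].

(* Main.v *)
From HB Require Import structures.
Require Import Defs.
From mathcomp Require Import all_boot all_order all_algebra all_fingroup.
From mathcomp Require Import boolp classical_sets reals complex ring lra.
Set Implicit Arguments.
Unset Strict Implicit.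
Unset Printing Implicit Defensive.
Import Order.TTheory GRing.Theory Num.Theory VectorInternalTheory.
Local Open Scope ring_scope.

(* On W, sigma(l)^3 is minus w |-> contr(l, cross(l, w)).l; let X be the set of
   the l for which this map has a three-dimensional kernel K(l).  Let c be the
   span of u1, u2, u3.  Explicit linear systems show that an element of c is in
   X if and only if its coefficients satisfy the conditions of the first
   family, and then K(l) = c.

   It remains to see that X is contained in Y = (GL_6 x GL_3).c.  The
   centralizer Z(l) of l in W is contained in K(l), and tau(w, z, v) =
   <cross(w, z), v> is an alternating invariant trilinear form.  If l is in X
   and dim Z(l) >= 3, then Z(l) = K(l), W = h_0.l + Z(l), and Z(l) is abelian.
   By the inverse function theorem a neighbourhood of l is then covered by the
   translates of Z(l).  For l in c this gives an open subset of Y, so that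
   dim Z(l) >= 3 for all l, by semicontinuity of the rank along complex lines.
   For arbitrary l in X, all elements of X near l have kernels conjugate to
   Z(l), so that membership in Y is locally constant on X.  Finally X contains
   the complement of finitely many points of the complex line from an element
   of c to l, so a path inside X joins the two. *)

(** * Signed sums over permutations *)

(** Two facts carry the structural part: [tau] is alternating and invariant, and [contr] is, up to a
    factor 2, adjoint to the action of [h0] for the pairing [dotp] and the trace forms. They turn
    statements on the centralizer of [l] and on the tangent space [h0.l] into orthogonality
    relations. The obstacle is to find, for an arbitrary [l] in X, an element of c in its orbit:
    nothing in the condition on the kernel points to one. Hence the deformation to the fixed point
    [cart 1 2 3]. It can stay inside X because 3 is a lower bound for the dimension of the kernel
    everywhere, inherited from the centralizer, while the upper bound is the nonvanishing of a
    polynomial along a complex line. Orbits are taken under GL_6 x GL_3, since sigma(l)^3 is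
    equivariant up to the factor [\det g * \det h], which does not change kernels. This permits
    group elements of the form 1 + A near the identity, with no exponential map. Determinants are
    normalized only at the end, the conditions on the coefficients being homogeneous. *)

(* Permutations as lists of values, for which parity can be computed. *)
Definition perm_seq n (s : 'S_n) : seq nat := [seq val (s i) | i <- enum 'I_n].

Fixpoint inversions (x : seq nat) : nat :=
  if x is a :: y then (count (fun b => b < a)%N y + inversions y)%N else 0%N.

Lemma size_perm_seq n (s : 'S_n) : size (perm_seq s) = n.
Proof. by rewrite size_map size_enum_ord. Qed.

Lemma nth_perm_seq n (s : 'S_n) (i : 'I_n) : nth 0%N (perm_seq s) i = s i.
Proof. by rewrite (nth_map i) ?size_enum_ord // nth_ord_enum. Qed.

Lemma prod_inversions (x : seq nat) :
  \prod_(i < size x) \prod_(j < size x | (i < j)%N)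
    (-1) ^+ (nth 0%N x j < nth 0%N x i)%N = (-1) ^+ inversions x :> int.
Proof.
elim: x => [|a x IH]; first by rewrite big_ord0.
rewrite /= big_ord_recl exprD; congr (_ * _).
  rewrite big_mkcond big_ord_recl /= mul1r -sum1_count.
  rewrite (big_nth 0%N) big_mkord [in RHS]big_mkcond expr_sum.
  by apply: eq_bigr => i _ /=; case: (_ < _)%N.
rewrite -IH; apply: eq_bigr => i _.
by rewrite big_mkcond big_ord_recl /= mul1r [RHS]big_mkcond.
Qed.

(* Permuting the columns of the Vandermonde matrix of 0, 1, ..., n-1
   multiplies its determinant by the signature. *)
Lemma odd_perm_inversions n (s : 'S_n) : odd_perm s = odd (inversions (perm_seq s)).
Proof.
pose a : 'rV[int]_n := \row_i (i : nat)%:Z.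
pose b : 'rV[int]_n := \row_i (s i : nat)%:Z.
have E : Vandermonde n b = col_perm s (Vandermonde n a).
  by apply/matrixP => i j; rewrite !mxE.
have := congr1 Num.sg (congr1 determinant E).
rewrite col_permE det_mulmx det_perm odd_permV !det_Vandermonde sgrM.
pose sgm := big_morph (@Num.sg int) (@sgrM _) (@sgr1 _).
rewrite !sgm; under eq_bigr do rewrite sgm.
under [X in _ = X * _]eq_bigr do rewrite sgm.
rewrite [X in _ = X * _]big1 ?mul1r => [|i _]; last first.
  by apply: big1 => j ij; rewrite !mxE gtr0_sg // subr_gt0 ltz_nat.
move=> H; apply: (@signr_inj int); rewrite signr_odd -prod_inversions size_perm_seq.
transitivity (Num.sg ((-1) ^+ s : int)); first by rewrite sgrX sgrN1.
rewrite -H; apply: eq_bigr => i _; apply: eq_bigr => j ij; rewrite !mxE !nth_perm_seq.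
case: ltngtP => [lt|lt|/val_inj/perm_inj eij].
- by rewrite ltr0_sg // subr_lt0 ltz_nat.
- by rewrite gtr0_sg // subr_gt0 ltz_nat.
- by rewrite eij ltnn in ij.
Qed.

Lemma perm_seq_permutations n :
  perm_eq [seq perm_seq s | s <- index_enum {perm 'I_n}] (permutations (iota 0 n)).
Proof.
have inj : injective (@perm_seq n).
  by move=> s t e; apply/permP => i; apply: val_inj; rewrite /= -!nth_perm_seq e.
apply: uniq_perm; rewrite ?permutations_uniq ?map_inj_uniq ?index_enum_uniq // => x.
rewrite mem_permutations; apply/mapP/idP => [[s _ ->]|].
  have -> : perm_seq s = [seq val i | i <- [seq s i | i <- enum 'I_n]] by rewrite -map_comp.
  rewrite -val_enum_ord; apply/perm_map/uniq_perm; rewrite ?enum_uniq //.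
    by rewrite map_inj_uniq ?enum_uniq //; apply: perm_inj.
  move=> i; rewrite mem_enum; apply/mapP; exists ((s^-1)%g i); rewrite ?mem_enum //.
  by rewrite permKV.
move=> px; have sx : size x = n by rewrite (perm_size px) size_iota.
have lt (i : 'I_n) : (nth 0 x i < n)%N.
  have: nth 0%N x i \in x by rewrite mem_nth // sx.
  by rewrite (perm_mem px) mem_iota.
have fI : injective (fun i : 'I_n => Ordinal (lt i)).
  move=> i j /(congr1 val) /= /eqP; rewrite nth_uniq ?sx //.
    by move/eqP/val_inj.
  by rewrite (perm_uniq px) iota_uniq.
exists (perm fI); first exact: mem_index_enum.
apply: (@eq_from_nth _ 0%N) => [|m]; rewrite ?size_perm_seq // sx => ltin.
by rewrite -[m]/(val (Ordinal ltin)) nth_perm_seq permE.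
Qed.

(** The right-hand side ranges over an explicit list, which [vm_compute] expands; this is how
    [star], [cross] and the 3 x 3 determinant become formulas in the entries. *)
Lemma sum_perm_seq (V : nmodType) n (G : bool -> seq nat -> V) :
  \sum_(s : 'S_n) G (odd_perm s) (perm_seq s) =
  \sum_(x <- permutations (iota 0 n)) G (odd (inversions x)) x.
Proof.
rewrite -(perm_big _ (perm_seq_permutations n)) big_map.
by apply: eq_bigr => s _; rewrite odd_perm_inversions.
Qed.

(* Entries with indices in [nat], read modulo [n.+1]. *)
Definition ent (F : numFieldType) n (M : 'M[F]_n.+1) (i j : nat) : F :=
  M (inZp i) (inZp j).

Lemma ent_val (F : numFieldType) n (M : 'M[F]_n.+1) (i j : 'I_n.+1) : ent M i j = M i j.
Proof. by rewrite /ent !valZpK. Qed.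

(** For distinct [i], [j] below 6 these are the 24 orderings of the other four indices, with the
    parity of the permutation that ends in [i], [j]. *)
Definition perms4 (i j : nat) : seq (bool * (nat * nat * nat * nat)) :=
  [seq (odd (inversions x), (nth 0 x 0, nth 0 x 1, nth 0 x 2, nth 0 x 3))%N
    | x <- permutations (iota 0 6) & (nth 0 x 4 == i) && (nth 0 x 5 == j)]%N.

Lemma star_mx_perms4 (F : numFieldType) (p q : 'M[F]_6) (i j : 'I_6) :
  star_mx p q i j = (\sum_(y <- perms4 i j)
    (-1) ^+ y.1 * ent p y.2.1.1.1 y.2.1.1.2 * ent q y.2.1.2 y.2.2) / 4.
Proof.
rewrite mxE; congr (_ / _); rewrite big_map big_filter big_mkcond /=.
rewrite [RHS]big_mkcond.
pose G (b : bool) (x : seq nat) := if (nth 0 x 4 == i) && (nth 0 x 5 == j) then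
  (-1) ^+ b * ent p (nth 0 x 0) (nth 0 x 1) * ent q (nth 0 x 2) (nth 0 x 3) else 0.
have := sum_perm_seq 6 G; rewrite /G /= => <-; apply: eq_bigr => s _.
have E k : nth 0%N (perm_seq s) (k : 'I_6) = s k by rewrite nth_perm_seq.
have := (E 0, E 1, E 2, E 3, E 4, E 5) => /= {}E.
by rewrite !E !ent_val.
Qed.

Lemma ent_alt (F : numFieldType) (p : alt F 6) i j :
  ent (vsval p) j i = - ent (vsval p) i j.
Proof.
by have := trmx_alt p => /matrixP/(_ (inZp i) (inZp j)); rewrite !mxE.
Qed.

Definition ent_altE (F : numFieldType) (p : alt F 6) := (ent_alt p 0 1, ent_alt p 0 2, ent_alt p 0 3,
  ent_alt p 0 4, ent_alt p 0 5, ent_alt p 1 2, ent_alt p 1 3, ent_alt p 1 4, ent_alt p 1 5, ent_alt p 2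
  3, ent_alt p 2 4, ent_alt p 2 5, ent_alt p 3 4, ent_alt p 3 5, ent_alt p 4 5).

(** The coefficient of the 4-form p /\ q on the indices a, b, c, d: one term for each splitting of
    the indices into an ordered pair of pairs. *)
Definition wedge4 (F : numFieldType) (p q : 'M[F]_6) (a b c d : nat) : F :=
  ent p a b * ent q c d + ent p c d * ent q a b
  - ent p a c * ent q b d - ent p b d * ent q a c
  + ent p a d * ent q b c + ent p b c * ent q a d.

(** The list [r] contains the remaining four indices in increasing order, and the sign is that of
    the permutation listing [r], then [i], [j]. The 24 terms fall into six groups of four equal
    ones, which cancels the division by 4 in [star_mx]. *)
Lemma ent_star (F : numFieldType) (p q : alt F 6) i j : (i < j < 6)%N ->
  let r := [seq x <- iota 0 6 | (x != i) && (x != j)] in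
  ent (vsval (star p q)) i j = (-1) ^+ (i + j).+1 *
    wedge4 (vsval p) (vsval q) (nth 0 r 0) (nth 0 r 1) (nth 0 r 2) (nth 0 r 3)%N.
Proof.
rewrite /wedge4 {1}/ent [vsval (star p q)]/= star_mx_perms4 => /andP[+ j6].
move: j j6 => [|[|[|[|[|[|j]]]]]] // _; move: i => [|[|[|[|[|i]]]]] // _;
  match goal with |- context [perms4 ?i ?j] =>
   let x := eval vm_compute in (perms4 i j) in
   have -> : perms4 i j = x by vm_compute end;
  rewrite !big_cons big_nil /= !(ent_altE p) !(ent_altE q) -[in RHS]signr_odd /= ?expr0 ?expr1;
  repeat match goal with |- context [ent ?a ?b ?c] => move: (ent a b c) => ? end.
all: by field.
Qed.

(** * The invariant trilinear form *)

(** Reading indices modulo 3 gives the three components of the cross product a single cyclic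
    form. *)
Lemma cross_inZp (F : numFieldType) (w z : W F) k : (k < 3)%N ->
  cross w z (inZp k) =
  star (w (inZp k.+1)) (z (inZp k.+2)) - star (w (inZp k.+2)) (z (inZp k.+1)).
Proof.
move=> k3; rewrite ffunE big_mkcond /=.
pose G (b : bool) (x : seq nat) := if nth 0%N x 2 == k then
  (-1) ^+ b *: star (w (inZp (nth 0%N x 0))) (z (inZp (nth 0%N x 1))) else 0.
transitivity (\sum_(s : 'S_3) G (odd_perm s) (perm_seq s)).
  apply: eq_bigr => s _; rewrite /G.
  have E m : nth 0%N (perm_seq s) (m : 'I_3) = s m by rewrite nth_perm_seq.
  have := (E 0, E 1, E 2) => /= {}E; rewrite !E !valZpK.
  by rewrite -val_eqE /= modn_small.
rewrite sum_perm_seq {}/G.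
let y := eval vm_compute in (permutations (iota 0 3)) in
have -> : permutations (iota 0 3) = y by vm_compute.
rewrite !big_cons big_nil /= expr0 expr1 !scale1r !scaleN1r.
have Z (n : nat) : inZp n.+3 = inZp n :> 'I_3 by apply: val_inj; rewrite /= -addn3 modnDr.
by move: k k3 => [|[|[|]]] //= _; rewrite ?Z ?addr0 ?add0r // addrC.
Qed.

(* Up to a scalar, the polarized Pfaffian. *)
Definition tau6 (F : numFieldType) (p q r : 'M[F]_6) : F :=
  \sum_(s : 'S_6) (-1) ^+ s * p (s 0) (s 1) * q (s 2) (s 3) * r (s 4) (s 5).

(** The entry [(i, j)] of [star] collects the permutations ending in [i], [j]; pairing with [r]
    fills these two slots and restores the full sum over ['S_6]. *)
Lemma tau6_star (F : numFieldType) (p q : alt F 6) (r : 'M[F]_6) :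
  \tr (vsval (star p q) *m r^T) = tau6 (vsval p) (vsval q) r / 4.
Proof.
rewrite /mxtrace; under eq_bigr do rewrite mxE; rewrite /=.
under eq_bigr do under eq_bigr do rewrite !mxE -mulrAC.
under eq_bigr do rewrite -mulr_suml.
rewrite -mulr_suml; congr (_ / _).
under eq_bigr do under eq_bigr do rewrite mulr_suml.
rewrite pair_bigA /= (exchange_big_dep xpredT) //=; apply: eq_bigr => s _.
rewrite (big_pred1 (s 4, s 5)) // => -[i j] /=.
by rewrite xpair_eqE ![s _ == _]eq_sym.
Qed.

(** Exchanging the positions 0, 1 with 2, 3 is an even permutation, so no sign appears. *)
Lemma tau6C12 (F : numFieldType) (p q r : 'M[F]_6) : tau6 p q r = tau6 q p r.
Proof.
pose c : 'S_6 := mulg (tperm 0 2) (tperm 1 3).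
have cE : (c 0 = 2) * (c 1 = 3) * (c 2 = 0) * (c 3 = 1) * (c 4 = 4) * (c 5 = 5).
  by rewrite /c; do ?split; rewrite permM !permE /=; apply/val_inj.
rewrite /tau6 (reindex_inj (mulgI c)) /=; apply: eq_bigr => s _.
rewrite !(permM c) !cE odd_permM /c odd_permM !odd_tperm /=.
by rewrite -!mulrA; congr (_ * _); rewrite mulrCA.
Qed.

Lemma tau6C23 (F : numFieldType) (p q r : 'M[F]_6) : tau6 p q r = tau6 p r q.
Proof.
pose c : 'S_6 := mulg (tperm 2 4) (tperm 3 5).
have cE : (c 0 = 0) * (c 1 = 1) * (c 2 = 4) * (c 3 = 5) * (c 4 = 2) * (c 5 = 3).
  by rewrite /c; do ?split; rewrite permM !permE /=; apply/val_inj.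
rewrite /tau6 (reindex_inj (mulgI c)) /=; apply: eq_bigr => s _.
rewrite !(permM c) !cE odd_permM /c odd_permM !odd_tperm /=.
by rewrite mulrAC.
Qed.

Lemma tau6_scalar (F : numFieldType) (q r : 'M[F]_6) : scalar (fun p => tau6 p q r).
Proof.
move=> c p p'; rewrite mulr_sumr -big_split; apply: eq_bigr => s _ /=.
rewrite !mxE.
rewrite mulrDr !mulrDl mulrCA.
by rewrite !mulrA.
Qed.

(** On rank-one arguments the definition is the Leibniz formula. The arguments of [tau6] are
    arbitrary matrices, and not only skew ones, in order to allow this specialization. *)
Lemma tau6_rank1 (F : numFieldType) (M : 'M[F]_6) :
  tau6 ((row 0 M)^T *m row 1 M) ((row 2 M)^T *m row 3 M) ((row 4 M)^T *m row 5 M)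
  = \det M.
Proof.
apply: eq_bigr => s _; rewrite -!mulrA; congr (_ * _).
rewrite !mxE !big_ord1 !mxE !big_ord_recl big_ord0 mulr1 -!mulrA.
by do ![congr (M _ (s _) * _) || congr (M _ (s _)); try exact/val_inj].
Qed.

Lemma scalar_sum (F : numFieldType) (V : lmodType F) (f : V -> F) (I : finType)
  (c : I -> F) (u : I -> V) : scalar f -> f (\sum_i c i *: u i) = \sum_i c i * f (u i).
Proof.
move=> fL; have f0 : f 0 = 0.
  by have := fL (-1) 0 0; rewrite scaler0 addr0 mulN1r addNr.
apply: (big_rec2 (fun x y => f x = y)) => // i y _ _ <-.
by rewrite -[X in _ = X + _]/(c i * f (u i)) -fL.
Qed.

Definition trilin (F : numFieldType) (V : lmodType F) (f : V -> V -> V -> F) :=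
  [/\ forall q r c x y, f (c *: x + y) q r = c * f x q r + f y q r,
      forall p r c x y, f p (c *: x + y) r = c * f p x r + f p y r &
      forall p q c x y, f p q (c *: x + y) = c * f p q x + f p q y].

Lemma mx_sum_rank1 (F : numFieldType) n (p : 'M[F]_n) :
  p = \sum_(x : 'I_n * 'I_n) p x.1 x.2 *:
        ((delta_mx 0 x.1 : 'rV_n)^T *m (delta_mx 0 x.2 : 'rV_n)).
Proof.
rewrite [LHS]matrix_sum_delta pair_bigA; apply: eq_bigr => x _ /=.
by rewrite trmx_delta mul_delta_mx.
Qed.

(** Rank-one matrices span all matrices. Together with [tau6_rank1] this reduces the invariance of
    [tau6] to identities between determinants. *)
Lemma trilin_ext (F : numFieldType) n (f g : 'M[F]_n -> 'M[F]_n -> 'M[F]_n -> F) :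
  trilin f -> trilin g ->
  (forall x y z t u v : 'rV_n, f (x^T *m y) (z^T *m t) (u^T *m v) =
                              g (x^T *m y) (z^T *m t) (u^T *m v)) ->
  forall p q r, f p q r = g p q r.
Proof.
move=> [f1 f2 f3] [g1 g2 g3] fg p q r.
rewrite (mx_sum_rank1 p) (@scalar_sum _ _ (fun x => f x q r) _ _ _ (f1 _ _)) (@scalar_sum _ _ (fun x =>
  g x q r) _ _ _ (g1 _ _)).
apply: eq_bigr => x _; congr (_ * _).
rewrite (mx_sum_rank1 q) (@scalar_sum _ _ (fun x => f _ x r) _ _ _ (f2 _ _)) (@scalar_sum _ _ (fun x =>
  g _ x r) _ _ _ (g2 _ _)).
apply: eq_bigr => y _; congr (_ * _).
rewrite (mx_sum_rank1 r) (@scalar_sum _ _ (fun x => f _ _ x) _ _ _ (f3 _ _)) (@scalar_sum _ _ (fun x =>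
  g _ _ x) _ _ _ (g3 _ _)).
by apply: eq_bigr => z _; congr (_ * _).
Qed.

Lemma tau6_trilin (F : numFieldType) : trilin (@tau6 F).
Proof.
split=> q r; first exact: tau6_scalar.
  by have E x : tau6 q x r = tau6 x q r := tau6C12 q x r;
     move=> c p p'; rewrite !E tau6_scalar.
have E x : tau6 q r x = tau6 x q r by rewrite (tau6C23 q r) (tau6C12 q x).
by move=> c p p'; rewrite !E tau6_scalar.
Qed.

Lemma trilin_comp (F : numFieldType) n (f : 'M[F]_n -> 'M[F]_n -> 'M[F]_n -> F)
  (a b c : 'M[F]_n -> 'M[F]_n) : linear a -> linear b -> linear c ->
  trilin f -> trilin (fun p q r => f (a p) (b q) (c r)).
Proof.
by move=> aL bL cL [f1 f2 f3]; split=> q r k x y; rewrite (aL, bL, cL) (f1, f2, f3).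
Qed.

Definition rows6 (F : numFieldType) (x y z t u v : 'rV[F]_6) : 'M[F]_6 :=
  \matrix_(i < 6) nth 0 [:: x; y; z; t; u; v] i.

Lemma tau6_rows (F : numFieldType) (x y z t u v : 'rV[F]_6) :
  tau6 (x^T *m y) (z^T *m t) (u^T *m v) = \det (rows6 x y z t u v).
Proof. by rewrite -tau6_rank1 !rowK. Qed.

Lemma tau6_congr (F : numFieldType) (g p q r : 'M[F]_6) :
  tau6 (g *m p *m g^T) (g *m q *m g^T) (g *m r *m g^T) = \det g * tau6 p q r.
Proof.
have gL : linear (fun p => g *m p *m g^T).
  by move=> c m m'; rewrite mulmxDr mulmxDl -scalemxAr -scalemxAl.
apply: (trilin_ext (trilin_comp gL gL gL (@tau6_trilin F)) (g := fun p q r => \det g * tau6 p q r)).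
  have [t1 t2 t3] := @tau6_trilin F.
  by split=> a b c x y /=; rewrite (t1, t2, t3) mulrDr mulrCA.
have E (x y : 'rV[F]_6) : g *m (x^T *m y) *m g^T = (x *m g^T)^T *m (y *m g^T).
  by rewrite trmx_mul trmxK !mulmxA.
move=> x y z t u v; rewrite !E !tau6_rows -[X in X * _]det_tr mulrC -det_mulmx.
congr (\det _); apply/row_matrixP => i; rewrite row_mul !rowK.
by case: i => [[|[|[|[|[|[|i]]]]]] i6].
Qed.

Lemma det_row_replace (F : numFieldType) n (M : 'M[F]_n) (v : 'rV[F]_n) i :
  \det (\matrix_k (if k == i then v else row k M)) = \sum_j v 0 j * cofactor M i j.
Proof.
rewrite (expand_det_row _ i); apply: eq_bigr => j _; rewrite !mxE eqxx; congr (_ * _).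
rewrite /cofactor; congr (_ * \det _); apply/matrixP => a b.
by rewrite !mxE lift_eqF mxE.
Qed.

(** The derivative of the determinant in the direction [M *m A]: expanding each summand along its
    replaced row gives the trace of [M *m A *m \adj M]. *)
Lemma sum_det_row_der (F : numFieldType) n (M A : 'M[F]_n) :
  \sum_i \det (\matrix_k (if k == i then row i (M *m A) else row k M)) = \tr A * \det M.
Proof.
under eq_bigr do rewrite det_row_replace.
transitivity (\tr (M *m A *m \adj M)).
  apply: eq_bigr => i _; rewrite mxE; apply: eq_bigr => j _.
  by rewrite !mxE.
by rewrite mxtrace_mulC mulmxA mul_adj_mx mul_scalar_mx mxtraceZ mulrC.
Qed.

(** The infinitesimal form of [tau6_congr]. On rank-one arguments the six terms on the left are the
    six row replacements of [sum_det_row_der]. *)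
Lemma tau6_der (F : numFieldType) (A p q r : 'M[F]_6) :
  tau6 (A *m p + p *m A^T) q r + tau6 p (A *m q + q *m A^T) r
    + tau6 p q (A *m r + r *m A^T) = \tr A * tau6 p q r.
Proof.
have aL : linear (fun p => A *m p + p *m A^T).
  by move=> c m m'; rewrite mulmxDr mulmxDl -scalemxAr -scalemxAl scalerDr addrACA.
have iL : linear (fun p : 'M[F]_6 => p) by [].
have T := @tau6_trilin F; have [t1 t2 t3] := T.
have [a1 a2 a3] := trilin_comp aL iL iL T.
have [b1 b2 b3] := trilin_comp iL aL iL T.
have [c1 c2 c3] := trilin_comp iL iL aL T.
apply: (trilin_ext (f := fun p q r => tau6 (A *m p + p *m A^T) q r
    + tau6 p (A *m q + q *m A^T) r + tau6 p q (A *m r + r *m A^T))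
  (g := fun p q r => \tr A * tau6 p q r)).
- have D (c x x' y y' z z' : F) : c * x + x' + (c * y + y') + (c * z + z')
      = c * (x + y + z) + (x' + y' + z') by ring.
  by split=> ? ? c x y; rewrite -D ?(a1, a2, a3) ?(b1, b2, b3) ?(c1, c2, c3).
- by split=> a b c x y; rewrite (t1, t2, t3) mulrDr mulrCA.
have E (x y : 'rV[F]_6) : A *m (x^T *m y) + x^T *m y *m A^T
    = 1 *: ((x *m A^T)^T *m y) + x^T *m (y *m A^T).
  by rewrite scale1r trmx_mul trmxK !mulmxA.
move=> x y z t u v; rewrite !E (t1, t2, t3) (t1, t2, t3) (t1, t2, t3) !mul1r !tau6_rows.
rewrite -[in RHS]mxtrace_tr -sum_det_row_der !big_ord_recl big_ord0 addr0 !addrA.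
do ![congr (_ + _)]; congr (\det _); apply/row_matrixP => i; rewrite !rowK ?row_mul ?rowK;
by case: i => [[|[|[|[|[|[|i]]]]]] i6].
Qed.

Lemma sum_ord3 (V : nmodType) (f : 'I_3 -> V) :
  \sum_i f i = f (inZp 0) + f (inZp 1) + f (inZp 2).
Proof.
rewrite !big_ord_recl big_ord0 addr0 addrA.
by congr (f _ + f _ + f _); apply: val_inj.
Qed.

Lemma det_ord3 (F : numFieldType) (M : 'M[F]_3) : \det M =
    ent M 0 0 * ent M 1 1 * ent M 2 2 - ent M 0 0 * ent M 1 2 * ent M 2 1
  + ent M 0 1 * ent M 1 2 * ent M 2 0 - ent M 0 1 * ent M 1 0 * ent M 2 2
  + ent M 0 2 * ent M 1 0 * ent M 2 1 - ent M 0 2 * ent M 1 1 * ent M 2 0.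
Proof.
rewrite /determinant.
pose G (b : bool) (x : seq nat) :=
  (-1) ^+ b * (ent M 0 (nth 0%N x 0) * ent M 1 (nth 0%N x 1) * ent M 2 (nth 0%N x 2)) : F.
transitivity (\sum_(s : 'S_3) G (odd_perm s) (perm_seq s)).
  apply: eq_bigr => s _; rewrite /G; congr (_ * _).
  have E m : nth 0%N (perm_seq s) (m : 'I_3) = s m by rewrite nth_perm_seq.
  have := (E 0, E 1, E 2) => /= {}E; rewrite !E /ent !valZpK.
  rewrite !big_ord_recl big_ord0 mulr1 mulrA.
  by congr (M _ (s _) * M _ (s _) * M _ (s _)); apply: val_inj.
rewrite sum_perm_seq {}/G.
let y := eval vm_compute in (permutations (iota 0 3)) in
have -> : permutations (iota 0 3) = y by vm_compute.
rewrite !big_cons big_nil /= expr0 expr1.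
repeat match goal with |- context [ent ?a ?b ?c] => move: (ent a b c) => ? end.
ring.
Qed.

(** Each trace counts a pair i < j twice, so this is twice the pairing of [W] and [Wd]. *)
Definition dotp (F : numFieldType) (w x : {ffun 'I_3 -> alt F 6}) : F :=
  \sum_k \tr (vsval (w k) *m (vsval (x k))^T).

Definition tau (F : numFieldType) (w z v : W F) : F := dotp (cross w z) v.

Definition tau6w (F : numFieldType) (w z v : W F) i j k : F :=
  tau6 (vsval (w (inZp i))) (vsval (z (inZp j))) (vsval (v (inZp k))).

(** The signs come from the six permutations of the three components of F^3; as [tau6] is symmetric,
    [tau] is alternating. *)
Lemma tauE (F : numFieldType) (w z v : W F) : tau w z v =
  (tau6w w z v 1 2 0 - tau6w w z v 2 1 0 + tau6w w z v 2 0 1 - tau6w w z v 0 2 1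
    + tau6w w z v 0 1 2 - tau6w w z v 1 0 2) / 4.
Proof.
have Z (n : nat) : inZp n.+3 = inZp n :> 'I_3 by apply: val_inj; rewrite /= -addn3 modnDr.
rewrite /tau /dotp sum_ord3 !cross_inZp // !Z.
rewrite !(raddfB vsval) !mulmxBl !(raddfB (@mxtrace F 6)) /= !tau6_star.
rewrite -/(tau6w w z v 1 2 0) -/(tau6w w z v 2 1 0) -/(tau6w w z v 2 0 1).
rewrite -/(tau6w w z v 0 2 1) -/(tau6w w z v 0 1 2) -/(tau6w w z v 1 0 2).
repeat match goal with |- context [tau6w w z v ?a ?b ?c] => move: (tau6w w z v a b c) => ? end.
by field.
Qed.

Lemma tau_swap23 (F : numFieldType) (w z v : W F) : tau w z v = - tau w v z.
Proof.
have E i j k : tau6w w v z i j k = tau6w w z v i k j by rewrite /tau6w tau6C23.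
rewrite !tauE !E.
repeat match goal with |- context [tau6w w z v ?a ?b ?c] => move: (tau6w w z v a b c) => ? end.
by field.
Qed.

Lemma tau_swap12 (F : numFieldType) (w z v : W F) : tau w z v = - tau z w v.
Proof.
have E i j k : tau6w z w v i j k = tau6w w z v j i k by rewrite /tau6w tau6C12.
rewrite !tauE !E.
repeat match goal with |- context [tau6w w z v ?a ?b ?c] => move: (tau6w w z v a b c) => ? end.
by field.
Qed.

(** * The group action, its derivative, and duality *)

Lemma actSE (F : numFieldType) (g : 'M[F]_6) (h : 'M[F]_3) (w : W F) k :
  vsval (actS g h w k) = \sum_m h k m *: (g *m vsval (w m) *m g^T).
Proof. by rewrite ffunE linear_sum; apply: eq_bigr => m _; rewrite linearZ. Qed.

Lemma derE (F : numFieldType) (A : 'M[F]_6) (B : 'M[F]_3) w k :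
  vsval (der A B w k) = A *m vsval (w k) + vsval (w k) *m A^T
    + \sum_m B k m *: vsval (w m).
Proof.
by rewrite ffunE linearD linear_sum /=; congr (_ + _); apply: eq_bigr => m _; rewrite linearZ.
Qed.

Lemma actS_comp (F : numFieldType) (g g' : 'M[F]_6) (h h' : 'M[F]_3) (w : W F) :
  actS g h (actS g' h' w) = actS (g *m g') (h *m h') w.
Proof.
apply/ffunP => k; apply: val_inj => /=; rewrite !actSE.
under [RHS]eq_bigr => m _ do rewrite /= mxE scaler_suml /=.
rewrite exchange_big; apply: eq_bigr => m _ /=; rewrite actSE mulmx_sumr mulmx_suml.
rewrite scaler_sumr; apply: eq_bigr => n _.
by rewrite -!scalemxAr -!scalemxAl scalerA trmx_mul !mulmxA.
Qed.

Lemma actS1 (F : numFieldType) (w : W F) : actS 1%:M 1%:M w = w.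
Proof.
apply/ffunP => k; apply: val_inj => /=; rewrite actSE (bigD1 k) //= big1 ?addr0.
  by rewrite trmx1 mulmx1 mul1mx mxE eqxx scale1r.
by move=> m mk; rewrite mxE eq_sym (negPf mk) scale0r.
Qed.

Lemma vsval_lin (F : numFieldType) c (w z : W F) k :
  vsval ((c *: w + z) k) = c *: vsval (w k) + vsval (z k).
Proof. by rewrite 2!ffunE linearP. Qed.

Lemma actS_is_linear (F : numFieldType) (g : 'M[F]_6) (h : 'M[F]_3) : linear (actS g h).
Proof.
move=> c w z; apply/ffunP => k; apply: val_inj.
rewrite [RHS]vsval_lin [LHS]actSE !actSE.
rewrite scaler_sumr -big_split; apply: eq_bigr => m _ /=.
by rewrite vsval_lin mulmxDr mulmxDl -scalemxAr -scalemxAl scalerDr !scalerA mulrC.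
Qed.
HB.instance Definition _ (F : numFieldType) (g : 'M[F]_6) (h : 'M[F]_3) :=
  GRing.isLinear.Build F (W F) (W F) _ (actS g h) (@actS_is_linear F g h).
HB.instance Definition _ (F : numFieldType) (l : W F) :=
  GRing.isLinear.Build F (W F) (Wd F) _ (cross l) (@cross_is_linear F l).

Lemma dotp_actS (F : numFieldType) (g g' : 'M[F]_6) (h h' : 'M[F]_3) (w x : W F) :
  g^T *m g' = 1%:M -> h^T *m h' = 1%:M ->
  dotp (actS g h w) (actS g' h' x) = dotp w x.
Proof.
move=> gg hh; have gg' : g'^T *m g = 1%:M by rewrite -[RHS]trmx1 -gg trmx_mul trmxK.
rewrite /dotp.
transitivity (\sum_k \sum_m \sum_n h k m * h' k n * \tr (vsval (w m) *m (vsval (x n))^T)).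
  apply: eq_bigr => k _; rewrite !actSE mulmx_suml linear_sum; apply: eq_bigr => m _ /=.
  rewrite linear_sum mulmx_sumr linear_sum; apply: eq_bigr => n _ /=.
  rewrite linearZ -scalemxAr -scalemxAl scalerA linearZ /= (mulrC (h' k n)); congr (_ * _).
  rewrite !trmx_mul trmxK -!mulmxA mxtrace_mulC -!mulmxA gg' mulmx1.
  by rewrite (mulmxA _ g') gg mul1mx.
rewrite exchange_big; apply: eq_bigr => m _ /=; rewrite exchange_big (bigD1 m) //=.
rewrite [X in _ + X]big1 ?addr0 => [|n nm]; rewrite -mulr_suml.
  have /matrixP/(_ m m) := hh; rewrite !mxE eqxx => E.
  rewrite -[RHS]mul1r; congr (_ * _); transitivity (true%:R : F) => //.
  by rewrite -E; apply: eq_bigr => k _; rewrite mxE.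
have /matrixP/(_ m n) := hh; rewrite !mxE eq_sym (negPf nm) => E.
by rewrite (_ : \sum_i _ = 0) ?mul0r // -[RHS]E; apply: eq_bigr => k _; rewrite mxE.
Qed.

Lemma dotpC (F : numFieldType) (w x : W F) : dotp w x = dotp x w.
Proof.
by apply: eq_bigr => k _; rewrite -mxtrace_tr trmx_mul trmxK.
Qed.

Lemma dotp_linr (F : numFieldType) (w x y : W F) c :
  dotp w (c *: x + y) = c * dotp w x + dotp w y.
Proof.
rewrite mulr_sumr -big_split; apply: eq_bigr => k _ /=.
by rewrite vsval_lin linearP mulmxDr -scalemxAr linearP.
Qed.

Lemma dotp_linl (F : numFieldType) (w x y : W F) c :
  dotp (c *: x + y) w = c * dotp x w + dotp y w.
Proof. by rewrite !(dotpC _ w) dotp_linr. Qed.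

Definition basisW (F : numFieldType) (k : 'I_3) (i j : 'I_6) : W F :=
  tensor (wedge (delta_mx i 0) (delta_mx j 0)) (delta_mx k 0).

Lemma basisWE (F : numFieldType) (k : 'I_3) (i j : 'I_6) m :
  vsval (basisW F k i j m) = (m == k)%:R *: (delta_mx i j - delta_mx j i).
Proof. by rewrite ffunE linearZ /= !trmx_delta !mul_delta_mx mxE eqxx andbT. Qed.

(** The sum runs over all [i], [j], which avoids a basis indexed by i < j. The terms for (i, j) and
    (j, i) are equal, hence the division by 2. *)
Lemma W_decomp (F : numFieldType) (w : W F) :
  w = \sum_k \sum_i \sum_j (vsval (w k) i j / 2) *: basisW F k i j.
Proof.
apply/ffunP => m; apply: val_inj => /=; rewrite sum_ffunE linear_sum /=.
rewrite (bigD1 m) //= [X in _ + X]big1 ?addr0 => [|k km]; last first.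
  rewrite sum_ffunE linear_sum big1 // => i _; rewrite sum_ffunE linear_sum big1 // => j _.
  by rewrite ffunE linearZ /= basisWE eq_sym (negPf km) scale0r scaler0.
rewrite sum_ffunE linear_sum /=.
transitivity (\sum_i \sum_j (vsval (w m) i j / 2) *: (delta_mx i j - delta_mx j i)).
  under eq_bigr do under eq_bigr do rewrite scalerBr.
  under eq_bigr do rewrite big_split /=; rewrite big_split /=.
  rewrite [X in _ + X]exchange_big -big_split /=.
  rewrite [LHS]matrix_sum_delta; apply: eq_bigr => i _.
  rewrite -big_split; apply: eq_bigr => j _ /=.
  have /matrixP/(_ i j) := trmx_alt (w m); rewrite !mxE => ->.
  by rewrite -scalerBl mulNr opprK -splitr.
apply: eq_bigr => i _; rewrite sum_ffunE linear_sum; apply: eq_bigr => j _.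
by rewrite ffunE linearZ /= basisWE eqxx scale1r.
Qed.

Lemma mxtrace_mul_delta (F : numFieldType) n (M : 'M[F]_n) a b :
  \tr (M *m delta_mx a b) = M b a.
Proof.
rewrite /mxtrace (bigD1 b) //= [X in _ + X]big1 ?addr0 => [|i ib].
  rewrite mxE (bigD1 a) //= big1 ?addr0 ?mxE ?eqxx ?mulr1 // => j ja.
  by rewrite mxE (negPf ja) mulr0.
by rewrite mxE big1 // => j _; rewrite mxE (negPf ib) andbF mulr0.
Qed.

Lemma dotp_basisW (F : numFieldType) (w : W F) k i j :
  dotp w (basisW F k i j) = 2 * vsval (w k) i j.
Proof.
rewrite /dotp (bigD1 k) //= big1 ?addr0 => [|m mk]; last first.
  by rewrite basisWE (negPf mk) scale0r trmx0 mulmx0 mxtrace0.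
rewrite basisWE eqxx scale1r linearB /= !trmx_delta mulmxBr linearB /= !mxtrace_mul_delta.
have /matrixP/(_ i j) := trmx_alt (w k); rewrite !mxE => ->.
by rewrite opprK -mulr2n mulr_natl.
Qed.

Lemma dotp_eq0 (F : numFieldType) (x : W F) : (forall w, dotp w x = 0) -> x = 0.
Proof.
move=> x0; rewrite (W_decomp x) big1 // => k _; rewrite big1 // => i _.
rewrite big1 // => j _; have /eqP := x0 (basisW F k i j).
rewrite dotpC dotp_basisW mulf_eq0 pnatr_eq0 /= => /eqP ->.
by rewrite mul0r scale0r.
Qed.

Lemma scalar_sum1 (F : numFieldType) (V : lmodType F) (f : V -> F) (I : finType)
  (u : I -> V) : scalar f -> f (\sum_i u i) = \sum_i f (u i).
Proof.
move=> fL; under eq_bigr do rewrite -[u _]scale1r.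
by rewrite (scalar_sum _ _ fL); under eq_bigr do rewrite mul1r.
Qed.

Lemma dotp_representable (F : numFieldType) (f : W F -> F) :
  scalar f -> exists x : W F, forall w, f w = dotp w x.
Proof.
(* By [W_decomp], [f w] is the sum of the entries of [w] times half the values of [f] on the
   [basisW k i j]; these halves are the entries of the representing element. *)
move=> fL; pose c k i j := f (basisW F k i j) / 2.
have cN k i j : c k j i = - c k i j.
  have E : basisW F k j i = (-1) *: basisW F k i j + 0.
    apply/ffunP => m; apply: val_inj; rewrite [RHS]vsval_lin !basisWE.
    rewrite (_ : vsval ((0 : W F) m) = 0) ?addr0; last by rewrite ffunE.
    by rewrite [LHS]basisWE scaleN1r -scalerN opprB.
  have f0 : f 0 = 0 by have := fL (-1) 0 0; rewrite scaler0 addr0 mulN1r addNr.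
  by rewrite /c E fL f0 addr0 mulN1r mulNr.
have xA k : \matrix_(i, j) c k i j \in altv F 6.
  by apply/altvP/matrixP => i j; rewrite !mxE cN.
exists [ffun k => Subvs (xA k)] => w.
rewrite {1}(W_decomp w) (scalar_sum1 _ fL); apply: eq_bigr => k _.
rewrite (scalar_sum1 _ fL); apply: eq_bigr => i _; rewrite (scalar_sum _ _ fL) mxE.
apply: eq_bigr => j _.
by rewrite ffunE /= !mxE mulrAC mulrA.
Qed.

(** Each coordinate of [w - projv S w] is a linear form vanishing on [S], hence of the form
    [dotp w x]; if all such forms kill [v], then [v] equals its projection. *)
Lemma dotp_separates (F : numFieldType) (S : {vspace W F}) (v : W F) :
  (forall x, (forall w, w \in S -> dotp w x = 0) -> dotp v x = 0) -> v \in S.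
Proof.
move=> vS; suff: v - projv S v = 0.
  by move/eqP; rewrite subr_eq0 => /eqP ->; rewrite memv_proj.
apply: v2r_inj; rewrite linear0; apply/rowP => i; rewrite [RHS]mxE.
have fL : scalar (fun w : W F => v2r (w - projv S w) 0 i).
  move=> c w z; rewrite linearP /= opprD addrACA -scalerBr linearP.
  by rewrite !mxE.
have [x fx] := dotp_representable fL.
rewrite fx; apply: vS => w wS; rewrite -fx projv_id // subrr linear0.
by rewrite mxE.
Qed.

Ltac gen_tau6w := repeat match goal with |- context [@tau6w ?F ?w ?z ?v ?a ?b ?c] =>
  move: (@tau6w F w z v a b c) => ? end.
Ltac gen_ent := repeat match goal with |- context [@ent ?F ?n ?M ?a ?b] =>
  move: (@ent F n M a b) => ? end.

Lemma tau6w_actS (F : numFieldType) (g : 'M[F]_6) (h : 'M[F]_3) (w z v : W F) i j k :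
  tau6w (actS g h w) (actS g h z) (actS g h v) i j k =
  \sum_m h (inZp i) m * \sum_n h (inZp j) n * \sum_o h (inZp k) o *
     (\det g * tau6w w z v m n o).
Proof.
have [t1 t2 t3] := @tau6_trilin F.
rewrite /tau6w !actSE (@scalar_sum _ _ (fun p => tau6 p _ _)) => [|c x y]; last exact: t1.
apply: eq_bigr => m _; congr (_ * _).
rewrite (@scalar_sum _ _ (fun p => tau6 _ p _)) => [|c x y]; last exact: t2.
apply: eq_bigr => n _; congr (_ * _).
rewrite (@scalar_sum _ _ (fun p => tau6 _ _ p)) => [|c x y]; last exact: t3.
by apply: eq_bigr => o _; rewrite tau6_congr !valZpK.
Qed.

Lemma tau_actS (F : numFieldType) (g : 'M[F]_6) (h : 'M[F]_3) (w z v : W F) :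
  tau (actS g h w) (actS g h z) (actS g h v) = \det g * \det h * tau w z v.
Proof.
rewrite !tauE !tau6w_actS !sum_ord3 det_ord3.
rewrite -![h (inZp _) (inZp _)]/(ent h _ _).
rewrite ![nat_of_ord (inZp _)]/=; move: (\det g) => d.
gen_ent; gen_tau6w. by field.
Qed.

Lemma tau6w_der (F : numFieldType) (A : 'M[F]_6) (B : 'M[F]_3) (w z v : W F) i j k :
  tau6w (der A B w) z v i j k + tau6w w (der A B z) v i j k
    + tau6w w z (der A B v) i j k =
  \tr A * tau6w w z v i j k + \sum_m B (inZp i) m * tau6w w z v m j k
    + \sum_m B (inZp j) m * tau6w w z v i m k + \sum_m B (inZp k) m * tau6w w z v i j m.
Proof.
have [t1 t2 t3] := @tau6_trilin F.
have a1 (x y q r : 'M[F]_6) : tau6 (x + y) q r = tau6 x q r + tau6 y q r.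
  by have := t1 q r 1 x y; rewrite scale1r mul1r.
have a2 (x y q r : 'M[F]_6) : tau6 q (x + y) r = tau6 q x r + tau6 q y r.
  by have := t2 q r 1 x y; rewrite scale1r mul1r.
have a3 (x y q r : 'M[F]_6) : tau6 q r (x + y) = tau6 q r x + tau6 q r y.
  by have := t3 q r 1 x y; rewrite scale1r mul1r.
rewrite -tau6_der /tau6w !derE (a1 (A *m _ + _)) (a2 (A *m _ + _)) (a3 (A *m _ + _)).
rewrite (@scalar_sum _ _ (fun p => tau6 p _ _)); last by move=> c x y; exact: t1.
rewrite (@scalar_sum _ _ (fun p => tau6 _ p _)); last by move=> c x y; exact: t2.
rewrite (@scalar_sum _ _ (fun p => tau6 _ _ p)); last by move=> c x y; exact: t3.
under [X in _ = _ + X + _ + _]eq_bigr do rewrite valZpK.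
under [X in _ = _ + X + _]eq_bigr do rewrite valZpK.
under [X in _ = _ + X]eq_bigr do rewrite valZpK.
have R (a b c x y t : F) : a + x + (b + y) + (c + t) = a + b + c + x + y + t by ring.
exact: R.
Qed.

Lemma tau_der (F : numFieldType) (A : 'M[F]_6) (B : 'M[F]_3) (w z v : W F) :
  tau (der A B w) z v + tau w (der A B z) v + tau w z (der A B v) =
  (\tr A + \tr B) * tau w z v.
Proof.
have D := tau6w_der A B w z v; rewrite !tauE.
have E (x1 x2 x3 x4 x5 x6 y1 y2 y3 y4 y5 y6 z1 z2 z3 z4 z5 z6 : F) :
  (x1 - x2 + x3 - x4 + x5 - x6) / 4 + (y1 - y2 + y3 - y4 + y5 - y6) / 4
   + (z1 - z2 + z3 - z4 + z5 - z6) / 4 =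
  ((x1 + y1 + z1) - (x2 + y2 + z2) + (x3 + y3 + z3) - (x4 + y4 + z4)
   + (x5 + y5 + z5) - (x6 + y6 + z6)) / 4 by field.
rewrite E !D {E D} !sum_ord3 [\tr B]sum_ord3 -![B (inZp _) (inZp _)]/(ent B _ _).
rewrite ![nat_of_ord (inZp _)]/=; move: (\tr A) => a.
gen_ent; gen_tau6w; by field.
Qed.

(** * The contraction as a moment map, and equivariance of [ad3] *)

Lemma contr1E (F : numFieldType) (w x : W F) (A : sl F 6) :
  \tr (vsval A *m vsval (contr w x).1) =
  \sum_k \tr (vsval A *m (vsval (w k) *m (vsval (x k))^T)).
Proof.
rewrite /= mulmxBr linearB /= mul_mx_scalar mxtraceZ (slvP _ (subvsP A)) mulr0 subr0.
by rewrite mulmx_sumr linear_sum.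
Qed.

Lemma dot_half (F : numFieldType) (p q : alt F 6) :
  \sum_(i < 6) \sum_(j < 6 | (i < j)%N) vsval p i j * vsval q i j
    = \tr (vsval p *m (vsval q)^T) / 2.
Proof.
have E : \tr (vsval p *m (vsval q)^T) = \sum_i \sum_j vsval p i j * vsval q i j.
  by apply: eq_bigr => i _; rewrite mxE; apply: eq_bigr => j _; rewrite mxE.
have N i j : vsval p j i * vsval q j i = vsval p i j * vsval q i j.
  have /matrixP/(_ i j) := trmx_alt p; have /matrixP/(_ i j) := trmx_alt q.
  by rewrite !mxE => -> ->; rewrite mulrNN.
apply: (canRL (mulfK _)); first by rewrite pnatr_eq0.
rewrite E mulr_natr mulr2n.
transitivity (\sum_(i < 6) (\sum_(j < 6 | (i < j)%N) vsval p i j * vsval q i j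
   + \sum_(j < 6 | (j < i)%N) vsval p i j * vsval q i j)).
  rewrite [RHS]big_split; congr (_ + _) => /=.
  rewrite [RHS](eq_bigr _ (fun i _ => big_mkcond _ _)) exchange_big /=.
  rewrite [LHS](eq_bigr _ (fun i _ => big_mkcond _ _)).
  by apply: eq_bigr => i _; apply: eq_bigr => j _; rewrite N.
apply: eq_bigr => i _; rewrite [RHS](bigD1 i) //=.
have /matrixP/(_ i i) := trmx_alt p; rewrite !mxE => /eqP.
rewrite -addr_eq0 -mulr2n mulrn_eq0 /= => /eqP ->; rewrite mul0r add0r.
rewrite [RHS](bigID (fun j : 'I_6 => (i < j)%N)) /=; congr (_ + _); apply: eq_bigl => j.
  by rewrite -val_eqE /=; case: ltngtP.
by rewrite -val_eqE /=; case: ltngtP.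
Qed.

Lemma contr2E (F : numFieldType) (w x : W F) (B : sl F 3) :
  \tr (vsval B *m vsval (contr w x).2) =
  (\sum_k \sum_m vsval B k m * \tr (vsval (w m) *m (vsval (x k))^T)) / 2.
Proof.
rewrite /= mulmxBr linearB /= mul_mx_scalar mxtraceZ (slvP _ (subvsP B)) mulr0 subr0.
rewrite mulr_suml; apply: eq_bigr => k _; rewrite mxE mulr_suml; apply: eq_bigr => m _.
by rewrite mxE dot_half mulrA.
Qed.

(** [contr] is adjoint to the action. The common factor 2 has two sources: the two terms of A p + p
    A^T have equal traces against a skew matrix, and the second component of [contr] sums over i < j
    only. *)
Lemma dotp_actW (F : numFieldType) (X : h0 F) (w x : W F) :
  dotp (actW X w) x = 2 * (\tr (vsval X.1 *m vsval (contr w x).1)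
                         + \tr (vsval X.2 *m vsval (contr w x).2)).
Proof.
rewrite contr1E contr2E mulrDr [X in _ = _ + X]mulrCA divff ?pnatr_eq0 // mulr1.
rewrite mulr_sumr -big_split; apply: eq_bigr => k _ /=.
rewrite derE mulmxDl linearD /=; congr (_ + _).
  rewrite mulmxDl linearD /= mulr_natl mulr2n -!mulmxA; congr (_ + _).
  rewrite -[LHS]mxtrace_tr !trmx_mul !trmxK !trmx_alt !mulmxN !linearN /=.
  by rewrite -mulmxA mxtrace_mulC mulmxA.
rewrite mulmx_suml linear_sum; apply: eq_bigr => m _ /=.
by rewrite -scalemxAl linearZ.
Qed.

Lemma dotp_der (F : numFieldType) (X : h0 F) (w z v : W F) :
  tau (actW X w) z v + tau w (actW X z) v + tau w z (actW X v) = 0.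
Proof. by rewrite tau_der !(slvP _ (subvsP _)) addr0 mul0r. Qed.

(** Testing against the trace-free parts of the matrix units suffices, because the scalar parts are
    orthogonal to trace-free matrices. *)
Lemma h0_pairing_eq0 (F : numFieldType) (Y : h0 F) :
  (forall X : h0 F, \tr (vsval X.1 *m vsval Y.1) + \tr (vsval X.2 *m vsval Y.2) = 0) ->
  Y = 0.
Proof.
have nd n (M : sl F n.+1) : (forall X : sl F n.+1, \tr (vsval X *m vsval M) = 0) -> M = 0.
  move=> M0; apply/val_inj/matrixP => i j; rewrite /= [RHS]mxE.
  have := M0 (tracefree (delta_mx j i)); rewrite /= mulmxBl linearB /= mul_scalar_mx.
  by rewrite mxtraceZ (slvP _ (subvsP M)) mulr0 subr0 mxtrace_mulC mxtrace_mul_delta.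
case: Y => Y1 Y2 /= Y0; congr (_, _); apply: nd => X.
  have : \tr (vsval X *m vsval Y1) + \tr (vsval (0 : sl F 3) *m vsval Y2) = 0 := Y0 (X, 0).
  by rewrite (raddf0 vsval) mul0mx mxtrace0 addr0.
have : \tr (vsval (0 : sl F 6) *m vsval Y1) + \tr (vsval X *m vsval Y2) = 0 := Y0 (0, X).
by rewrite (raddf0 vsval) mul0mx mxtrace0 add0r.
Qed.

Lemma contr_eq0 (F : numFieldType) (w x : W F) :
  (forall X, dotp (actW X w) x = 0) -> contr w x = 0.
Proof.
move=> H; apply: h0_pairing_eq0 => X; have /eqP := H X.
by rewrite dotp_actW mulf_eq0 pnatr_eq0 /= => /eqP.
Qed.

Lemma dotp0l (F : numFieldType) (w : W F) : dotp (0 : W F) w = 0.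
Proof.
by have := dotp_linl w 0 0 (-1); rewrite scaler0 addr0 mulN1r addNr.
Qed.

Lemma dotpZl (F : numFieldType) c (w x : W F) : dotp (c *: x) w = c * dotp x w.
Proof. by have := dotp_linl w x 0 c; rewrite dotp0l !addr0. Qed.

Lemma dotpBl (F : numFieldType) (w x y : W F) : dotp (x - y) w = dotp x w - dotp y w.
Proof. by rewrite addrC -scaleN1r dotp_linl mulN1r addrC. Qed.

Lemma dotp_inj (F : numFieldType) (x y : W F) : (forall w, dotp x w = dotp y w) -> x = y.
Proof.
move=> xy; apply/eqP; rewrite -subr_eq0; apply/eqP/dotp_eq0 => w.
by rewrite dotpC dotpBl xy subrr.
Qed.

(* The restriction of [sigma l] cubed to [h1] is [- ad3 l]. *)
Definition ad3 (F : numFieldType) (l w : W F) : W F := actW (contr l (cross l w)) l.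

(** [tau] is multiplied by [\det g * \det h] and [dotp] is nondegenerate, so [cross] is equivariant,
    up to this factor, into the contragredient representation. *)
Lemma cross_actS (F : numFieldType) (g : 'M[F]_6) (h : 'M[F]_3) (w z : W F) :
  g \in unitmx -> h \in unitmx ->
  cross (actS g h w) (actS g h z) =
  (\det g * \det h) *: actS (invmx g)^T (invmx h)^T (cross w z).
Proof.
move=> gU hU; apply: dotp_inj => v.
have -> : v = actS g h (actS (invmx g) (invmx h) v) by rewrite actS_comp !mulmxV // actS1.
rewrite -/(tau _ _ _) tau_actS dotpZl dotp_actS // trmxK.
  by rewrite mulVmx.
by rewrite mulVmx.
Qed.

(** The hypotheses say that [Y] is the conjugate of [X]; they are written as intertwining relations,
    the form in which [contr_actS] provides them. *)
Lemma actW_actS (F : numFieldType) (g : 'M[F]_6) (h : 'M[F]_3) (X Y : h0 F) (w : W F) :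
  vsval Y.1 *m g = g *m vsval X.1 -> vsval Y.2 *m h = h *m vsval X.2 ->
  actW Y (actS g h w) = actS g h (actW X w).
Proof.
move=> Yg Yh; apply/ffunP => k; apply: val_inj => /=.
rewrite [LHS]derE [RHS]actSE actSE.
transitivity (\sum_m (h k m *: (g *m (vsval X.1 *m vsval (w m)
    + vsval (w m) *m (vsval X.1)^T) *m g^T) +
  \sum_n (h k n * vsval X.2 n m) *: (g *m vsval (w m) *m g^T))).
  rewrite big_split /=; congr (_ + _).
    rewrite mulmx_sumr mulmx_suml -big_split; apply: eq_bigr => m _ /=.
    rewrite -scalemxAr -scalemxAl -scalerDr mulmxDr mulmxDl !mulmxA Yg.
    by rewrite -!mulmxA -!trmx_mul Yg.
  under eq_bigr do rewrite actSE scaler_sumr.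
  rewrite exchange_big; apply: eq_bigr => m _ /=.
  rewrite -scaler_suml; under eq_bigr do rewrite scalerA.
  rewrite -scaler_suml; congr (_ *: _).
  by have /matrixP/(_ k m) := Yh; rewrite !mxE.
rewrite big_split /= [X in _ + X = _]exchange_big -big_split; apply: eq_bigr => m _ /=.
rewrite derE mulmxDr mulmxDl scalerDr; congr (_ + _).
rewrite mulmx_sumr mulmx_suml scaler_sumr; apply: eq_bigr => n _.
by rewrite -scalemxAr -scalemxAl scalerA.
Qed.

Lemma sum_contragredient (F : numFieldType) (V : lmodType F) n (h h' : 'M[F]_n)
  (G : 'I_n -> 'I_n -> V) : h^T *m h' = 1%:M ->
  \sum_k \sum_m \sum_j (h k m * h' k j) *: G m j = \sum_m G m m.
Proof.
move=> hh; rewrite exchange_big; apply: eq_bigr => m _ /=.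
rewrite exchange_big (bigD1 m) //= [X in _ + X]big1 ?addr0 => [|j jm].
  rewrite -scaler_suml -[RHS]scale1r; congr (_ *: _); transitivity (true%:R : F) => //.
  have /matrixP/(_ m m) := hh; rewrite !mxE eqxx => <-.
  by apply: eq_bigr => k _; rewrite mxE.
rewrite -scaler_suml (_ : \sum_i _ = 0) ?scale0r //.
have /matrixP/(_ m j) := hh; rewrite !mxE eq_sym (negPf jm) => E.
by rewrite -[RHS]/(false%:R : F) -E; apply: eq_bigr => k _; rewrite mxE.
Qed.

Lemma contr_actS (F : numFieldType) (g : 'M[F]_6) (h : 'M[F]_3) (w x : W F) :
  g \in unitmx -> h \in unitmx ->
  let Y := contr (actS g h w) (actS (invmx g)^T (invmx h)^T x) in
  let X := contr w x in
  vsval Y.1 *m g = g *m vsval X.1 /\ vsval Y.2 *m h = h *m vsval X.2.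
Proof.
move=> gU hU /=.
set C := \sum_k _; set C' := \sum_k _; set D := \matrix_(a, c) _; set D' := \matrix_(a, c) _.
have hh : h^T *m (invmx h)^T = 1%:M by rewrite -trmx_mul mulVmx // trmx1.
have E (p q : 'M[F]_6) :
    g *m p *m g^T *m ((invmx g)^T *m q *m (invmx g)^T^T)^T = g *m (p *m q^T) *m invmx g.
  rewrite !trmx_mul !trmxK !mulmxA -(mulmxA _ g^T) -trmx_mul mulVmx // trmx1 mulmx1.
  by rewrite ?mulmxA.
have CC : C *m g = g *m C'.
  rewrite /C' -(sum_contragredient (fun m n => vsval (w m) *m (vsval (x n))^T) hh).
  rewrite /C mulmx_suml mulmx_sumr; apply: eq_bigr => k _.
  rewrite !actSE 2!mulmx_suml mulmx_sumr; apply: eq_bigr => m _.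
  rewrite linear_sum /= mulmx_sumr mulmx_suml mulmx_sumr; apply: eq_bigr => n _.
  rewrite linearZ -scalemxAr -!scalemxAl -scalemxAr scalerA mulrC; congr (_ *: _).
  by rewrite /= E mulmxKV.
have trg (M : 'M[F]_6) : \tr (g *m M *m invmx g) = \tr M.
  by rewrite mxtrace_mulC mulmxA mulVmx // mul1mx.
have DE a c : D a c = \sum_m \sum_n h a m * D' m n * invmx h n c.
  rewrite mxE dot_half !actSE mulmx_suml linear_sum mulr_suml; apply: eq_bigr => m _ /=.
  rewrite linear_sum mulmx_sumr linear_sum mulr_suml; apply: eq_bigr => n _ /=.
  rewrite linearZ -scalemxAr -scalemxAl /= linearZ linearZ /= E trg.
  rewrite !mxE dot_half; move: (\tr _) => t; move: (h _ _) (invmx h _ _) => ? ?. by field.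
have DD : D *m h = h *m D'.
  suff -> : D = h *m D' *m invmx h by rewrite mulmxKV.
  apply/matrixP => i j; rewrite DE mxE exchange_big; apply: eq_bigr => n _ /=.
  by rewrite mxE mulr_suml.
have tE n (A B k : 'M[F]_n.+1) : k \in unitmx -> A *m k = k *m B ->
    (A - (\tr A / n.+1%:R)%:M) *m k = k *m (B - (\tr B / n.+1%:R)%:M).
  move=> kU AB; have -> : \tr A = \tr B.
    by rewrite -[A](mulmxK kU) AB mxtrace_mulC mulmxA mulVmx // mul1mx.
  by rewrite mulmxBl mulmxBr AB mul_scalar_mx mul_mx_scalar.
by split; apply: tE.
Qed.

Lemma contr0r (F : numFieldType) (l : W F) : contr l 0 = 0.
Proof. by have := contrDr (-1) l 0 0; rewrite scaler0 addr0 scaleN1r addNr. Qed.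

Lemma actW0l (F : numFieldType) (l : W F) : actW (0 : h0 F) l = 0.
Proof. by have := actWDl (-1) (0 : h0 F) 0 l; rewrite scaler0 addr0 scaleN1r addNr. Qed.

(** The scalar factor is invertible, so kernels of [ad3] are carried along by all of GL_6 x GL_3. *)
Lemma ad3_actS (F : numFieldType) (g : 'M[F]_6) (h : 'M[F]_3) (l w : W F) :
  g \in unitmx -> h \in unitmx ->
  ad3 (actS g h l) (actS g h w) = (\det g * \det h) *: actS g h (ad3 l w).
Proof.
move=> gU hU; rewrite /ad3 cross_actS //.
set c := _ * _; set x := actS _ _ (cross _ _).
have -> : contr (actS g h l) (c *: x) = c *: contr (actS g h l) x.
  by have := contrDr c (actS g h l) x 0; rewrite contr0r !addr0.
have -> : actW (c *: contr (actS g h l) x) (actS g h l)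
    = c *: actW (contr (actS g h l) x) (actS g h l).
  by have := actWDl c (contr (actS g h l) x) 0 (actS g h l); rewrite actW0l !addr0.
have [e1 e2] := contr_actS l (cross l w) gU hU.
by rewrite (actW_actS _ e1 e2).
Qed.

(** * Regular elements *)

Lemma ad3_is_linear (F : numFieldType) (l : W F) : linear (ad3 l).
Proof. by move=> c w z; rewrite /ad3 cross_is_linear contrDr actWDl. Qed.
HB.instance Definition _ (F : numFieldType) (l : W F) :=
  GRing.isLinear.Build F (W F) (W F) _ (ad3 l) (@ad3_is_linear F l).

Definition orbmap (F : numFieldType) (l : W F) (X : h0 F) : W F := actW X l.
Lemma orbmap_is_linear (F : numFieldType) (l : W F) : linear (orbmap l).
Proof. by move=> c X Y; rewrite /orbmap actWDl. Qed.
HB.instance Definition _ (F : numFieldType) (l : W F) :=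
  GRing.isLinear.Build F (h0 F) (W F) _ (orbmap l) (@orbmap_is_linear F l).

Definition K3 (F : numFieldType) (l : W F) : {vspace W F} := lker (linfun (ad3 l)).
(* The centralizer of [l] in W. *)
Definition Z1 (F : numFieldType) (l : W F) : {vspace W F} :=
  lker (linfun (cross l : W F -> W F)).

Lemma memK3 (F : numFieldType) (l w : W F) : (w \in K3 l) = (ad3 l w == 0).
Proof. by rewrite memv_ker lfunE. Qed.

Lemma memZ1 (F : numFieldType) (l w : W F) : (w \in Z1 l) = (cross l w == 0).
Proof. by rewrite memv_ker lfunE. Qed.

Lemma Z1_sub_K3 (F : numFieldType) (l : W F) : (Z1 l <= K3 l)%VS.
Proof.
apply/subvP => w; rewrite memZ1 memK3 /ad3 => /eqP ->.
by rewrite contr0r actW0l.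
Qed.

(** Since [tau] is alternating, [cross l] is skew for [dotp], so its image is the orthogonal of its
    kernel. *)
Lemma perp_Z1 (F : numFieldType) (l x : W F) :
  (forall k, k \in Z1 l -> dotp k x = 0) -> exists w, x = cross l w.
Proof.
move=> xZ; suff /memv_imgP[w _ ->] : x \in limg (linfun (cross l : W F -> W F)).
  by exists w; rewrite lfunE.
apply: dotp_separates => y yI; rewrite dotpC; apply: xZ.
rewrite memZ1; apply/eqP/dotp_eq0 => w; rewrite dotpC -/(tau _ _ _) tau_swap23.
have -> : tau l w y = 0; last by rewrite oppr0.
have E : linfun (cross l : W F -> W F) w = cross l w := lfunE _ _.
by rewrite /tau -E; apply: yI; exact/memv_img/memvf.
Qed.

Lemma regular_Z1 (F : numFieldType) (l : W F) :
  \dim (K3 l) = 3%N -> (3 <= \dim (Z1 l))%N -> Z1 l = K3 l.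
Proof. by move=> K3l Z1l; apply/eqP; rewrite eqEdim Z1_sub_K3 K3l. Qed.

(* If [x] is orthogonal to [h0.l + Z1 l], then [x = cross l z] with [z] in
   [K3 l = Z1 l], so that [x = 0]. *)
Lemma regular_decomp (F : numFieldType) (l : W F) :
  \dim (K3 l) = 3%N -> (3 <= \dim (Z1 l))%N ->
  forall w, exists (X : h0 F) k, k \in Z1 l /\ w = actW X l + k.
Proof.
move=> K3l Z1l w.
have: w \in (limg (linfun (orbmap l)) + Z1 l)%VS.
  apply: dotp_separates => x xS.
  have /perp_Z1[z xE] k : k \in Z1 l -> dotp k x = 0.
    by move=> kZ; apply: xS; apply: subvP kZ; exact: addvSr.
  have lx0 : contr l x = 0.
    apply: contr_eq0 => X; apply: xS; apply: (subvP (addvSl _ _)).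
    by rewrite -[actW X l]/(orbmap l X) -[orbmap l X](lfunE (orbmap l)); exact/memv_img/memvf.
  have: z \in K3 l by rewrite memK3 /ad3 -xE lx0 actW0l.
  rewrite -(regular_Z1 K3l Z1l) memZ1 -xE => /eqP ->.
  by rewrite dotpC dotp0l.
case/memv_addP => y /memv_imgP[X _ ->] [k kZ ->]; exists X, k; split=> //.
by rewrite lfunE.
Qed.

Lemma tau_lin1 (F : numFieldType) c (x y w z : W F) :
  tau (c *: x + y) w z = c * tau x w z + tau y w z.
Proof. by rewrite !(tau_swap12 _ w) /tau cross_is_linear dotp_linl opprD mulrN. Qed.

Lemma tau_lin2 (F : numFieldType) c (x y w z : W F) :
  tau w (c *: x + y) z = c * tau w x z + tau w y z.
Proof. by rewrite /tau cross_is_linear dotp_linl. Qed.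

Lemma tau_lin3 (F : numFieldType) c (x y w z : W F) :
  tau w z (c *: x + y) = c * tau w z x + tau w z y.
Proof. by rewrite /tau dotp_linr. Qed.

Lemma span3 (F : numFieldType) (V : vectType F) (U : {vspace V}) : \dim U = 3%N ->
  exists e0 e1 e2 : V, [/\ e0 \in U, e1 \in U, e2 \in U & forall v, v \in U ->
    exists x y z, v = x *: e0 + (y *: e1 + z *: e2)].
Proof.
move=> U3; have H v : v \in U -> v = \sum_(i < \dim U) coord (vbasis U) i v *: (vbasis U)`_i.
  exact: coord_vbasis.
have M (i : 'I_(\dim U)) : (vbasis U)`_i \in U by apply/vbasis_mem/mem_nth; rewrite size_tuple.
move: (vbasis U) H M => B; case: (\dim U) / (esym U3) B => B H M.
exists B`_0%N, B`_1%N, B`_2%N; split=> [||| v /H ->]; [exact: (M 0) | exact: (M 1) | exact: (M 2) |].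
rewrite !big_ord_recl big_ord0 addr0.
by do 3!eexists.
Qed.

(** An alternating form on a three-dimensional space is determined by its value on a basis. As [l]
    lies in its own centralizer, expand it in that basis: the values [tau l e_i e_j] vanish, and
    they are, up to sign, the coordinates of [l] times this basis value. Since [l] is nonzero, the
    basis value is 0. *)
Lemma tau_regular0 (F : numFieldType) (l : W F) : l != 0 -> \dim (Z1 l) = 3%N ->
  {in Z1 l & &, forall w z v, tau w z v = 0}.
Proof.
move=> l0 Z3; have [e0 [e1 [e2 [m0 m1 m2 eP]]]] := span3 Z3.
have A12 x y : tau x x y = 0 :> F.
  apply/eqP; have /eqP := tau_swap12 x x y.
  by rewrite -addr_eq0 -mulr2n mulrn_eq0.
have A23 x y : tau x y y = 0 :> F by rewrite tau_swap12 tau_swap23 A12 !oppr0.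
have A13 x y : tau x y x = 0 :> F by rewrite tau_swap23 A12 oppr0.
have lZ : l \in Z1 l by rewrite memZ1; apply/eqP/dotp_eq0 => w; rewrite dotpC; exact: A12.
have lk k v : k \in Z1 l -> tau l k v = 0.
  by rewrite memZ1 /tau => /eqP ->; rewrite dotp0l.
have T1 w z : tau 0 w z = 0 :> F by have := tau_lin1 (-1) 0 0 w z; rewrite scaler0 addr0 mulN1r addNr.
have D0 : tau e0 e1 e2 = 0.
  have [x [y [z lE]]] := eP _ lZ; apply: contraNeq l0 => D0.
  have tE w v : tau l w v = x * tau e0 w v + (y * tau e1 w v + z * tau e2 w v).
    by rewrite lE !tau_lin1 -[z *: e2]addr0 tau_lin1 T1 addr0.
  have := lk _ e2 m1; rewrite tE A12 A13 !mulr0 !addr0 => /eqP.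
  rewrite mulf_eq0 (negPf D0) orbF => /eqP x0.
  have := lk _ e2 m0; rewrite tE A12 A13 !mulr0 add0r addr0 tau_swap12 mulrN => /eqP.
  rewrite oppr_eq0 mulf_eq0 (negPf D0) orbF => /eqP y0.
  have := lk _ e1 m0; rewrite tE A12 A13 !mulr0 !add0r tau_swap12 tau_swap23 opprK => /eqP.
  rewrite mulf_eq0 (negPf D0) orbF => /eqP z0.
  by rewrite lE x0 y0 z0 !scale0r !addr0.
have D1 : tau e0 e2 e1 = 0 by rewrite tau_swap23 D0 oppr0.
have D2 : tau e1 e0 e2 = 0 by rewrite tau_swap12 D0 oppr0.
have D3 : tau e1 e2 e0 = 0 by rewrite tau_swap23 D2 oppr0.
have D4 : tau e2 e0 e1 = 0 by rewrite tau_swap12 D1 oppr0.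
have D5 : tau e2 e1 e0 = 0 by rewrite tau_swap23 D4 oppr0.
move=> ? ? ? /eP[w0 [w1 [w2 ->]]] /eP[z0 [z1 [z2 ->]]] /eP[v0 [v1 [v2 ->]]].
have S x : x = x + 0 :> W F by rewrite addr0.
have T2 w z : tau w 0 z = 0 :> F by rewrite tau_swap12 T1 oppr0.
have T3 w z : tau w z 0 = 0 :> F by rewrite tau_swap23 T2 oppr0.
rewrite [w2 *: e2]S [z2 *: e2]S [v2 *: e2]S.
rewrite !(tau_lin1, tau_lin2, tau_lin3, T1, T2, T3).
by rewrite !(A12, A23, A13, D0, D1, D2, D3, D4, D5, mulr0, addr0).
Qed.

(** Test [cross k k'] against w = X.l + k''. The part in [Z1 l] is handled by [tau_regular0]; for
    X.l, invariance of [tau] moves [X] onto [k] or [k'], and both resulting terms contain [l]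
    together with an element of its centralizer. *)
Lemma regular_abelian (F : numFieldType) (l : W F) :
  l != 0 -> \dim (K3 l) = 3%N -> (3 <= \dim (Z1 l))%N ->
  {in Z1 l &, forall k k', cross k k' = 0}.
Proof.
move=> l0 K3l Z1l k k' kZ kZ'; have Z3 : \dim (Z1 l) = 3%N by rewrite regular_Z1.
apply: dotp_eq0 => w; rewrite dotpC.
have lz z v : z \in Z1 l -> tau l z v = 0.
  by rewrite memZ1 /tau => /eqP ->; rewrite dotp0l.
have [X [k'' [kZ'' ->]]] := regular_decomp K3l Z1l w.
rewrite -(scale1r (actW X l)) -/(tau _ _ _) tau_lin3 (tau_regular0 l0 Z3 kZ kZ' kZ'') addr0 mul1r.
have := dotp_der X l k k'.
rewrite [tau l (actW X k) k']tau_swap23 !lz // oppr0 !addr0 => H.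
by rewrite tau_swap23 tau_swap12 opprK.
Qed.

(** * Local surjectivity over the complex numbers *)

Lemma le_pow2_le0 (R : realType) (a b : R) : (forall n, a <= b / 2 ^+ n) -> a <= 0.
Proof.
move=> H; rewrite leNgt; apply/negP => a0.
have b0 : 0 < b by have := H 0%N; rewrite expr0 divr1; exact: lt_le_trans.
have [n bn] : exists n, b / a < n%:R.
  exists (Num.bound (b / a)); apply: archi_boundP.
  by rewrite divr_ge0 // ltW.
have := H n; rewrite leNgt => /negP; apply.
rewrite ltr_pdivrMr ?exprn_gt0 // mulrC -ltr_pdivrMr //.
by apply: lt_trans bn _; rewrite -natrX ltr_nat ltn_expl.
Qed.

(** The intervals of radius 2 e / 2^n around [u n] are nested, since 2 e / 2^n = e / 2^n + 2 e /
    2^(n+1); the supremum of their left ends lies in all of them. *)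
Lemma geometric_limit_real (R : realType) (u : nat -> R) (e : R) :
  (forall n, `|u n.+1 - u n| <= e / 2 ^+ n) ->
  exists y, forall n, `|y - u n| <= 2 * e / 2 ^+ n.
Proof.
move=> H; have e0 : 0 <= e by have := H 0%N; rewrite expr0 divr1; exact: le_trans.
have S n : 2 * e / 2 ^+ n = e / 2 ^+ n + 2 * e / 2 ^+ n.+1.
  have : (2 ^+ n : R) != 0 by rewrite expf_neq0 // pnatr_eq0.
  by rewrite exprS => ?; field.
have lo n k : u n - 2 * e / 2 ^+ n <= u (n + k)%N - 2 * e / 2 ^+ (n + k).
  elim: k n => [|k IH] n; first by rewrite addn0.
  apply: le_trans (IH n) _; rewrite addnS; move: (n + k)%N => m.
  by have := H m; rewrite ler_norml (S m) => /andP[]; lra.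
have up n k : u (n + k)%N + 2 * e / 2 ^+ (n + k) <= u n + 2 * e / 2 ^+ n.
  elim: k n => [|k IH] n; first by rewrite addn0.
  apply: le_trans _ (IH n); rewrite addnS; move: (n + k)%N => m.
  by have := H m; rewrite ler_norml (S m) => /andP[]; lra.
have pos n : 0 <= 2 * e / 2 ^+ n by rewrite divr_ge0 ?mulr_ge0 ?exprn_ge0.
pose E := [set u n - 2 * e / 2 ^+ n | n in [set: nat]]%classic.
have ubE n : ubound E (u n + 2 * e / 2 ^+ n).
  move=> _ [m _ <-]; have := lo m n; have := up n m; rewrite addnC.
  by have := pos (m + n)%N; lra.
have E0 : (E !=set0)%classic by exists (u 0%N - 2 * e / 2 ^+ 0); exists 0%N.
exists (sup E) => n; rewrite ler_norml; apply/andP; split.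
  rewrite lerBrDl addrC -[_ + _]addrC addrC.
  by rewrite addrC; apply: ub_le_sup; [exists (u 0%N + 2 * e / 2 ^+ 0) | exists n].
by rewrite lerBlDl; apply: ge_sup.
Qed.

(* The norm [`|x|] of MathComp has its values in [R[i]] itself. *)
Definition nc (R : realType) (x : R[i]) : R := Normc.normc x.

Section Norm.
Variable R : realType.
Implicit Types x y : R[i].

Lemma ncD x y : nc (x + y) <= nc x + nc y. Proof. exact: le_normcD. Qed.
Lemma ncM x y : nc (x * y) = nc x * nc y. Proof. exact: Normc.normcM. Qed.
Lemma nc0 : nc (0 : R[i]) = 0. Proof. exact: Normc.normc0. Qed.
Lemma ncN x : nc (- x) = nc x. Proof. exact: normcN. Qed.
Lemma nc_eq0 x : nc x = 0 -> x = 0. Proof. exact: Normc.eq0_normc. Qed.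
Lemma nc_ge0 x : 0 <= nc x. Proof. by case: x => a b; exact: sqrtr_ge0. Qed.

Lemma nc_real (a : R) : nc a%:C%C = `|a|.
Proof. by rewrite /nc /= expr0n /= addr0 sqrtr_sqr. Qed.

Lemma nc_Re x : `|complex.Re x| <= nc x.
Proof.
case: x => a b; rewrite /nc /= -sqrtr_sqr ler_wsqrtr // lerDl; exact: sqr_ge0.
Qed.

Lemma nc_Im x : `|complex.Im x| <= nc x.
Proof.
case: x => a b; rewrite /nc /= -sqrtr_sqr ler_wsqrtr // lerDr; exact: sqr_ge0.
Qed.

Lemma nc_le x : nc x <= `|complex.Re x| + `|complex.Im x|.
Proof.
case: x => a b; rewrite -[complex.Re _]/a -[complex.Im _]/b.
rewrite [X in nc X](_ : _ = a%:C%C + b%:C%C * 'i%C); last by simpc.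
apply: le_trans (ncD _ _) _; rewrite ncM !nc_real.
have -> : nc ('i%C : R[i]) = 1 by rewrite /nc /= expr0n /= add0r expr1n sqrtr1.
by rewrite mulr1.
Qed.

Lemma geometric_limit_complex (u : nat -> R[i]) (e : R) :
  (forall n, nc (u n.+1 - u n) <= e / 2 ^+ n) ->
  exists y, forall n, nc (y - u n) <= 4 * e / 2 ^+ n.
Proof.
move=> H.
have [a aE] : exists a, forall n, `|a - complex.Re (u n)| <= 2 * e / 2 ^+ n.
  apply: geometric_limit_real => n; apply: le_trans (H n).
  by rewrite -raddfB; exact: nc_Re.
have [b bE] : exists b, forall n, `|b - complex.Im (u n)| <= 2 * e / 2 ^+ n.
  apply: geometric_limit_real => n; apply: le_trans (H n).
  by rewrite -raddfB; exact: nc_Im.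
exists (a +i* b)%C => n; apply: le_trans (nc_le _) _; rewrite !raddfB /=.
have -> : 4 * e / 2 ^+ n = 2 * e / 2 ^+ n + 2 * e / 2 ^+ n.
  by rewrite -!mulrDl -natrD.
exact: lerD.
Qed.

Section Vect.
Variable V : vectType R[i].
Implicit Types u v : V.

Definition nrm v : R := \sum_i nc (v2r v 0 i).

Lemma nrm_ge0 v : 0 <= nrm v.
Proof. by apply: sumr_ge0 => i _; exact: nc_ge0. Qed.

Lemma nrmD u v : nrm (u + v) <= nrm u + nrm v.
Proof.
rewrite -big_split; apply: ler_sum => i _ /=.
by rewrite linearD mxE; exact: ncD.
Qed.

Lemma nrmZ c v : nrm (c *: v) = nc c * nrm v.
Proof.
by rewrite mulr_sumr; apply: eq_bigr => i _; rewrite linearZ mxE ncM.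
Qed.

Lemma nrmN v : nrm (- v) = nrm v.
Proof. by apply: eq_bigr => i _; rewrite linearN mxE ncN. Qed.

Lemma nrmB u v : nrm (u - v) <= nrm u + nrm v.
Proof. by rewrite -(nrmN v); exact: nrmD. Qed.

Lemma nrm0 : nrm 0 = 0.
Proof. by rewrite -(scale0r 0) nrmZ nc0 mul0r. Qed.

Lemma nrm_eq0 v : nrm v = 0 -> v = 0.
Proof.
move/eqP; rewrite psumr_eq0 => [|i _]; last exact: nc_ge0.
move=> /allP v0; apply: v2r_inj; rewrite linear0; apply/rowP => i; rewrite [RHS]mxE.
by apply: nc_eq0; apply/eqP/v0; rewrite mem_index_enum.
Qed.

Lemma nrm_le0 v : nrm v <= 0 -> v = 0.
Proof. by move=> v0; apply: nrm_eq0; apply/eqP; rewrite eq_le v0 nrm_ge0. Qed.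

Lemma geometric_limit (u : nat -> V) (e : R) :
  (forall n, nrm (u n.+1 - u n) <= e / 2 ^+ n) ->
  exists (K : R) (y : V), forall n, nrm (y - u n) <= K / 2 ^+ n.
Proof.
move=> H; have Hi i : exists y, forall n, nc (y - v2r (u n) 0 i) <= 4 * e / 2 ^+ n.
  apply: geometric_limit_complex => n; apply: le_trans (H n).
  rewrite /nrm (bigD1 i) //= linearB !mxE lerDl; apply: sumr_ge0 => j _; exact: nc_ge0.
have [y yE] := boolp.choice Hi.
exists (\sum_(i < dim V) 4 * e), (r2v (\row_i y i)) => n.
rewrite mulr_suml; apply: ler_sum => i _.
by rewrite linearB /= r2vK !mxE.
Qed.
End Vect.

Lemma linear_bounded (V U : vectType R[i]) (f : {linear V -> U}) :
  exists2 C : R, 0 < C & forall v, nrm (f v) <= C * nrm v.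
Proof.
exists (1 + \sum_i nrm (f (r2v (delta_mx 0 i)))).
  by rewrite ltr_pwDl // sumr_ge0 // => i _; exact: nrm_ge0.
move=> v; have vE : v = \sum_i v2r v 0 i *: r2v (delta_mx 0 i).
  rewrite -[LHS]v2rK [X in r2v X]row_sum_delta linear_sum; apply: eq_bigr => i _.
  by rewrite linearZ.
have nS (I : finType) (g : I -> U) : nrm (\sum_i g i) <= \sum_i nrm (g i).
  elim/big_rec2: _ => [|i y x _ xy]; first by rewrite nrm0.
  by apply: le_trans (nrmD _ _) _; rewrite lerD2l.
rewrite [X in f X]vE linear_sum; apply: le_trans (nS _ _) _.
apply: (@le_trans _ _ (\sum_i nrm v * nrm (f (r2v (delta_mx 0 i))))).
  apply: ler_sum => i _; rewrite linearZ nrmZ ler_wpM2r ?nrm_ge0 //.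
  by rewrite /nrm (bigD1 i) //= lerDl sumr_ge0 // => j _; exact: nc_ge0.
by rewrite -mulr_sumr mulrC ler_wpM2r ?nrm_ge0 // lerDr.
Qed.

(* Newton's iteration with the constant right inverse [D^-1]; the hypothesis on
   [f] is strict differentiability at 0. *)
Lemma locally_onto (V U : vectType R[i]) (f : V -> U) (D : 'Hom(V, U)) :
  (forall c : R, 0 < c -> exists2 r : R, 0 < r & forall x y : V, nrm x <= r -> nrm y <= r ->
     nrm (f x - f y - D (x - y)) <= c * nrm (x - y)) ->
  limg D = fullv ->
  forall e : R, 0 < e -> exists2 d : R, 0 < d &
    forall u, nrm (u - f 0) < d -> exists2 x : V, nrm x < e & f x = u.
Proof.
move=> fD onto e e0.
have [M M0 GM] := linear_bounded (D^-1)%VF.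
have [N N0 DN] := linear_bounded D.
have DG u : D ((D^-1)%VF u) = u by rewrite limg_lfunVK // onto memvf.
(* A step is at most [M] times the residual [u - f (x n)], so with this constant the bound on the
   residual is halved each time. *)
have c0 : 0 < 1 / (2 * M) by rewrite divr_gt0 // mulr_gt0.
have [r r0 fr] := fD _ c0.
pose q := Num.min r (e / 2).
have q0 : 0 < q by rewrite lt_min r0 divr_gt0.
have qr : q <= r by rewrite ge_min lexx.
have qe : q < e by rewrite gt_min; apply/orP; right; lra.
(* The steps have lengths at most M d / 2^n, in total 2 M d = q, so the iterates stay in the ball of
   radius [q]. *)
pose d := q / (2 * M).
have d0 : 0 < d by rewrite divr_gt0 // mulr_gt0.
exists d => // u ud.
pose fix x n := if n is m.+1 then x m + (D^-1)%VF (u - f (x m)) else 0.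
have x_step n : nrm (u - f (x n)) <= d / 2 ^+ n -> nrm (x n.+1 - x n) <= M * d / 2 ^+ n.
  move=> H; rewrite /= addrC addKr; apply: le_trans (GM _) _.
  by rewrite -mulrA ler_pM2l.
have I n : nrm (u - f (x n)) <= d / 2 ^+ n /\ nrm (x n) <= q * (1 - 1 / 2 ^+ n).
  elim: n => [|n [IH1 IH2]].
    by rewrite expr0 !divr1 subrr mulr0 nrm0; split=> //; exact: ltW.
  have S := x_step n IH1.
  have p0 : 0 < (2 ^+ n : R) by rewrite exprn_gt0.
  have xn : nrm (x n.+1) <= q * (1 - 1 / 2 ^+ n.+1).
    have -> : q * (1 - 1 / 2 ^+ n.+1) = q * (1 - 1 / 2 ^+ n) + M * d / 2 ^+ n.
      by rewrite exprS /d; field; rewrite !gt_eqF.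
    have -> : x n.+1 = x n + (x n.+1 - x n) by rewrite addrC subrK.
    by apply: le_trans (nrmD _ _) _; exact: lerD.
  split=> //.
  have le_q m : q * (1 - 1 / 2 ^+ m) <= r.
    apply: le_trans qr; rewrite -[leRHS]mulr1 ler_pM2l // gerBl.
    by rewrite divr_ge0 // exprn_ge0.
  have := fr (x n.+1) (x n) (le_trans xn (le_q _)) (le_trans IH2 (le_q _)).
  (* The derivative maps the step exactly to the old residual, so the new residual is the
     linearization error between consecutive iterates. *)
  have -> : D (x n.+1 - x n) = u - f (x n) by rewrite /= addrC addKr DG.
  rewrite -nrmN (_ : - _ = u - f (x n.+1)); last by rewrite opprB opprB addrA subrK.
  move=> H; apply: le_trans H _.
  apply: (@le_trans _ _ (1 / (2 * M) * (M * d / 2 ^+ n))).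
    by rewrite ler_pM2l // divr_gt0 // mulr_gt0.
  by rewrite exprS le_eqVlt; apply/orP; left; apply/eqP; field; rewrite !gt_eqF.
have [K [y yE]] : exists (K : R) (y : V), forall n, nrm (y - x n) <= K / 2 ^+ n.
  by apply: geometric_limit => n; apply: x_step; have [] := I n.
have xq n : nrm (x n) <= q.
  apply: le_trans (proj2 (I n)) _; rewrite -[leRHS]mulr1 ler_pM2l // gerBl.
  by rewrite divr_ge0 // exprn_ge0.
have yq : nrm y <= q.
  rewrite -subr_le0; apply: (@le_pow2_le0 _ _ K) => n.
  rewrite lerBlDr; have -> : y = (y - x n) + x n by rewrite subrK.
  by apply: le_trans (nrmD _ _) _; exact: lerD.
exists y; first exact: le_lt_trans qe.
apply/esym/eqP; rewrite -subr_eq0; apply/eqP/nrm_le0.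
(* [u - f y] is split into the residual at [x n], the linearization error between [y] and [x n], and
   the derivative of [y - x n]; each is bounded by a multiple of 2^-n. *)
apply: (@le_pow2_le0 _ _ (d + (1 / (2 * M) + N) * K)) => n.
have -> : u - f y = (u - f (x n)) - ((f y - f (x n) - D (y - x n)) + D (y - x n)).
  by rewrite subrK opprB addrA subrK.
apply: le_trans (nrmB _ _) _; rewrite mulrDl; apply: lerD; first by have [] := I n.
apply: le_trans (nrmD _ _) _; rewrite mulrDl mulrDl; apply: lerD.
  apply: le_trans (fr _ _ (le_trans yq qr) (le_trans (xq n) qr)) _.
  by rewrite -[leRHS]mulrA ler_pM2l.
by apply: le_trans (DN _) _; rewrite -[leRHS]mulrA ler_pM2l.
Qed.
End Norm.

(** * Strict differentiability at the origin *)

Section StrictDiff.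
Variables (R : realType) (V : vectType R[i]).

(** E x y = o(nrm (x - y)) as both points tend to 0. Two moving points are required because the
    Newton iteration compares values at consecutive iterates. *)
Definition small (E : V -> V -> R) := forall c : R, 0 < c -> exists2 r : R, 0 < r &
  forall x y : V, nrm x <= r -> nrm y <= r -> E x y <= c * nrm (x - y).

Lemma small_le (E E' : V -> V -> R) : (forall x y, E x y <= E' x y) -> small E' -> small E.
Proof.
move=> EE sE c /sE[r r0 H]; exists r => // x y xr yr.
exact: le_trans (EE _ _) (H _ _ xr yr).
Qed.

Lemma small_add (E E' : V -> V -> R) : small E -> small E' ->
  small (fun x y => E x y + E' x y).
Proof.
move=> sE sE' c c0; have c2 : 0 < c / 2 by rewrite divr_gt0.
have [r r0 H] := sE _ c2; have [r' r0' H'] := sE' _ c2.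
exists (Num.min r r') => [|x y]; first by rewrite lt_min r0.
rewrite !le_min => /andP[xr xr'] /andP[yr yr'].
by apply: le_trans (lerD (H _ _ xr yr) (H' _ _ xr' yr')) _; rewrite -mulrDl -splitr.
Qed.

Lemma small_scale (E : V -> V -> R) a : 0 <= a -> small E -> small (fun x y => a * E x y).
Proof.
move=> a0 sE c c0; have a1 : 0 < a + 1 by rewrite ltr_wpDl.
have [|r r0 H] := sE (c / (a + 1)); first by rewrite divr_gt0.
exists r => // x y xr yr; apply: (@le_trans _ _ (a * (c / (a + 1) * nrm (x - y)))).
  by rewrite ler_wpM2l // H.
rewrite mulrA ler_wpM2r ?nrm_ge0 // mulrA ler_pdivrMr // mulrC ler_wpM2l ?ltW //.
by rewrite ltrDl.
Qed.

Lemma small_sum (I : eqType) (s : seq I) (E : I -> V -> V -> R) :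
  (forall i, small (E i)) -> small (fun x y => \sum_(i <- s) E i x y).
Proof.
move=> sE; elim: s => [|i s IH].
  move=> c c0; exists 1 => // x y _ _; rewrite big_nil mulr_ge0 ?nrm_ge0 //; exact: ltW.
have := small_add (sE i) IH; apply: small_le => x y.
by rewrite big_cons.
Qed.

Definition lipschitz (f : V -> R[i]) := exists2 C : R, 0 < C &
  forall x y, nc (f x - f y) <= C * nrm (x - y).

(* [f] is strictly differentiable at 0, with derivative [D]. *)
Definition sdiff (f D : V -> R[i]) :=
  lipschitz D /\ small (fun x y => nc (f x - f y - (D x - D y))).

Lemma sdiff_cst (a : R[i]) : sdiff (fun=> a) (fun=> 0).
Proof.
split; first by exists 1 => // x y; rewrite subrr nc0 mul1r nrm_ge0.
move=> c c0; exists 1 => // x y _ _.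
by rewrite !subrr nc0 mulr_ge0 ?nrm_ge0 // ltW.
Qed.

Lemma sdiff_scalar (f : V -> R[i]) : scalar f -> sdiff f f.
Proof.
move=> fL; split; last first.
  move=> c c0; exists 1 => // x y _ _.
  by rewrite !subrr nc0 mulr_ge0 ?nrm_ge0 // ltW.
exists (1 + \sum_i nc (f (r2v (delta_mx 0 i)))).
  by rewrite ltr_pwDl // sumr_ge0 // => i _; exact: nc_ge0.
move=> x y; have -> : f x - f y = f (x - y).
  by have := fL (-1) y x; rewrite scaleN1r mulN1r ![- _ + _]addrC.
move: (x - y) => v; have vE : v = \sum_i v2r v 0 i *: r2v (delta_mx 0 i).
  rewrite -[LHS]v2rK [X in r2v X]row_sum_delta linear_sum; apply: eq_bigr => i _.
  by rewrite linearZ.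
have nS (I : finType) (g : I -> R[i]) : nc (\sum_i g i) <= \sum_i nc (g i).
  elim/big_rec2: _ => [|i a b _ ab]; first by rewrite nc0.
  by apply: le_trans (ncD _ _) _; rewrite lerD2l.
rewrite [X in f X]vE (scalar_sum _ _ fL); apply: le_trans (nS _ _) _.
apply: (@le_trans _ _ (\sum_i nrm v * nc (f (r2v (delta_mx 0 i))))).
  apply: ler_sum => i _; rewrite ncM ler_wpM2r ?nc_ge0 //.
  by rewrite /nrm (bigD1 i) //= lerDl sumr_ge0 // => j _; exact: nc_ge0.
by rewrite -mulr_sumr mulrC ler_wpM2r ?nrm_ge0 // lerDr.
Qed.

Lemma lipschitz_add f g : lipschitz f -> lipschitz g -> lipschitz (fun x => f x + g x).
Proof.
move=> [C C0 H] [C' C0' H']; exists (C + C') => [|x y]; first exact: addr_gt0.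
rewrite opprD addrACA mulrDl; apply: le_trans (ncD _ _) _; exact: lerD.
Qed.

Lemma lipschitz_scale f a : lipschitz f -> lipschitz (fun x => a * f x).
Proof.
move=> [C C0 H]; exists ((nc a + 1) * C) => [|x y].
  by rewrite mulr_gt0 // ltr_wpDl // nc_ge0.
rewrite -mulrBr ncM -mulrA; apply: ler_pM; rewrite ?nc_ge0 //.
by rewrite lerDl.
Qed.

Lemma sdiff_add f g D E : sdiff f D -> sdiff g E ->
  sdiff (fun x => f x + g x) (fun x => D x + E x).
Proof.
move=> [LD Df] [LE Eg]; split; first exact: lipschitz_add.
apply: small_le (small_add Df Eg) => x y; apply: le_trans (ncD _ _).
by rewrite le_eqVlt; apply/orP; left; apply/eqP; congr nc; ring.
Qed.

Lemma eq_sdiff f g D E : f =1 g -> D =1 E -> sdiff f D -> sdiff g E.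
Proof. by move=> /funext <- /funext <-. Qed.

Lemma sdiff_sum (I : finType) (f D : I -> V -> R[i]) : (forall i, sdiff (f i) (D i)) ->
  sdiff (fun x => \sum_i f i x) (fun x => \sum_i D i x).
Proof.
move=> H; elim: (index_enum I) => [|i s IH].
  by apply: eq_sdiff (sdiff_cst 0) => x; rewrite big_nil.
by apply: eq_sdiff (sdiff_add (H i) IH) => x; rewrite big_cons.
Qed.

Lemma sdiff_lipschitz f D : sdiff f D -> exists2 C : R, 0 < C & exists2 r : R, 0 < r &
  forall x y : V, nrm x <= r -> nrm y <= r -> nc (f x - f y) <= C * nrm (x - y).
Proof.
move=> [[C C0 H] /(_ 1 ltr01)[r r0 H']]; exists (1 + C); first exact: addr_gt0.
exists r => // x y xr yr; rewrite -[f x - f y](subrK (D x - D y)) mulrDl.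
by apply: le_trans (ncD _ _) _; apply: lerD; [exact: H' | exact: H].
Qed.

(** Write f x g x - f y g y = f x (g x - g y) + g y (f x - f y) and separate the values at 0. What
    remains besides the errors of [f] and [g] are (f x - f 0) (g x - g y) and (g y - g 0) (f x - f
    y), which are small: the second factor is Lipschitz and the first tends to 0. *)
Lemma sdiff_mul f g D E : sdiff f D -> sdiff g E ->
  sdiff (fun x => f x * g x) (fun x => f 0 * E x + D x * g 0).
Proof.
move=> Df Eg; have [LD Sf] := Df; have [LE Sg] := Eg; split.
  apply: lipschitz_add; first exact: lipschitz_scale.
  have -> : (fun x => D x * g 0) = (fun x => g 0 * D x) by apply/funext => x; rewrite mulrC.
  exact: lipschitz_scale.
have P (F G : V -> R[i]) (DF DG : V -> R[i]) : sdiff F DF -> sdiff G DG ->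
    small (fun x y => nc ((F x - F 0) * (G x - G y))).
  move=> /sdiff_lipschitz[A A0 [r r0 FA]] /sdiff_lipschitz[B B0 [r' r0' GB]] c c0.
  have AB0 : 0 < c / (A * B) by rewrite divr_gt0 // mulr_gt0.
  exists (Num.min (Num.min r r') (c / (A * B))) => [|x y].
    by rewrite !lt_min r0 r0' AB0.
  rewrite !le_min => /andP[/andP[xr xr'] xc] /andP[/andP[yr yr'] yc].
  rewrite ncM; apply: (@le_trans _ _ (A * nrm x * (B * nrm (x - y)))).
    apply: ler_pM; rewrite ?nc_ge0 ?GB //.
    by have := FA x 0 xr; rewrite nrm0 subr0; apply; exact: ltW.
  rewrite mulrA ler_wpM2r ?nrm_ge0 // mulrAC mulrC.
  by rewrite -ler_pdivlMr // mulr_gt0.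
have Pc (F G : V -> R[i]) (DF DG : V -> R[i]) : sdiff F DF -> sdiff G DG ->
    small (fun x y => nc ((F y - F 0) * (G x - G y))).
  move=> FD GD c c0; have [r r0 H] := P F G DF DG FD GD c c0; exists r => // x y xr yr.
  have := H y x yr xr; rewrite -(nrmN (x - y)) opprB.
  by rewrite -(ncN (_ * _)) -mulrN opprB.
have S := small_add (small_add (P f g D E Df Eg) (small_scale (nc_ge0 (f 0)) Sg))
  (small_add (Pc g f E D Eg Df) (small_scale (nc_ge0 (g 0)) Sf)).
apply: small_le S => x y; rewrite -!ncM.
apply: (@le_trans _ _ (nc ((f x - f 0) * (g x - g y) + f 0 * (g x - g y - (E x - E y)))
  + nc ((g y - g 0) * (f x - f y) + g 0 * (f x - f y - (D x - D y))))).
  apply: le_trans (ncD _ _); rewrite le_eqVlt; apply/orP; left; apply/eqP; congr nc.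
  move: (f 0) (g 0) (f x) (g x) (f y) (g y) (D x) (D y) (E x) (E y) => *; ring.
by apply: lerD; exact: ncD.
Qed.

Definition mx_sdiff m n (f D : V -> 'M[R[i]]_(m, n)) :=
  forall i j, sdiff (fun x => f x i j) (fun x => D x i j).

Lemma mx_sdiff_mul m n p (f D : V -> 'M[R[i]]_(m, n)) (g E : V -> 'M[R[i]]_(n, p)) :
  mx_sdiff f D -> mx_sdiff g E ->
  mx_sdiff (fun x => f x *m g x) (fun x => f 0 *m E x + D x *m g 0).
Proof.
move=> fD gE i j; have := sdiff_sum (fun k => sdiff_mul (fD i k) (gE k j)).
by apply: eq_sdiff => x; rewrite !mxE // big_split.
Qed.

Lemma mx_sdiff_affine m n (a : 'M[R[i]]_(m, n)) (f : V -> 'M[R[i]]_(m, n)) :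
  linear f -> mx_sdiff (fun x => a + f x) f.
Proof.
move=> fL i j; have fS : scalar (fun x => f x i j) by move=> c x y; rewrite fL !mxE.
have := sdiff_add (sdiff_cst (a i j)) (sdiff_scalar fS).
by apply: eq_sdiff => x; rewrite ?mxE // add0r.
Qed.

Lemma mx_sdiff_tr m n (f D : V -> 'M[R[i]]_(m, n)) : mx_sdiff f D ->
  mx_sdiff (fun x => (f x)^T) (fun x => (D x)^T).
Proof. by move=> fD i j; apply: eq_sdiff (fD j i) => x; rewrite mxE. Qed.
End StrictDiff.

Lemma W_sdiff_small (R : realType) (V : vectType R[i]) (f D : V -> W R[i]) :
  (forall k, mx_sdiff (fun x => vsval (f x k)) (fun x => vsval (D x k))) ->
  small (fun x y => nrm (f x - f y - (D x - D y))).
Proof.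
move=> fD.
have S := small_sum (index_enum {: 'I_3 * ('I_6 * 'I_6)})
  (fun z => small_scale (nrm_ge0 (basisW R[i] z.1 z.2.1 z.2.2))
     (small_scale (nc_ge0 (2^-1)) (proj2 (fD z.1 z.2.1 z.2.2)))).
apply: small_le S => x y; set w := f x - _ - _.
have wE k i j : vsval (w k) i j = vsval (f x k) i j - vsval (f y k) i j
    - (vsval (D x k) i j - vsval (D y k) i j).
  by rewrite /w !ffunE /= !mxE.
have nS (I : finType) (g : I -> W R[i]) : nrm (\sum_i g i) <= \sum_i nrm (g i).
  elim/big_rec2: _ => [|i a b _ ab]; first by rewrite nrm0.
  by apply: le_trans (nrmD _ _) _; rewrite lerD2l.
rewrite {1}(W_decomp w).
rewrite (eq_bigr (fun k => \sum_(z : 'I_6 * 'I_6) (vsval (w k) z.1 z.2 / 2) *: basisW R[i] k z.1 z.2));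
  last first.
  by move=> k _; rewrite pair_bigA.
rewrite pair_bigA; apply: le_trans (nS _ _) _; apply: ler_sum => z _ /=.
by rewrite nrmZ ncM -wE mulrC (mulrC (nc _)).
Qed.

(** If v (1 + G) = 0 then v = - v G, so the sum of the moduli of the entries of a nonzero [v] would
    be strictly smaller than itself. *)
Lemma unitmx_near1 (R : realType) n (G : 'M[R[i]]_n) :
  \sum_i \sum_j nc (G i j) < 1 -> 1%:M + G \in unitmx.
Proof.
move=> G1; rewrite unitmxE unitfE; apply/det0P => -[v v0].
rewrite mulmxDr mulmx1 => /eqP; rewrite addr_eq0 => /eqP vE.
have nS (g : 'I_n -> R[i]) : nc (\sum_i g i) <= \sum_i nc (g i).
  elim/big_rec2: _ => [|i a b _ ab]; first by rewrite nc0.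
  by apply: le_trans (ncD _ _) _; rewrite lerD2l.
pose S := \sum_j nc (v 0 j).
have S0 : 0 < S.
  rewrite lt_neqAle sumr_ge0 ?andbT => [|j _]; last exact: nc_ge0.
  apply: contraNneq v0 => /esym/eqP; rewrite psumr_eq0 => [/allP H|j _]; last exact: nc_ge0.
  apply/eqP/rowP => j; rewrite [RHS]mxE; apply: nc_eq0; apply/eqP/H.
  by rewrite mem_index_enum.
have : S <= S * \sum_i \sum_j nc (G i j).
  apply: (@le_trans _ _ (\sum_j \sum_i nc (v 0 i) * nc (G i j))).
    apply: ler_sum => j _; rewrite [in leLHS]vE !mxE ncN; apply: le_trans (nS _) _.
    by apply: ler_sum => i _; rewrite ncM.
  rewrite exchange_big mulr_sumr; apply: ler_sum => i _.
  rewrite -mulr_sumr ler_wpM2r ?sumr_ge0 // => [j _|]; first exact: nc_ge0.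
  by rewrite /S (bigD1 i) //= lerDl sumr_ge0 // => j _; exact: nc_ge0.
by rewrite leNgt gtr_pMr // G1.
Qed.

Lemma near_unitmx (R : realType) (V : vectType R[i]) n (f : V -> 'M[R[i]]_n) :
  linear f -> exists2 e : R, 0 < e & forall v, nrm v < e -> 1%:M + f v \in unitmx.
Proof.
move=> fL; have fS i j : sdiff (fun x => f x i j) (fun x => f x i j).
  by apply: sdiff_scalar => c x y; rewrite fL !mxE.
have f0 i j : f 0 i j = 0.
  by have := fL (-1) 0 0; rewrite scaler0 addr0 scaleN1r addNr => ->; rewrite mxE.
have B i j : exists C : R, 0 < C /\ forall v, nc (f v i j) <= C * nrm v.
  have [[C C0 H] _] := fS i j; exists C; split=> // v.
  by have := H v 0; rewrite f0 !subr0.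
have [C CP] := boolp.choice (fun z : 'I_n * 'I_n => B z.1 z.2).
pose S := 1 + \sum_z C z; have S0 : 0 < S.
  by rewrite ltr_pwDl // sumr_ge0 // => z _; have [/ltW] := CP z.
exists S^-1 => [|v vS]; first by rewrite invr_gt0.
apply: unitmx_near1; rewrite pair_bigA /=.
apply: (@le_lt_trans _ _ (S * nrm v)).
  rewrite mulrDl mulr_suml ler_wpDl ?mul1r ?nrm_ge0 //.
  by apply: ler_sum => z _; have [_] := CP z; apply.
by rewrite mulrC -ltr_pdivlMr // div1r.
Qed.

(* Apply [locally_onto] to [v |-> (1 + a v).(l + b v)]. *)
Lemma orbit_local_param (R : realType) (V : vectType R[i]) (l : W R[i])
  (a : {linear V -> h0 R[i]}) (b : {linear V -> W R[i]}) :
  (forall w, exists v, w = actW (a v) l + b v) ->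
  exists2 d : R, 0 < d & forall w, nrm (w - l) < d ->
    exists g h v, [/\ g \in unitmx, h \in unitmx & w = actS g h (l + b v)].
Proof.
move=> H.
pose A (v : V) : 'M[R[i]]_6 := vsval (a v).1; pose B (v : V) : 'M[R[i]]_3 := vsval (a v).2.
pose k (v : V) : W R[i] := l + b v.
have AL : linear A by move=> c x y; rewrite /A linearP; exact: (linearP vsval c (a x).1 (a y).1).
have BL : linear B by move=> c x y; rewrite /B linearP; exact: (linearP vsval c (a x).2 (a y).2).
have [e1 e10 U1] := near_unitmx AL; have [e2 e20 U2] := near_unitmx BL.
pose f (v : V) := actS (1%:M + A v) (1%:M + B v) (k v).
pose D (v : V) : W R[i] := actW (a v) l + b v.
have DL : linear D.
  by move=> c x y; rewrite /D !linearP actWDl scalerDr addrACA.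
pose DL' := GRing.isLinear.Build _ _ _ _ D DL.
pose Dlin : {linear V -> W R[i]} := HB.pack D DL'.
have A0 : A 0 = 0 by rewrite /A !linear0.
have B0 : B 0 = 0 by rewrite /B !linear0.
have k0 : k 0 = l by rewrite /k linear0 addr0.
have f0 : f 0 = l by rewrite /f A0 B0 k0 !addr0 actS1.
have fD m : mx_sdiff (fun x => vsval (f x m)) (fun x => vsval (D x m)).
  have dA : mx_sdiff (fun x => 1%:M + A x) A by exact: mx_sdiff_affine.
  have dB : mx_sdiff (fun x => 1%:M + B x) B by exact: mx_sdiff_affine.
  have dk n : mx_sdiff (fun x => vsval (k x n)) (fun x => vsval (b x n)).
    have kL : linear (fun x : V => vsval (b x n)).
      by move=> c x y; rewrite linearP vsval_lin.
    move=> i j; apply: eq_sdiff (mx_sdiff_affine (vsval (l n)) kL i j) => // x.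
    by rewrite /k ffunE.
  have dg n := mx_sdiff_mul (mx_sdiff_mul dA (dk n)) (mx_sdiff_tr dA).
  move=> i j; have := sdiff_sum (fun n => sdiff_mul (dB m n) (dg n i j)).
  apply: eq_sdiff => x.
    by rewrite /f actSE summxE; apply: eq_bigr => n _; rewrite [RHS]mxE.
  (* At the origin both group elements are the identity, so the product rule leaves the
     infinitesimal action on [l] plus [b x]. *)
  rewrite A0 B0 k0 !addr0 trmx1 big_split /= (bigD1 m) //= big1 ?addr0 => [|n nm]; last first.
    by rewrite mxE eq_sym (negPf nm) mul0r.
  rewrite [_%:M m m]mxE eqxx mul1r !mul1mx !mulmx1.
  rewrite (_ : vsval (D x m) = vsval (actW (a x) l m) + vsval (b x m)); last first.
    by rewrite /D ffunE.
  have -> : vsval (actW (a x) l m) = A x *m vsval (l m) + vsval (l m) *m (A x)^T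
      + \sum_n B x m n *: vsval (l n) by exact: derE.
  have mxD (P Q : 'M[R[i]]_6) : (P + Q) i j = P i j + Q i j by rewrite mxE.
  rewrite !mxD summxE.
  have -> : \sum_(k0 < 3) (B x m k0 *: vsval (l k0)) i j =
    \sum_(k0 < 3) B x m k0 * (1%:M *m vsval (l k0) *m 1%:M) i j.
    by apply: eq_bigr => n _; rewrite mxE mul1mx mulmx1.
  move: (\sum_(k0 < 3) _) ((vsval (l m) *m (A x)^T) i j) ((A x *m vsval (l m)) i j)
    (vsval (b x m) i j) => *; ring.
have DlE v : linfun Dlin v = D v := lfunE _ v.
have DE x y : D x - D y = linfun Dlin (x - y).
  have := DL (-1) y x; rewrite scaleN1r (addrC (- y) x) => E.
  by rewrite DlE E scaleN1r addrC.
have fs := @W_sdiff_small R V f D fD.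
have Donto : limg (linfun Dlin) = fullv.
  apply/eqP; rewrite eqEsubv subvf; apply/subvP => w _.
  have [v ->] := H w; rewrite -/(D v) -DlE.
  exact/memv_img/memvf.
have Dest c : 0 < c -> exists2 r : R, 0 < r & forall x y : V, nrm x <= r -> nrm y <= r ->
    nrm (f x - f y - linfun Dlin (x - y)) <= c * nrm (x - y).
  by move=> c0; have [r r0 Hr] := fs c c0; exists r => // x y xr yr;
    exact: (eq_ind _ (fun t => nrm (f x - f y - t) <= c * nrm (x - y)) (Hr x y xr yr) _ (DE x y)).
have e0 : 0 < Num.min e1 e2 by rewrite lt_min e10.
have [d d0 fd] := locally_onto Dest Donto e0.
exists d => // w; rewrite -{1}f0 => /fd[v]; rewrite lt_min => /andP[v1 v2] <-.
by exists (1%:M + A v), (1%:M + B v), v; split; [exact: U1 | exact: U2 |].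
Qed.

Lemma orbit_local (R : realType) (l : W R[i]) (K : {vspace W R[i]}) :
  l \in K -> (forall w, exists (X : h0 R[i]) k, k \in K /\ w = actW X l + k) ->
  exists2 d : R, 0 < d & forall w, nrm (w - l) < d ->
    exists g h k, [/\ g \in unitmx, h \in unitmx, k \in K & w = actS g h k].
Proof.
move=> lK H; pose V : vectType R[i] := (h0 R[i] * subvs_of K)%type.
pose a (v : V) : h0 R[i] := v.1; pose b (v : V) : W R[i] := vsval v.2.
have aL : linear a by [].
have bL : linear b by move=> c x y; exact: (linearP vsval c x.2 y.2).
pose aL' := GRing.isLinear.Build _ _ _ _ a aL.
pose bL' := GRing.isLinear.Build _ _ _ _ b bL.
pose al : {linear V -> h0 R[i]} := HB.pack a aL'.
pose bl : {linear V -> W R[i]} := HB.pack b bL'.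
have [w|d d0 dP] := @orbit_local_param R V l al bl.
  by have [X [k [kK ->]]] := H w; exists ((X, Subvs kK) : V).
exists d => // w /dP[g [h [v [gU hU ->]]]]; exists g, h, (l + bl v); split=> //.
by rewrite rpredD // subvsP.
Qed.

(** * The subspace spanned by u1, u2, u3 *)

(** Explicit computations use these coordinates, with indices counted from 0; by skewness the 45
    with k < 3 and i < j < 6 determine [w]. *)
Definition wc (F : numFieldType) (w : W F) (k i j : nat) : F := ent (vsval (w (inZp k))) i j.

Lemma wc_lin (F : numFieldType) c (w z : W F) k i j :
  wc (c *: w + z) k i j = c * wc w k i j + wc z k i j.
Proof. by rewrite /wc vsval_lin /ent !mxE. Qed.

Lemma wcD (F : numFieldType) (w z : W F) k i j : wc (w + z) k i j = wc w k i j + wc z k i j.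
Proof. by rewrite -[w in w + z]scale1r wc_lin mul1r. Qed.

Lemma wcZ (F : numFieldType) c (w : W F) k i j : wc (c *: w) k i j = c * wc w k i j.
Proof. by rewrite /wc /ent ffunE linearZ mxE. Qed.

Lemma wc0 (F : numFieldType) k i j : wc (0 : W F) k i j = 0.
Proof. by rewrite -(scale0r (0 : W F)) wcZ mul0r. Qed.

Lemma wc_alt (F : numFieldType) (w : W F) k i j : wc w k j i = - wc w k i j.
Proof. exact: ent_alt. Qed.

Lemma wc_inj (F : numFieldType) (w z : W F) :
  (forall k i j, (k < 3)%N -> (i < j < 6)%N -> wc w k i j = wc z k i j) -> w = z.
Proof.
move=> H; apply/ffunP => k; apply/val_inj/matrixP => i j.
have E (x : W F) (a b : 'I_6) : vsval (x k) a b = wc x k a b by rewrite /wc ent_val valZpK.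
rewrite -[LHS]/(vsval (w k) i j) -[RHS]/(vsval (z k) i j) !E.
case: (ltngtP i j) => [ij|ji|->].
- by apply: H => //; rewrite ij ltn_ord.
- by rewrite wc_alt [RHS]wc_alt H // ji ltn_ord.
have D (x : W F) : wc x k j j = 0.
  by have /eqP := wc_alt x k j j; rewrite -addr_eq0 -mulr2n mulrn_eq0 /= => /eqP.
by rewrite !D.
Qed.

Definition wedge4c (F : numFieldType) (w z : W F) (k m a b c d : nat) : F :=
  wc w k a b * wc z m c d + wc w k c d * wc z m a b
  - wc w k a c * wc z m b d - wc w k b d * wc z m a c
  + wc w k a d * wc z m b c + wc w k b c * wc z m a d.

Lemma wc_cross (F : numFieldType) (w z : W F) k i j : (k < 3)%N -> (i < j < 6)%N ->
  let r := [seq x <- iota 0 6 | (x != i) && (x != j)] in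
  let f k m := wedge4c w z k m (nth 0%N r 0) (nth 0%N r 1) (nth 0%N r 2) (nth 0%N r 3) in
  wc (cross w z : W F) k i j = (-1) ^+ (i + j).+1 *
    (f (k.+1 %% 3)%N (k.+2 %% 3)%N - f (k.+2 %% 3)%N (k.+1 %% 3)%N).
Proof.
move=> k3 ij r f.
have Z n : inZp (n %% 3) = inZp n :> 'I_3 by apply: val_inj; rewrite /= modn_mod.
rewrite {1}/wc cross_inZp // {1}/ent (raddfB vsval) mxE [X in _ + X]mxE -!/(ent _ _ _).
rewrite !ent_star // mulrBr /f /wedge4c /wc !Z.
by [].
Qed.

Definition stdb n (F : numFieldType) : n.-tuple 'cV[F]_n := [tuple delta_mx i 0 | i < n].

Definition cart (F : numFieldType) (t1 t2 t3 : F) : W F :=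
  t1 *: u1 (stdb 6 F) (stdb 3 F) + t2 *: u2 (stdb 6 F) (stdb 3 F)
  + t3 *: u3 (stdb 6 F) (stdb 3 F).

Lemma nth_stdb n (F : numFieldType) (i : 'I_n) : (stdb n F)`_i = delta_mx i 0.
Proof. by rewrite -tnth_nth tnth_mktuple. Qed.

Lemma abk_stdb (F : numFieldType) (i j : 'I_6) (k : 'I_3) :
  abk (stdb 6 F) (stdb 3 F) i.+1 j.+1 k.+1 = basisW F k i j.
Proof. by rewrite /abk /= !nth_stdb. Qed.

Lemma wc_basisW (F : numFieldType) (k : 'I_3) (i j : 'I_6) m a b :
  (m < 3)%N -> (a < 6)%N -> (b < 6)%N ->
  wc (basisW F k i j) m a b = (m == k)%:R *
    (((a == i) && (b == j))%:R - ((a == j) && (b == i))%:R).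
Proof.
move=> m3 a6 b6; have E n p (q : 'I_n.+1) : (p < n.+1)%N -> (inZp p == q) = (p == q :> nat).
  by move=> pn; rewrite -val_eqE /= modn_small.
by rewrite /wc basisWE /ent !mxE !E.
Qed.

(** Pattern matching on all indices lets [/=] evaluate it on literals, with both orders of [i], [j]
    listed. *)
Definition cart_coef (F : numFieldType) (t1 t2 t3 : F) (k i j : nat) : F :=
  match k, i, j with
  | 0%N, 0%N, 1%N => t1
  | 0%N, 1%N, 0%N => - t1
  | 1%N, 2%N, 3%N => t1
  | 1%N, 3%N, 2%N => - t1
  | 2%N, 4%N, 5%N => t1
  | 2%N, 5%N, 4%N => - t1
  | 0%N, 3%N, 4%N => - t2
  | 0%N, 4%N, 3%N => t2
  | 1%N, 0%N, 5%N => t2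
  | 1%N, 5%N, 0%N => - t2
  | 2%N, 1%N, 2%N => - t2
  | 2%N, 2%N, 1%N => t2
  | 0%N, 2%N, 5%N => t3
  | 0%N, 5%N, 2%N => - t3
  | 1%N, 1%N, 4%N => - t3
  | 1%N, 4%N, 1%N => t3
  | 2%N, 0%N, 3%N => t3
  | 2%N, 3%N, 0%N => - t3
  | _, _, _ => 0
  end.

Lemma wc_cart (F : numFieldType) (t1 t2 t3 : F) k i j :
  (k < 3)%N -> (i < 6)%N -> (j < 6)%N -> wc (cart t1 t2 t3) k i j = cart_coef t1 t2 t3 k i j.
Proof.
move=> k3 i6 j6; rewrite /cart /u1 /u2 /u3.
have e (a b : 'I_6) (c : 'I_3) n m p : n = a.+1 -> m = b.+1 -> p = c.+1 ->
    abk (stdb 6 F) (stdb 3 F) n m p = basisW F c a b.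
  by move=> -> -> ->; exact: abk_stdb.
rewrite (e 0 1 0) // (e 2 3 1) // (e 4 5 2) // (e 4 3 0) // (e 0 5 1) // (e 2 1 2) //.
rewrite (e 2 5 0) // (e 4 1 1) // (e 0 3 2) //.
rewrite !(wcD, wcZ) !wc_basisW //.
by case: k k3 => [|[|[|]]] // _; case: i i6 => [|[|[|[|[|[|]]]]]] // _;
  case: j j6 => [|[|[|[|[|[|]]]]]] // _ /=; ring.
Qed.

Ltac cross_cart_eq := rewrite wc_cross // /wedge4c /= !wc_cart //= -signr_odd /=;
  repeat match goal with |- context [@wc ?F ?w ?a ?b ?c] => move: (@wc F w a b c) => ? end; ring.

(** All 45 coordinates, in lexicographic order of (k, i, j). Names such as [e112] given to them
    below count the three indices from 1. *)
Lemma cross_cart (F : numFieldType) (t1 t2 t3 : F) (w : W F) :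
  let c := wc (cross (cart t1 t2 t3) w : W F) in
  [/\ ([/\ [/\ c 0 0 1 = - t1 * wc w 1 2 3 + t1 * wc w 2 4 5,
      c 0 0 2 = t1 * wc w 1 1 3 - t3 * wc w 2 3 5 &
      c 0 0 3 = - t1 * wc w 1 1 2 + t2 * wc w 1 4 5 + t3 * wc w 2 2 5],
     [/\ c 0 0 4 = - t2 * wc w 1 3 5 - t1 * wc w 2 1 5,
      c 0 0 5 = t2 * wc w 1 3 4 + t1 * wc w 2 1 4 - t3 * wc w 2 2 3 &
      c 0 1 2 = - t1 * wc w 1 0 3 - t3 * wc w 1 4 5 + t2 * wc w 2 3 4],
     [/\ c 0 1 3 = t1 * wc w 1 0 2 - t2 * wc w 2 2 4,
      c 0 1 4 = t3 * wc w 1 2 5 + t1 * wc w 2 0 5 + t2 * wc w 2 2 3 &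
      c 0 1 5 = - t3 * wc w 1 2 4 - t1 * wc w 2 0 4],
     [/\ c 0 2 3 = - t1 * wc w 1 0 1 - t3 * wc w 2 0 5 + t2 * wc w 2 1 4,
      c 0 2 4 = - t3 * wc w 1 1 5 - t2 * wc w 2 1 3 &
      c 0 2 5 = t3 * wc w 1 1 4 + t3 * wc w 2 0 3] &
     [/\ c 0 3 4 = t2 * wc w 1 0 5 + t2 * wc w 2 1 2,
      c 0 3 5 = - t2 * wc w 1 0 4 - t3 * wc w 2 0 2 &
      c 0 4 5 = t2 * wc w 1 0 3 - t3 * wc w 1 1 2 + t1 * wc w 2 0 1]]),
    ([/\ [/\ c 1 0 1 = t1 * wc w 0 2 3 + t2 * wc w 2 2 5 - t3 * wc w 2 3 4,
      c 1 0 2 = - t1 * wc w 0 1 3 - t2 * wc w 2 1 5 &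
      c 1 0 3 = t1 * wc w 0 1 2 - t2 * wc w 0 4 5 + t3 * wc w 2 1 4],
     [/\ c 1 0 4 = t2 * wc w 0 3 5 - t3 * wc w 2 1 3,
      c 1 0 5 = - t2 * wc w 0 3 4 + t2 * wc w 2 1 2 &
      c 1 1 2 = t1 * wc w 0 0 3 + t3 * wc w 0 4 5 + t2 * wc w 2 0 5],
     [/\ c 1 1 3 = - t1 * wc w 0 0 2 - t3 * wc w 2 0 4,
      c 1 1 4 = - t3 * wc w 0 2 5 + t3 * wc w 2 0 3 &
      c 1 1 5 = t3 * wc w 0 2 4 - t2 * wc w 2 0 2],
     [/\ c 1 2 3 = t1 * wc w 0 0 1 - t1 * wc w 2 4 5,
      c 1 2 4 = t3 * wc w 0 1 5 + t1 * wc w 2 3 5 &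
      c 1 2 5 = - t3 * wc w 0 1 4 + t2 * wc w 2 0 1 - t1 * wc w 2 3 4] &
     [/\ c 1 3 4 = - t2 * wc w 0 0 5 - t3 * wc w 2 0 1 - t1 * wc w 2 2 5,
      c 1 3 5 = t2 * wc w 0 0 4 + t1 * wc w 2 2 4 &
      c 1 4 5 = - t2 * wc w 0 0 3 + t3 * wc w 0 1 2 - t1 * wc w 2 2 3]]) &
    ([/\ [/\ c 2 0 1 = - t1 * wc w 0 4 5 - t2 * wc w 1 2 5 + t3 * wc w 1 3 4,
      c 2 0 2 = t3 * wc w 0 3 5 + t2 * wc w 1 1 5 &
      c 2 0 3 = - t3 * wc w 0 2 5 - t3 * wc w 1 1 4],
     [/\ c 2 0 4 = t1 * wc w 0 1 5 + t3 * wc w 1 1 3,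
      c 2 0 5 = - t1 * wc w 0 1 4 + t3 * wc w 0 2 3 - t2 * wc w 1 1 2 &
      c 2 1 2 = - t2 * wc w 0 3 4 - t2 * wc w 1 0 5],
     [/\ c 2 1 3 = t2 * wc w 0 2 4 + t3 * wc w 1 0 4,
      c 2 1 4 = - t1 * wc w 0 0 5 - t2 * wc w 0 2 3 - t3 * wc w 1 0 3 &
      c 2 1 5 = t1 * wc w 0 0 4 + t2 * wc w 1 0 2],
     [/\ c 2 2 3 = t3 * wc w 0 0 5 - t2 * wc w 0 1 4 + t1 * wc w 1 4 5,
      c 2 2 4 = t2 * wc w 0 1 3 - t1 * wc w 1 3 5 &
      c 2 2 5 = - t3 * wc w 0 0 3 - t2 * wc w 1 0 1 + t1 * wc w 1 3 4] &
     [/\ c 2 3 4 = - t2 * wc w 0 1 2 + t3 * wc w 1 0 1 + t1 * wc w 1 2 5,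
      c 2 3 5 = t3 * wc w 0 0 2 - t1 * wc w 1 2 4 &
      c 2 4 5 = - t1 * wc w 0 0 1 + t1 * wc w 1 2 3]])].
Proof. by move=> c; rewrite {}/c; do !split; cross_cart_eq. Qed.

(** * Solving the linear systems attached to an element of c *)

Lemma nonzero_coef (F : numFieldType) (a b x : F) : a * x = b * x -> a - b != 0 -> x = 0.
Proof. by move=> abx /mulfI; apply; rewrite mulrBl abx subrr mulr0. Qed.

Ltac lin_from e :=
  first [by rewrite -[RHS]e; ring | by rewrite -[RHS]oppr0 -[in RHS]e; ring].

(* With [g], [h] the two shifts of the index, the equations say that
   [l1 + l2 g + l3 h] kills [x].  As [g], [h] commute and have order 3, the
   factorization of [a^3 + b^3 + c^3 - 3abc] gives
   [(l1^3 + l2^3 + l3^3) x = 3 l1 l2 l3 (gh) x]; iterate this three times. *)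
Lemma torus_diag (F : numFieldType) (l1 l2 l3 x00 x01 x02 x10 x11 x12 x20 x21 x22 : F) :
  l1 * x00 + l2 * x10 + l3 * x01 = 0 -> l1 * x01 + l2 * x11 + l3 * x02 = 0 -> l1 * x02 + l2 * x12 + l3 *
    x00 = 0 ->
  l1 * x10 + l2 * x20 + l3 * x11 = 0 -> l1 * x11 + l2 * x21 + l3 * x12 = 0 -> l1 * x12 + l2 * x22 + l3 *
    x10 = 0 ->
  l1 * x20 + l2 * x00 + l3 * x21 = 0 -> l1 * x21 + l2 * x01 + l3 * x22 = 0 -> l1 * x22 + l2 * x02 + l3 *
    x20 = 0 ->
  (l1 ^+ 3 + l2 ^+ 3 + l3 ^+ 3) ^+ 3 - (3 * l1 * l2 * l3) ^+ 3 != 0 -> x00 = 0.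
Proof.
move=> e00 e01 e02 e10 e11 e12 e20 e21 e22.
set S := _ + l3 ^+ 3; set P := 3 * _ * _ * _.
have s0 : S * x00 = P * x11.
  apply/eqP; rewrite -subr_eq0; apply/eqP.
  transitivity (l1 ^+ 2 * (l1 * x00 + l2 * x10 + l3 * x01) + l2 ^+ 2 * (l1 * x20 + l2 * x00 + l3 * x21)
    + l3 ^+ 2 * (l1 * x02 + l2 * x12 + l3 * x00) + - (l1 * l2) * (l1 * x10 + l2 * x20 + l3 * x11) + -
    (l2 * l3) * (l1 * x11 + l2 * x21 + l3 * x12) + - (l1 * l3) * (l1 * x01 + l2 * x11 + l3 * x02)).
    by rewrite /S /P; ring.
  by rewrite e00 e20 e02 e10 e11 e01 !mulr0 !addr0.
have s1 : S * x11 = P * x22.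
  apply/eqP; rewrite -subr_eq0; apply/eqP.
  transitivity (l1 ^+ 2 * (l1 * x11 + l2 * x21 + l3 * x12) + l2 ^+ 2 * (l1 * x01 + l2 * x11 + l3 * x02)
    + l3 ^+ 2 * (l1 * x10 + l2 * x20 + l3 * x11) + - (l1 * l2) * (l1 * x21 + l2 * x01 + l3 * x22) + -
    (l2 * l3) * (l1 * x22 + l2 * x02 + l3 * x20) + - (l1 * l3) * (l1 * x12 + l2 * x22 + l3 * x10)).
    by rewrite /S /P; ring.
  by rewrite e11 e01 e10 e21 e22 e12 !mulr0 !addr0.
have s2 : S * x22 = P * x00.
  apply/eqP; rewrite -subr_eq0; apply/eqP.
  transitivity (l1 ^+ 2 * (l1 * x22 + l2 * x02 + l3 * x20) + l2 ^+ 2 * (l1 * x12 + l2 * x22 + l3 * x10)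
    + l3 ^+ 2 * (l1 * x21 + l2 * x01 + l3 * x22) + - (l1 * l2) * (l1 * x02 + l2 * x12 + l3 * x00) + -
    (l2 * l3) * (l1 * x00 + l2 * x10 + l3 * x01) + - (l1 * l3) * (l1 * x20 + l2 * x00 + l3 * x21)).
    by rewrite /S /P; ring.
  by rewrite e22 e12 e21 e02 e00 e20 !mulr0 !addr0.
clearbody S P; apply: nonzero_coef; rewrite ![_ ^+ 3]exprS !expr2.
by rewrite -!mulrA s0 (mulrCA S P) (mulrCA S P) s1 (mulrCA S P) s2.
Qed.

(** The system is unchanged by cyclic shifts of either index, so each unknown can be put in the
    first place of [torus_diag]. *)
Lemma torus9 (F : numFieldType) (l1 l2 l3 x00 x01 x02 x10 x11 x12 x20 x21 x22 : F) :
  (l1 ^+ 3 + l2 ^+ 3 + l3 ^+ 3) ^+ 3 - (3 * l1 * l2 * l3) ^+ 3 != 0 ->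
  l1 * x00 + l2 * x10 + l3 * x01 = 0 -> l1 * x01 + l2 * x11 + l3 * x02 = 0 -> l1 * x02 + l2 * x12 + l3 *
    x00 = 0 ->
  l1 * x10 + l2 * x20 + l3 * x11 = 0 -> l1 * x11 + l2 * x21 + l3 * x12 = 0 -> l1 * x12 + l2 * x22 + l3 *
    x10 = 0 ->
  l1 * x20 + l2 * x00 + l3 * x21 = 0 -> l1 * x21 + l2 * x01 + l3 * x22 = 0 -> l1 * x22 + l2 * x02 + l3 *
    x20 = 0 ->
  [/\ [/\ x00 = 0, x01 = 0 & x02 = 0], [/\ x10 = 0, x11 = 0 & x12 = 0]
    & [/\ x20 = 0, x21 = 0 & x22 = 0]].
Proof.
move=> D e00 e01 e02 e10 e11 e12 e20 e21 e22.
split; split;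
  [apply: (@torus_diag F l1 l2 l3 x00 x01 x02 x10 x11 x12 x20 x21 x22)
  |apply: (@torus_diag F l1 l2 l3 x01 x02 x00 x11 x12 x10 x21 x22 x20)
  |apply: (@torus_diag F l1 l2 l3 x02 x00 x01 x12 x10 x11 x22 x20 x21)
  |apply: (@torus_diag F l1 l2 l3 x10 x11 x12 x20 x21 x22 x00 x01 x02)
  |apply: (@torus_diag F l1 l2 l3 x11 x12 x10 x21 x22 x20 x01 x02 x00)
  |apply: (@torus_diag F l1 l2 l3 x12 x10 x11 x22 x20 x21 x02 x00 x01)
  |apply: (@torus_diag F l1 l2 l3 x20 x21 x22 x00 x01 x02 x10 x11 x12)
  |apply: (@torus_diag F l1 l2 l3 x21 x22 x20 x01 x02 x00 x11 x12 x10)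
  |apply: (@torus_diag F l1 l2 l3 x22 x20 x21 x02 x00 x01 x12 x10 x11)] => //.
Qed.

(** The determinant of this 3 x 3 system is q^3 - p^3. *)
Lemma cube_block (F : numFieldType) (p q x y z : F) : p != 0 -> q != 0 -> p ^+ 3 != q ^+ 3 ->
  q * y + p * z = 0 -> p * x + q * z = 0 -> q * x - p * y = 0 -> [/\ x = 0, y = 0 & z = 0].
Proof.
move=> p0 q0 pq e1 e2 e3.
have z0 : z = 0.
  apply: (@nonzero_coef _ (p ^+ 3) (q ^+ 3)); last by rewrite subr_eq0.
  apply/eqP; rewrite -subr_eq0; apply/eqP.
  transitivity (p ^+ 2 * (q * y + p * z) - q ^+ 2 * (p * x + q * z) + p * q * (q * x - p * y)).
    by ring.
  by rewrite e1 e2 e3 !mulr0 subr0 addr0.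
move: e1 e2; rewrite z0 !mulr0 !addr0 => /eqP + /eqP.
by rewrite !mulf_eq0 (negPf p0) (negPf q0) /= => /eqP-> /eqP->.
Qed.

(** The equations decouple. The 18 coordinates with [i], [j] of equal parity, which have nonzero
    weight under diag(1, -1, 1, -1, 1, -1), form six blocks for [cube_block]. On the other 27 write
    the even index as 2o and the odd one as 2e + 1: the two nonzero classes of o + e + k modulo 3
    form the two blocks for [torus9], after some changes of sign. The zero class is the support of
    u1, u2, u3, and there the equations only identify coordinates up to sign. *)
Lemma cross_system (F : numFieldType) (t1 t2 t3 : F) (c : nat -> nat -> nat -> F) :
  t1 != 0 -> t2 != 0 -> t3 != 0 ->
  t1 ^+ 3 != t2 ^+ 3 -> t1 ^+ 3 != t3 ^+ 3 -> t2 ^+ 3 != t3 ^+ 3 ->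
  (t1 ^+ 3 + t2 ^+ 3 + t3 ^+ 3) ^+ 3 - (3 * t1 * t2 * t3) ^+ 3 != 0 ->
  [/\ ([/\ [/\ - t1 * c 1 2 3 + t1 * c 2 4 5 = 0,
      t1 * c 1 1 3 - t3 * c 2 3 5 = 0 &
      - t1 * c 1 1 2 + t2 * c 1 4 5 + t3 * c 2 2 5 = 0],
     [/\ - t2 * c 1 3 5 - t1 * c 2 1 5 = 0,
      t2 * c 1 3 4 + t1 * c 2 1 4 - t3 * c 2 2 3 = 0 &
      - t1 * c 1 0 3 - t3 * c 1 4 5 + t2 * c 2 3 4 = 0],
     [/\ t1 * c 1 0 2 - t2 * c 2 2 4 = 0,
      t3 * c 1 2 5 + t1 * c 2 0 5 + t2 * c 2 2 3 = 0 &
      - t3 * c 1 2 4 - t1 * c 2 0 4 = 0],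
     [/\ - t1 * c 1 0 1 - t3 * c 2 0 5 + t2 * c 2 1 4 = 0,
      - t3 * c 1 1 5 - t2 * c 2 1 3 = 0 &
      t3 * c 1 1 4 + t3 * c 2 0 3 = 0] &
     [/\ t2 * c 1 0 5 + t2 * c 2 1 2 = 0,
      - t2 * c 1 0 4 - t3 * c 2 0 2 = 0 &
      t2 * c 1 0 3 - t3 * c 1 1 2 + t1 * c 2 0 1 = 0]]),
    ([/\ [/\ t1 * c 0 2 3 + t2 * c 2 2 5 - t3 * c 2 3 4 = 0,
      - t1 * c 0 1 3 - t2 * c 2 1 5 = 0 &
      t1 * c 0 1 2 - t2 * c 0 4 5 + t3 * c 2 1 4 = 0],
     [/\ t2 * c 0 3 5 - t3 * c 2 1 3 = 0,
      - t2 * c 0 3 4 + t2 * c 2 1 2 = 0 &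
      t1 * c 0 0 3 + t3 * c 0 4 5 + t2 * c 2 0 5 = 0],
     [/\ - t1 * c 0 0 2 - t3 * c 2 0 4 = 0,
      - t3 * c 0 2 5 + t3 * c 2 0 3 = 0 &
      t3 * c 0 2 4 - t2 * c 2 0 2 = 0],
     [/\ t1 * c 0 0 1 - t1 * c 2 4 5 = 0,
      t3 * c 0 1 5 + t1 * c 2 3 5 = 0 &
      - t3 * c 0 1 4 + t2 * c 2 0 1 - t1 * c 2 3 4 = 0] &
     [/\ - t2 * c 0 0 5 - t3 * c 2 0 1 - t1 * c 2 2 5 = 0,
      t2 * c 0 0 4 + t1 * c 2 2 4 = 0 &
      - t2 * c 0 0 3 + t3 * c 0 1 2 - t1 * c 2 2 3 = 0]]) &
    ([/\ [/\ - t1 * c 0 4 5 - t2 * c 1 2 5 + t3 * c 1 3 4 = 0,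
      t3 * c 0 3 5 + t2 * c 1 1 5 = 0 &
      - t3 * c 0 2 5 - t3 * c 1 1 4 = 0],
     [/\ t1 * c 0 1 5 + t3 * c 1 1 3 = 0,
      - t1 * c 0 1 4 + t3 * c 0 2 3 - t2 * c 1 1 2 = 0 &
      - t2 * c 0 3 4 - t2 * c 1 0 5 = 0],
     [/\ t2 * c 0 2 4 + t3 * c 1 0 4 = 0,
      - t1 * c 0 0 5 - t2 * c 0 2 3 - t3 * c 1 0 3 = 0 &
      t1 * c 0 0 4 + t2 * c 1 0 2 = 0],
     [/\ t3 * c 0 0 5 - t2 * c 0 1 4 + t1 * c 1 4 5 = 0,
      t2 * c 0 1 3 - t1 * c 1 3 5 = 0 &
      - t3 * c 0 0 3 - t2 * c 1 0 1 + t1 * c 1 3 4 = 0] &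
     [/\ - t2 * c 0 1 2 + t3 * c 1 0 1 + t1 * c 1 2 5 = 0,
      t3 * c 0 0 2 - t1 * c 1 2 4 = 0 &
      - t1 * c 0 0 1 + t1 * c 1 2 3 = 0]])] ->
  forall k i j, (k < 3)%N -> (i < j < 6)%N ->
    c k i j = cart_coef (c 0 0 1)%N (c 1 0 5)%N (c 0 2 5)%N k i j.
Proof.
move=> h1 h2 h3 n12 n13 n23 D.
have m12 : t2 ^+ 3 != t1 ^+ 3 by rewrite eq_sym.
have m13 : t3 ^+ 3 != t1 ^+ 3 by rewrite eq_sym.
have m23 : t3 ^+ 3 != t2 ^+ 3 by rewrite eq_sym.
move=> [[[e112 e113 e114] [e115 e116 e123] [e124 e125 e126] [e134 e135 e136] [e145 e146 e156]] [[e212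
  e213 e214] [e215 e216 e223] [e224 e225 e226] [e234 e235 e236] [e245 e246 e256]] [[e312 e313 e314]
  [e315 e316 e323] [e324 e325 e326] [e334 e335 e336] [e345 e346 e356]]].
have [zw113 zw235 zw315] : [/\ c 0 0 2 = 0, c 1 2 4 = 0 & c 2 0 4 = 0].
  apply: (@cube_block F t1 t3 (c 0 0 2) (c 1 2 4) (c 2 0 4));
  [done | done | done | lin_from e126 | lin_from e224 | lin_from e346].
have [zw115 zw335 zw213] : [/\ c 0 0 4 = 0, - c 2 2 4 = 0 & c 1 0 2 = 0].
  apply: (@cube_block F t1 t2 (c 0 0 4) (- c 2 2 4) (c 1 0 2));
  [done | done | done | lin_from e124 | lin_from e326 | lin_from e246].
move/eqP: zw335; rewrite oppr_eq0 => /eqP zw335.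
have [zw124 zw246 zw326] : [/\ c 0 1 3 = 0, c 1 3 5 = 0 & c 2 1 5 = 0].
  apply: (@cube_block F t1 t2 (c 0 1 3) (c 1 3 5) (c 2 1 5));
  [done | done | done | lin_from e115 | lin_from e213 | lin_from e335].
have [zw126 zw346 zw224] : [/\ c 0 1 5 = 0, - c 2 3 5 = 0 & c 1 1 3 = 0].
  apply: (@cube_block F t1 t3 (c 0 1 5) (- c 2 3 5) (c 1 1 3));
  [done | done | done | lin_from e113 | lin_from e315 | lin_from e235].
move/eqP: zw346; rewrite oppr_eq0 => /eqP zw346.
have [zw135 zw313 zw215] : [/\ c 0 2 4 = 0, c 2 0 2 = 0 & c 1 0 4 = 0].
  apply: (@cube_block F t2 t3 (c 0 2 4) (c 2 0 2) (c 1 0 4));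
  [done | done | done | lin_from e146 | lin_from e324 | lin_from e226].
have [zw146 zw226 zw324] : [/\ c 0 3 5 = 0, - c 1 1 5 = 0 & - c 2 1 3 = 0].
  apply: (@cube_block F t2 t3 (c 0 3 5) (- c 1 1 5) (- c 2 1 3));
  [done | done | done | lin_from e135 | lin_from e215 | lin_from e313].
move/eqP: zw226; rewrite oppr_eq0 => /eqP zw226.
move/eqP: zw324; rewrite oppr_eq0 => /eqP zw324.
have [[zw325 zw334 zw123] [zw245 zw114 zw156] [zw212 zw316 zw236]] : [/\ [/\ c 2 1 4 = 0, - c 2 2 3 = 0
  & c 0 1 2 = 0],
   [/\ c 1 3 4 = 0, - c 0 0 3 = 0 & - c 0 4 5 = 0]
   & [/\ - c 1 0 1 = 0, - c 2 0 5 = 0 & - c 1 2 5 = 0]].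
  apply: (@torus9 F t1 t2 t3 (c 2 1 4) (- c 2 2 3) (c 0 1 2) (c 1 3 4) (- c 0 0 3) (- c 0 4 5) (- c 1 0
    1) (- c 2 0 5) (- c 1 2 5));
  [done
  |lin_from e116
  |lin_from e256
  |lin_from e214
  |lin_from e336
  |lin_from e223
  |lin_from e312
  |lin_from e134
  |lin_from e125
  |lin_from e345].
move/eqP: zw334; rewrite oppr_eq0 => /eqP zw334.
move/eqP: zw114; rewrite oppr_eq0 => /eqP zw114.
move/eqP: zw156; rewrite oppr_eq0 => /eqP zw156.
move/eqP: zw212; rewrite oppr_eq0 => /eqP zw212.
move/eqP: zw316; rewrite oppr_eq0 => /eqP zw316.
move/eqP: zw236; rewrite oppr_eq0 => /eqP zw236.
have [[zw223 zw336 zw312] [zw256 zw116 zw214] [zw125 zw134 zw345]] : [/\ [/\ c 1 1 2 = 0, - c 2 2 5 = 0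
  & - c 2 0 1 = 0],
   [/\ - c 1 4 5 = 0, - c 0 0 5 = 0 & - c 1 0 3 = 0]
   & [/\ c 0 1 4 = 0, - c 0 2 3 = 0 & c 2 3 4 = 0]].
  apply: (@torus9 F t1 t2 t3 (c 1 1 2) (- c 2 2 5) (- c 2 0 1) (- c 1 4 5) (- c 0 0 5) (- c 1 0 3) (c 0
    1 4) (- c 0 2 3) (c 2 3 4));
  [done
  |lin_from e114
  |lin_from e245
  |lin_from e156
  |lin_from e334
  |lin_from e325
  |lin_from e123
  |lin_from e316
  |lin_from e212
  |lin_from e236].
move/eqP: zw336; rewrite oppr_eq0 => /eqP zw336.
move/eqP: zw312; rewrite oppr_eq0 => /eqP zw312.
move/eqP: zw256; rewrite oppr_eq0 => /eqP zw256.
move/eqP: zw116; rewrite oppr_eq0 => /eqP zw116.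
move/eqP: zw214; rewrite oppr_eq0 => /eqP zw214.
move/eqP: zw134; rewrite oppr_eq0 => /eqP zw134.
have can t (x y : F) : t != 0 -> t * x - t * y = 0 -> x = y.
  by move=> t0; rewrite -mulrBr => /eqP; rewrite mulf_eq0 (negPf t0) subr_eq0 => /eqP.
have can' t (x y : F) : t != 0 -> t * x + t * y = 0 -> x = - y.
  by move=> t0 H; apply: (can _ _ _ t0); rewrite mulrN opprK.
have k1 : c 1 2 3 = c 0 0 1 by apply: (can _ _ _ h1); lin_from e356.
have k2 : c 2 4 5 = c 0 0 1 by apply: (can _ _ _ h1); lin_from e234.
have k3 : c 1 1 4 = - c 0 2 5 by apply: (can' _ _ _ h3); lin_from e314.
have k4 : c 2 0 3 = c 0 2 5 by apply: (can _ _ _ h3); lin_from e225.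
have k5 : c 0 3 4 = - c 1 0 5 by apply: (can' _ _ _ h2); lin_from e323.
have k6 : c 2 1 2 = - c 1 0 5 by apply: (can' _ _ _ h2); lin_from e145.
move=> k i j kl /andP[ij jl]; have il := ltn_trans ij jl.
by case: k kl => [|[|[|?]]] // _; case: i il ij => [|[|[|[|[|[|?]]]]]] // _;
  case: j jl => [|[|[|[|[|[|?]]]]]].
Qed.

Lemma sum_ord6 (V : nmodType) (f : 'I_6 -> V) :
  \sum_i f i = f (inZp 0) + f (inZp 1) + f (inZp 2) + f (inZp 3) + f (inZp 4) + f (inZp 5).
Proof.
rewrite !big_ord_recl big_ord0 addr0 !addrA.
by congr (f _ + f _ + f _ + f _ + f _ + f _); apply: val_inj.
Qed.

Lemma wc_actW (F : numFieldType) (X : h0 F) (w : W F) k i j :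
  let a := ent (vsval X.1) in let b := ent (vsval X.2) in
  wc (actW X w) k i j =
    (a i 0 * wc w k 0 j + a i 1 * wc w k 1 j + a i 2 * wc w k 2 j
     + a i 3 * wc w k 3 j + a i 4 * wc w k 4 j + a i 5 * wc w k 5 j)
  + (a j 0 * wc w k i 0 + a j 1 * wc w k i 1 + a j 2 * wc w k i 2
     + a j 3 * wc w k i 3 + a j 4 * wc w k i 4 + a j 5 * wc w k i 5)
  + (b k 0 * wc w 0 i j + b k 1 * wc w 1 i j + b k 2 * wc w 2 i j).
Proof.
move=> a b; have D (P Q : 'M[F]_6) x y : (P + Q) x y = P x y + Q x y by rewrite mxE.
rewrite {1}/wc {1}/ent derE !D summxE sum_ord3; congr (_ + _ + _).
- by rewrite mxE sum_ord6.
- by rewrite mxE sum_ord6 ![_^T _ _]mxE /a /wc /ent; do !congr (_ + _); rewrite mulrC.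
- by rewrite /b /wc /ent !mxE.
Qed.

Lemma act_cart (F : numFieldType) (t1 t2 t3 : F) (X : h0 F) :
  let a := ent (vsval X.1) in let b := ent (vsval X.2) in
  actW X (cart t1 t2 t3) = 0 ->
  [/\ ([/\ [/\ t1 * a 0 0 + t1 * a 1 1 + t1 * b 0 0 = 0,
      - t3 * a 0 5 + t1 * a 2 1 = 0 &
      t2 * a 0 4 + t1 * a 3 1 + t3 * b 0 2 = 0],
     [/\ - t2 * a 0 3 + t1 * a 4 1 = 0,
      t3 * a 0 2 + t1 * a 5 1 + t2 * b 0 1 = 0 &
      - t3 * a 1 5 - t1 * a 2 0 - t2 * b 0 2 = 0],
     [/\ t2 * a 1 4 - t1 * a 3 0 = 0,
      - t2 * a 1 3 - t1 * a 4 0 - t3 * b 0 1 = 0 &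
      t3 * a 1 2 - t1 * a 5 0 = 0],
     [/\ t2 * a 2 4 + t3 * a 3 5 + t1 * b 0 1 = 0,
      - t2 * a 2 3 + t3 * a 4 5 = 0 &
      t3 * a 2 2 + t3 * a 5 5 + t3 * b 0 0 = 0] &
     [/\ - t2 * a 3 3 - t2 * a 4 4 - t2 * b 0 0 = 0,
      t3 * a 3 2 - t2 * a 5 4 = 0 &
      t3 * a 4 2 + t2 * a 5 3 + t1 * b 0 2 = 0]]),
    ([/\ [/\ t3 * a 0 4 + t2 * a 1 5 + t1 * b 1 0 = 0,
      - t1 * a 0 3 + t2 * a 2 5 = 0 &
      t1 * a 0 2 + t2 * a 3 5 + t3 * b 1 2 = 0],
     [/\ - t3 * a 0 1 + t2 * a 4 5 = 0,
      t2 * a 0 0 + t2 * a 5 5 + t2 * b 1 1 = 0 &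
      - t1 * a 1 3 - t3 * a 2 4 - t2 * b 1 2 = 0],
     [/\ t1 * a 1 2 - t3 * a 3 4 = 0,
      - t3 * a 1 1 - t3 * a 4 4 - t3 * b 1 1 = 0 &
      t2 * a 1 0 - t3 * a 5 4 = 0],
     [/\ t1 * a 2 2 + t1 * a 3 3 + t1 * b 1 1 = 0,
      - t3 * a 2 1 + t1 * a 4 3 = 0 &
      t2 * a 2 0 + t1 * a 5 3 + t3 * b 1 0 = 0] &
     [/\ - t3 * a 3 1 - t1 * a 4 2 - t2 * b 1 0 = 0,
      t2 * a 3 0 - t1 * a 5 2 = 0 &
      t2 * a 4 0 + t3 * a 5 1 + t1 * b 1 2 = 0]]) &
    ([/\ [/\ t2 * a 0 2 + t3 * a 1 3 + t1 * b 2 0 = 0,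
      - t2 * a 0 1 + t3 * a 2 3 = 0 &
      t3 * a 0 0 + t3 * a 3 3 + t3 * b 2 2 = 0],
     [/\ - t1 * a 0 5 + t3 * a 4 3 = 0,
      t1 * a 0 4 + t3 * a 5 3 + t2 * b 2 1 = 0 &
      - t2 * a 1 1 - t2 * a 2 2 - t2 * b 2 2 = 0],
     [/\ t3 * a 1 0 - t2 * a 3 2 = 0,
      - t1 * a 1 5 - t2 * a 4 2 - t3 * b 2 1 = 0 &
      t1 * a 1 4 - t2 * a 5 2 = 0],
     [/\ t3 * a 2 0 + t2 * a 3 1 + t1 * b 2 1 = 0,
      - t1 * a 2 5 + t2 * a 4 1 = 0 &
      t1 * a 2 4 + t2 * a 5 1 + t3 * b 2 0 = 0] &
     [/\ - t1 * a 3 5 - t3 * a 4 0 - t2 * b 2 0 = 0,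
      t1 * a 3 4 - t3 * a 5 0 = 0 &
      t1 * a 4 4 + t1 * a 5 5 + t1 * b 2 2 = 0]])].
Proof.
move=> a b X0; have E k i j : wc (actW X (cart t1 t2 t3)) k i j = 0 by rewrite X0 wc0.
do !split;
  [have := E 0 0 1
  |have := E 0 0 2
  |have := E 0 0 3
  |have := E 0 0 4
  |have := E 0 0 5
  |have := E 0 1 2
  |have := E 0 1 3
  |have := E 0 1 4
  |have := E 0 1 5
  |have := E 0 2 3
  |have := E 0 2 4
  |have := E 0 2 5
  |have := E 0 3 4
  |have := E 0 3 5
  |have := E 0 4 5
  |have := E 1 0 1
  |have := E 1 0 2
  |have := E 1 0 3
  |have := E 1 0 4
  |have := E 1 0 5
  |have := E 1 1 2
  |have := E 1 1 3
  |have := E 1 1 4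
  |have := E 1 1 5
  |have := E 1 2 3
  |have := E 1 2 4
  |have := E 1 2 5
  |have := E 1 3 4
  |have := E 1 3 5
  |have := E 1 4 5
  |have := E 2 0 1
  |have := E 2 0 2
  |have := E 2 0 3
  |have := E 2 0 4
  |have := E 2 0 5
  |have := E 2 1 2
  |have := E 2 1 3
  |have := E 2 1 4
  |have := E 2 1 5
  |have := E 2 2 3
  |have := E 2 2 4
  |have := E 2 2 5
  |have := E 2 3 4
  |have := E 2 3 5
  |have := E 2 4 5];
  rewrite wc_actW !wc_cart //= -/a -/b => H; rewrite -[RHS]H;
  move: a b {H E} => a b; ring.
Qed.

(** The entries of [a] with indices of different parity form six blocks for [cube_block]; the
    off-diagonal entries of equal parity, with those of [b], form two blocks for [torus9]. For each
    diagonal entry of [b], three equations on disjoint pairs of indices add up to [3 * b k k] plus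
    the trace of [a], so it vanishes; the diagonal of [a] then alternates in sign. *)
Lemma act_system (F : numFieldType) (t1 t2 t3 : F) (a b : nat -> nat -> F) :
  t1 != 0 -> t2 != 0 -> t3 != 0 ->
  t1 ^+ 3 != t2 ^+ 3 -> t1 ^+ 3 != t3 ^+ 3 -> t2 ^+ 3 != t3 ^+ 3 ->
  (t1 ^+ 3 + t2 ^+ 3 + t3 ^+ 3) ^+ 3 - (3 * t1 * t2 * t3) ^+ 3 != 0 ->
  [/\ ([/\ [/\ t1 * a 0 0 + t1 * a 1 1 + t1 * b 0 0 = 0,
      - t3 * a 0 5 + t1 * a 2 1 = 0 &
      t2 * a 0 4 + t1 * a 3 1 + t3 * b 0 2 = 0],
     [/\ - t2 * a 0 3 + t1 * a 4 1 = 0,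
      t3 * a 0 2 + t1 * a 5 1 + t2 * b 0 1 = 0 &
      - t3 * a 1 5 - t1 * a 2 0 - t2 * b 0 2 = 0],
     [/\ t2 * a 1 4 - t1 * a 3 0 = 0,
      - t2 * a 1 3 - t1 * a 4 0 - t3 * b 0 1 = 0 &
      t3 * a 1 2 - t1 * a 5 0 = 0],
     [/\ t2 * a 2 4 + t3 * a 3 5 + t1 * b 0 1 = 0,
      - t2 * a 2 3 + t3 * a 4 5 = 0 &
      t3 * a 2 2 + t3 * a 5 5 + t3 * b 0 0 = 0] &
     [/\ - t2 * a 3 3 - t2 * a 4 4 - t2 * b 0 0 = 0,
      t3 * a 3 2 - t2 * a 5 4 = 0 &
      t3 * a 4 2 + t2 * a 5 3 + t1 * b 0 2 = 0]]),
    ([/\ [/\ t3 * a 0 4 + t2 * a 1 5 + t1 * b 1 0 = 0,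
      - t1 * a 0 3 + t2 * a 2 5 = 0 &
      t1 * a 0 2 + t2 * a 3 5 + t3 * b 1 2 = 0],
     [/\ - t3 * a 0 1 + t2 * a 4 5 = 0,
      t2 * a 0 0 + t2 * a 5 5 + t2 * b 1 1 = 0 &
      - t1 * a 1 3 - t3 * a 2 4 - t2 * b 1 2 = 0],
     [/\ t1 * a 1 2 - t3 * a 3 4 = 0,
      - t3 * a 1 1 - t3 * a 4 4 - t3 * b 1 1 = 0 &
      t2 * a 1 0 - t3 * a 5 4 = 0],
     [/\ t1 * a 2 2 + t1 * a 3 3 + t1 * b 1 1 = 0,
      - t3 * a 2 1 + t1 * a 4 3 = 0 &
      t2 * a 2 0 + t1 * a 5 3 + t3 * b 1 0 = 0] &
     [/\ - t3 * a 3 1 - t1 * a 4 2 - t2 * b 1 0 = 0,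
      t2 * a 3 0 - t1 * a 5 2 = 0 &
      t2 * a 4 0 + t3 * a 5 1 + t1 * b 1 2 = 0]]) &
    ([/\ [/\ t2 * a 0 2 + t3 * a 1 3 + t1 * b 2 0 = 0,
      - t2 * a 0 1 + t3 * a 2 3 = 0 &
      t3 * a 0 0 + t3 * a 3 3 + t3 * b 2 2 = 0],
     [/\ - t1 * a 0 5 + t3 * a 4 3 = 0,
      t1 * a 0 4 + t3 * a 5 3 + t2 * b 2 1 = 0 &
      - t2 * a 1 1 - t2 * a 2 2 - t2 * b 2 2 = 0],
     [/\ t3 * a 1 0 - t2 * a 3 2 = 0,
      - t1 * a 1 5 - t2 * a 4 2 - t3 * b 2 1 = 0 &
      t1 * a 1 4 - t2 * a 5 2 = 0],
     [/\ t3 * a 2 0 + t2 * a 3 1 + t1 * b 2 1 = 0,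
      - t1 * a 2 5 + t2 * a 4 1 = 0 &
      t1 * a 2 4 + t2 * a 5 1 + t3 * b 2 0 = 0] &
     [/\ - t1 * a 3 5 - t3 * a 4 0 - t2 * b 2 0 = 0,
      t1 * a 3 4 - t3 * a 5 0 = 0 &
      t1 * a 4 4 + t1 * a 5 5 + t1 * b 2 2 = 0]])] ->
  a 0 0 + a 1 1 + a 2 2 + a 3 3 + a 4 4 + a 5 5 = 0 -> b 0 0 + b 1 1 + b 2 2 = 0 ->
  (forall i j, (i < 6)%N -> (j < 6)%N -> a i j = if i == j then (if odd i then - a 0 0 else a 0 0) else
    0)
  /\ (forall i j, (i < 3)%N -> (j < 3)%N -> b i j = 0).
Proof.
move=> h1 h2 h3 n12 n13 n23 D.
have m12 : t2 ^+ 3 != t1 ^+ 3 by rewrite eq_sym.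
have m13 : t3 ^+ 3 != t1 ^+ 3 by rewrite eq_sym.
have m23 : t3 ^+ 3 != t2 ^+ 3 by rewrite eq_sym.
move=> [[[e112 e113 e114] [e115 e116 e123] [e124 e125 e126] [e134 e135 e136] [e145 e146 e156]] [[e212
  e213 e214] [e215 e216 e223] [e224 e225 e226] [e234 e235 e236] [e245 e246 e256]] [[e312 e313 e314]
  [e315 e316 e323] [e324 e325 e326] [e334 e335 e336] [e345 e346 e356]]] tA tB.
have [zA12 zA56 zA34] : [/\ a 0 1 = 0, a 4 5 = 0 & - a 2 3 = 0].
  apply: (@cube_block F t2 t3 (a 0 1) (a 4 5) (- a 2 3));
  [done | done | done | lin_from e135 | lin_from e313 | lin_from e215].
move/eqP: zA34; rewrite oppr_eq0 => /eqP zA34.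
have [zA14 zA52 zA36] : [/\ a 0 3 = 0, a 4 1 = 0 & - a 2 5 = 0].
  apply: (@cube_block F t1 t2 (a 0 3) (a 4 1) (- a 2 5));
  [done | done | done | lin_from e335 | lin_from e213 | lin_from e115].
move/eqP: zA36; rewrite oppr_eq0 => /eqP zA36.
have [zA16 zA32 zA54] : [/\ a 0 5 = 0, a 2 1 = 0 & - a 4 3 = 0].
  apply: (@cube_block F t1 t3 (a 0 5) (a 2 1) (- a 4 3));
  [done | done | done | lin_from e235 | lin_from e315 | lin_from e113].
move/eqP: zA54; rewrite oppr_eq0 => /eqP zA54.
have [zA21 zA43 zA65] : [/\ a 1 0 = 0, a 3 2 = 0 & - a 5 4 = 0].
  apply: (@cube_block F t2 t3 (a 1 0) (a 3 2) (- a 5 4));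
  [done | done | done | lin_from e146 | lin_from e226 | lin_from e324].
move/eqP: zA65; rewrite oppr_eq0 => /eqP zA65.
have [zA23 zA61 zA45] : [/\ a 1 2 = 0, a 5 0 = 0 & - a 3 4 = 0].
  apply: (@cube_block F t1 t3 (a 1 2) (a 5 0) (- a 3 4));
  [done | done | done | lin_from e346 | lin_from e224 | lin_from e126].
move/eqP: zA45; rewrite oppr_eq0 => /eqP zA45.
have [zA25 zA41 zA63] : [/\ a 1 4 = 0, a 3 0 = 0 & - a 5 2 = 0].
  apply: (@cube_block F t1 t2 (a 1 4) (a 3 0) (- a 5 2));
  [done | done | done | lin_from e246 | lin_from e326 | lin_from e124].
move/eqP: zA63; rewrite oppr_eq0 => /eqP zA63.
have [[zA62 zA13 zB23] [zB12 zA46 zA51] [zA35 zB31 zA24]] : [/\ [/\ a 5 1 = 0, a 0 2 = 0 & b 1 2 = 0],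
   [/\ b 0 1 = 0, a 3 5 = 0 & a 4 0 = 0]
   & [/\ a 2 4 = 0, b 2 0 = 0 & a 1 3 = 0]].
  apply: (@torus9 F t1 t2 t3 (a 5 1) (a 0 2) (b 1 2) (b 0 1) (a 3 5) (a 4 0) (a 2 4) (b 2 0) (a 1 3));
  [done
  |lin_from e116
  |lin_from e214
  |lin_from e256
  |lin_from e134
  |lin_from e345
  |lin_from e125
  |lin_from e336
  |lin_from e312
  |lin_from e223].
have [[zA42 zB13 zA53] [zA15 zA64 zB21] [zB32 zA31 zA26]] : [/\ [/\ a 3 1 = 0, b 0 2 = 0 & a 4 2 = 0],
   [/\ a 0 4 = 0, a 5 3 = 0 & b 1 0 = 0]
   & [/\ b 2 1 = 0, a 2 0 = 0 & a 1 5 = 0]].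
  apply: (@torus9 F t1 t2 t3 (a 3 1) (b 0 2) (a 4 2) (a 0 4) (a 5 3) (b 1 0) (b 2 1) (a 2 0) (a 1 5));
  [done
  |lin_from e114
  |lin_from e156
  |lin_from e245
  |lin_from e316
  |lin_from e236
  |lin_from e212
  |lin_from e334
  |lin_from e123
  |lin_from e325].
have can t (x : F) : t != 0 -> t * x = 0 -> x = 0.
  by move=> t0 /eqP; rewrite mulf_eq0 (negPf t0) => /eqP.
have d112 : a 0 0 + a 1 1 + b 0 0 = 0 by apply: (can _ _ h1); lin_from e112.
have d136 : a 2 2 + a 5 5 + b 0 0 = 0 by apply: (can _ _ h3); lin_from e136.
have d145 : a 3 3 + a 4 4 + b 0 0 = 0 by apply: (can _ _ h2); lin_from e145.
have d216 : a 0 0 + a 5 5 + b 1 1 = 0 by apply: (can _ _ h2); lin_from e216.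
have d225 : a 1 1 + a 4 4 + b 1 1 = 0 by apply: (can _ _ h3); lin_from e225.
have d234 : a 2 2 + a 3 3 + b 1 1 = 0 by apply: (can _ _ h1); lin_from e234.
have d314 : a 0 0 + a 3 3 + b 2 2 = 0 by apply: (can _ _ h3); lin_from e314.
have d323 : a 1 1 + a 2 2 + b 2 2 = 0 by apply: (can _ _ h2); lin_from e323.
have d356 : a 4 4 + a 5 5 + b 2 2 = 0 by apply: (can _ _ h1); lin_from e356.
have h3F : (3 : F) != 0 by rewrite pnatr_eq0.
have zB11 : b 0 0 = 0.
  apply: (can 3 _ h3F); transitivity ((a 0 0 + a 1 1 + b 0 0) + (a 2 2 + a 5 5 + b 0 0)
    + (a 3 3 + a 4 4 + b 0 0) - (a 0 0 + a 1 1 + a 2 2 + a 3 3 + a 4 4 + a 5 5)); first by ring.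
  by rewrite d112 d136 d145 tA !addr0 subrr.
have zB22 : b 1 1 = 0.
  apply: (can 3 _ h3F); transitivity ((a 0 0 + a 5 5 + b 1 1) + (a 1 1 + a 4 4 + b 1 1)
    + (a 2 2 + a 3 3 + b 1 1) - (a 0 0 + a 1 1 + a 2 2 + a 3 3 + a 4 4 + a 5 5)); first by ring.
  by rewrite d216 d225 d234 tA !addr0 subrr.
have zB33 : b 2 2 = 0 by move: tB; rewrite zB11 zB22 !add0r.
have a1 : a 1 1 = - a 0 0 by rewrite -[RHS]add0r -d112 zB11; ring.
have a5 : a 5 5 = - a 0 0 by rewrite -[RHS]add0r -d216 zB22; ring.
have a3 : a 3 3 = - a 0 0 by rewrite -[RHS]add0r -d314 zB33; ring.
have a2 : a 2 2 = a 0 0 by rewrite -[RHS]add0r -d136 zB11 a5; ring.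
have a4 : a 4 4 = a 0 0 by rewrite -[RHS]add0r -d356 zB33 a5; ring.
split=> i j i3 j3; last first.
  by case: i i3 => [|[|[|?]]] // _; case: j j3 => [|[|[|?]]].
by case: i i3 => [|[|[|[|[|[|?]]]]]] // _; case: j j3 => [|[|[|[|[|[|?]]]]]].
Qed.

Lemma sum_ltn6 (V : nmodType) (G : nat -> nat -> V) :
  \sum_(i < 6) \sum_(j < 6 | (i < j)%N) G i j =
  G 0 1 + G 0 2 + G 0 3 + G 0 4 + G 0 5 + G 1 2 + G 1 3
  + G 1 4 + G 1 5 + G 2 3 + G 2 4 + G 2 5 + G 3 4 + G 3 5 + G 4 5.
Proof.
under eq_bigr do rewrite big_mkcond.
by rewrite !big_ord_recl !big_ord0 /= ?(addr0, add0r) !addrA.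
Qed.

(** A matrix whose trace-free part vanishes is scalar; [s] and [s'] are the two scalars, unknown at
    this stage. *)
Lemma contr_entries (F : numFieldType) (w x : W F) : contr w x = 0 -> exists s s' : F,
  (forall p q, (p < 6)%N -> (q < 6)%N ->
     \sum_(k < 3) \sum_(b < 6) wc w k p b * wc x k q b = if p == q then s else 0) /\
  (forall p q, (p < 3)%N -> (q < 3)%N ->
     \sum_(i < 6) \sum_(j < 6 | (i < j)%N) wc w p i j * wc x q i j
       = if p == q then s' else 0).
Proof.
move=> c0; have /(congr1 vsval) c1 : (contr w x).1 = 0 by rewrite c0.
have /(congr1 vsval) {c0} c2 : (contr w x).2 = 0 by rewrite c0.
move: c1 c2; rewrite !(raddf0 vsval) /=.
set C := \sum_k _; set D := \matrix_(_, _) _ => /eqP + /eqP; rewrite !subr_eq0 => /eqP c1 /eqP c2.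
exists (\tr C / 6), (\tr D / 3); split=> p q pl ql.
  have /matrixP/(_ (inZp p) (inZp q)) := c1; rewrite {1}/C summxE mxE.
  rewrite -val_eqE /= !modn_small // => E.
  transitivity ((\tr C / 6) *+ (p == q)); last by case: eqP.
  rewrite -E; apply: eq_bigr => k _; rewrite mxE; apply: eq_bigr => b _.
  by rewrite mxE /wc /ent !valZpK.
have /matrixP/(_ (inZp p) (inZp q)) := c2; rewrite {1}/D !mxE.
rewrite -val_eqE /= !modn_small // => E.
transitivity ((\tr D / 3) *+ (p == q)); last by case: eqP.
by rewrite -E; apply: eq_bigr => i _; apply: eq_bigr => j _; rewrite /wc /ent !valZpK.
Qed.

Lemma contr_cart (F : numFieldType) (t1 t2 t3 : F) (x : W F) : contr (cart t1 t2 t3) x = 0 ->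
  let c := wc x in exists s s' : F,
  [/\ ([/\ [/\ t1 * c 0 0 1 + t2 * c 1 0 5 + t3 * c 2 0 3 = s,
      - t3 * c 1 0 4 - t2 * c 2 0 2 = 0 &
      t3 * c 0 0 5 + t1 * c 1 0 3 + t2 * c 2 0 1 = 0],
     [/\ - t2 * c 0 0 4 - t1 * c 1 0 2 = 0,
      t2 * c 0 0 3 + t3 * c 1 0 1 + t1 * c 2 0 5 = 0 &
      - t3 * c 0 0 2 - t1 * c 2 0 4 = 0],
     [/\ t2 * c 1 1 5 + t3 * c 2 1 3 = 0,
      t1 * c 0 0 1 - t3 * c 1 1 4 - t2 * c 2 1 2 = s &
      t3 * c 0 1 5 + t1 * c 1 1 3 = 0],
     [/\ - t2 * c 0 1 4 - t1 * c 1 1 2 + t3 * c 2 0 1 = 0,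
      t2 * c 0 1 3 + t1 * c 2 1 5 = 0 &
      - t3 * c 0 1 2 + t2 * c 1 0 1 - t1 * c 2 1 4 = 0] &
     [/\ - t1 * c 0 1 2 + t2 * c 1 2 5 + t3 * c 2 2 3 = 0,
      t1 * c 0 0 2 - t3 * c 1 2 4 = 0 &
      t3 * c 0 2 5 + t1 * c 1 2 3 - t2 * c 2 1 2 = s]]),
    ([/\ [/\ - t2 * c 0 2 4 + t3 * c 2 0 2 = 0,
      t2 * c 0 2 3 - t3 * c 1 1 2 + t1 * c 2 2 5 = 0 &
      t2 * c 1 0 2 - t1 * c 2 2 4 = 0],
     [/\ - t1 * c 0 1 3 + t2 * c 1 3 5 = 0,
      t1 * c 0 0 3 - t3 * c 1 3 4 + t2 * c 2 2 3 = 0 &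
      t3 * c 0 3 5 - t2 * c 2 1 3 = 0],
     [/\ - t2 * c 0 3 4 + t1 * c 1 2 3 + t3 * c 2 0 3 = s,
      - t3 * c 1 1 3 + t1 * c 2 3 5 = 0 &
      t3 * c 0 2 3 + t2 * c 1 0 3 - t1 * c 2 3 4 = 0],
     [/\ - t1 * c 0 1 4 + t2 * c 1 4 5 - t3 * c 2 3 4 = 0,
      t1 * c 0 0 4 + t2 * c 2 2 4 = 0 &
      t3 * c 0 4 5 - t1 * c 1 3 4 - t2 * c 2 1 4 = 0] &
     [/\ t1 * c 1 2 4 + t3 * c 2 0 4 = 0,
      - t2 * c 0 3 4 - t3 * c 1 1 4 + t1 * c 2 4 5 = s &
      t3 * c 0 2 4 + t2 * c 1 0 4 = 0]]) &
    ([/\ [/\ - t1 * c 0 1 5 - t3 * c 2 3 5 = 0,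
      t1 * c 0 0 5 + t3 * c 1 4 5 + t2 * c 2 2 5 = 0 &
      - t1 * c 1 3 5 - t2 * c 2 1 5 = 0],
     [/\ t2 * c 0 4 5 + t1 * c 1 2 5 + t3 * c 2 0 5 = 0,
      - t2 * c 0 3 5 - t3 * c 1 1 5 = 0 &
      t3 * c 0 2 5 + t2 * c 1 0 5 + t1 * c 2 4 5 = s],
     [/\ t1 * c 0 0 1 + t3 * c 0 2 5 - t2 * c 0 3 4 = s',
      t2 * c 0 0 5 - t3 * c 0 1 4 + t1 * c 0 2 3 = 0 &
      t3 * c 0 0 3 - t2 * c 0 1 2 + t1 * c 0 4 5 = 0],
     [/\ t1 * c 1 0 1 + t3 * c 1 2 5 - t2 * c 1 3 4 = 0,
      t2 * c 1 0 5 - t3 * c 1 1 4 + t1 * c 1 2 3 = s' &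
      t3 * c 1 0 3 - t2 * c 1 1 2 + t1 * c 1 4 5 = 0] &
     [/\ t1 * c 2 0 1 + t3 * c 2 2 5 - t2 * c 2 3 4 = 0,
      t2 * c 2 0 5 - t3 * c 2 1 4 + t1 * c 2 2 3 = 0 &
      t3 * c 2 0 3 - t2 * c 2 1 2 + t1 * c 2 4 5 = s']])].
Proof.
move=> /contr_entries[s [s' [E1 E2]]] c; exists s, s'.
have E3 p q : (p < 3)%N -> (q < 3)%N ->
    let G i j := wc (cart t1 t2 t3) p i j * wc x q i j in
    G 0 1 + G 0 2 + G 0 3 + G 0 4 + G 0 5 + G 1 2 + G 1 3 + G 1 4 + G 1 5 + G 2 3 + G 2 4 + G 2 5 + G 3
    4 + G 3 5 + G 4 5 = if p == q then s' else 0.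
  by move=> pl ql G; rewrite -E2 // (sum_ltn6 G).
have alt0 k i : wc x k i i = 0.
  by have /eqP := wc_alt x k i i; rewrite -addr_eq0 -mulr2n mulrn_eq0 /= => /eqP.
have a01 k : wc x k 1 0 = - wc x k 0 1 := wc_alt x k 0 1.
have a02 k : wc x k 2 0 = - wc x k 0 2 := wc_alt x k 0 2.
have a03 k : wc x k 3 0 = - wc x k 0 3 := wc_alt x k 0 3.
have a04 k : wc x k 4 0 = - wc x k 0 4 := wc_alt x k 0 4.
have a05 k : wc x k 5 0 = - wc x k 0 5 := wc_alt x k 0 5.
have a12 k : wc x k 2 1 = - wc x k 1 2 := wc_alt x k 1 2.
have a13 k : wc x k 3 1 = - wc x k 1 3 := wc_alt x k 1 3.
have a14 k : wc x k 4 1 = - wc x k 1 4 := wc_alt x k 1 4.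
have a15 k : wc x k 5 1 = - wc x k 1 5 := wc_alt x k 1 5.
have a23 k : wc x k 3 2 = - wc x k 2 3 := wc_alt x k 2 3.
have a24 k : wc x k 4 2 = - wc x k 2 4 := wc_alt x k 2 4.
have a25 k : wc x k 5 2 = - wc x k 2 5 := wc_alt x k 2 5.
have a34 k : wc x k 4 3 = - wc x k 3 4 := wc_alt x k 3 4.
have a35 k : wc x k 5 3 = - wc x k 3 5 := wc_alt x k 3 5.
have a45 k : wc x k 5 4 = - wc x k 4 5 := wc_alt x k 4 5.
do !split;
  [have := E1 0 0 isT isT
  |have := E1 1 0 isT isT
  |have := E1 2 0 isT isT
  |have := E1 3 0 isT isT
  |have := E1 4 0 isT isT
  |have := E1 5 0 isT isT
  |have := E1 0 1 isT isT
  |have := E1 1 1 isT isT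
  |have := E1 2 1 isT isT
  |have := E1 3 1 isT isT
  |have := E1 4 1 isT isT
  |have := E1 5 1 isT isT
  |have := E1 0 2 isT isT
  |have := E1 1 2 isT isT
  |have := E1 2 2 isT isT
  |have := E1 3 2 isT isT
  |have := E1 4 2 isT isT
  |have := E1 5 2 isT isT
  |have := E1 0 3 isT isT
  |have := E1 1 3 isT isT
  |have := E1 2 3 isT isT
  |have := E1 3 3 isT isT
  |have := E1 4 3 isT isT
  |have := E1 5 3 isT isT
  |have := E1 0 4 isT isT
  |have := E1 1 4 isT isT
  |have := E1 2 4 isT isT
  |have := E1 3 4 isT isT
  |have := E1 4 4 isT isT
  |have := E1 5 4 isT isT
  |have := E1 0 5 isT isT
  |have := E1 1 5 isT isT
  |have := E1 2 5 isT isT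
  |have := E1 3 5 isT isT
  |have := E1 4 5 isT isT
  |have := E1 5 5 isT isT
  |have := E3 0 0 isT isT
  |have := E3 1 0 isT isT
  |have := E3 2 0 isT isT
  |have := E3 0 1 isT isT
  |have := E3 1 1 isT isT
  |have := E3 2 1 isT isT
  |have := E3 0 2 isT isT
  |have := E3 1 2 isT isT
  |have := E3 2 2 isT isT];
  rewrite ?sum_ord3 ?sum_ord6 /= !wc_cart //= => <-;
  rewrite ?alt0;
  rewrite ?(a01, a02, a03, a04, a05, a12, a13, a14, a15, a23, a24, a25, a34, a35, a45);
  rewrite -/c; move: c {E1 E2 E3 alt0 a01 a02 a03 a04 a05 a12 a13 a14 a15 a23 a24 a25 a34 a35 a45} => c;
    ring.
Qed.

(** The blocks are those of [cross_system]. The last three hypotheses say that the element is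
    orthogonal to u1, u2, u3. Three diagonal equations add up to 3 s, and three others to 3 s', both
    combinations of these relations, so the scalars vanish. Each of the nine coordinates left is
    then isolated, up to sign, as 3 t_i times itself: a sum of the three equations in which its term
    occurs, minus two orthogonality relations. *)
Lemma contr_system (F : numFieldType) (t1 t2 t3 s s' : F) (c : nat -> nat -> nat -> F) :
  t1 != 0 -> t2 != 0 -> t3 != 0 ->
  t1 ^+ 3 != t2 ^+ 3 -> t1 ^+ 3 != t3 ^+ 3 -> t2 ^+ 3 != t3 ^+ 3 ->
  (t1 ^+ 3 + t2 ^+ 3 + t3 ^+ 3) ^+ 3 - (3 * t1 * t2 * t3) ^+ 3 != 0 ->
  [/\ ([/\ [/\ t1 * c 0 0 1 + t2 * c 1 0 5 + t3 * c 2 0 3 = s,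
      - t3 * c 1 0 4 - t2 * c 2 0 2 = 0 &
      t3 * c 0 0 5 + t1 * c 1 0 3 + t2 * c 2 0 1 = 0],
     [/\ - t2 * c 0 0 4 - t1 * c 1 0 2 = 0,
      t2 * c 0 0 3 + t3 * c 1 0 1 + t1 * c 2 0 5 = 0 &
      - t3 * c 0 0 2 - t1 * c 2 0 4 = 0],
     [/\ t2 * c 1 1 5 + t3 * c 2 1 3 = 0,
      t1 * c 0 0 1 - t3 * c 1 1 4 - t2 * c 2 1 2 = s &
      t3 * c 0 1 5 + t1 * c 1 1 3 = 0],
     [/\ - t2 * c 0 1 4 - t1 * c 1 1 2 + t3 * c 2 0 1 = 0,
      t2 * c 0 1 3 + t1 * c 2 1 5 = 0 &
      - t3 * c 0 1 2 + t2 * c 1 0 1 - t1 * c 2 1 4 = 0] &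
     [/\ - t1 * c 0 1 2 + t2 * c 1 2 5 + t3 * c 2 2 3 = 0,
      t1 * c 0 0 2 - t3 * c 1 2 4 = 0 &
      t3 * c 0 2 5 + t1 * c 1 2 3 - t2 * c 2 1 2 = s]]),
    ([/\ [/\ - t2 * c 0 2 4 + t3 * c 2 0 2 = 0,
      t2 * c 0 2 3 - t3 * c 1 1 2 + t1 * c 2 2 5 = 0 &
      t2 * c 1 0 2 - t1 * c 2 2 4 = 0],
     [/\ - t1 * c 0 1 3 + t2 * c 1 3 5 = 0,
      t1 * c 0 0 3 - t3 * c 1 3 4 + t2 * c 2 2 3 = 0 &
      t3 * c 0 3 5 - t2 * c 2 1 3 = 0],
     [/\ - t2 * c 0 3 4 + t1 * c 1 2 3 + t3 * c 2 0 3 = s,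
      - t3 * c 1 1 3 + t1 * c 2 3 5 = 0 &
      t3 * c 0 2 3 + t2 * c 1 0 3 - t1 * c 2 3 4 = 0],
     [/\ - t1 * c 0 1 4 + t2 * c 1 4 5 - t3 * c 2 3 4 = 0,
      t1 * c 0 0 4 + t2 * c 2 2 4 = 0 &
      t3 * c 0 4 5 - t1 * c 1 3 4 - t2 * c 2 1 4 = 0] &
     [/\ t1 * c 1 2 4 + t3 * c 2 0 4 = 0,
      - t2 * c 0 3 4 - t3 * c 1 1 4 + t1 * c 2 4 5 = s &
      t3 * c 0 2 4 + t2 * c 1 0 4 = 0]]) &
    ([/\ [/\ - t1 * c 0 1 5 - t3 * c 2 3 5 = 0,
      t1 * c 0 0 5 + t3 * c 1 4 5 + t2 * c 2 2 5 = 0 &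
      - t1 * c 1 3 5 - t2 * c 2 1 5 = 0],
     [/\ t2 * c 0 4 5 + t1 * c 1 2 5 + t3 * c 2 0 5 = 0,
      - t2 * c 0 3 5 - t3 * c 1 1 5 = 0 &
      t3 * c 0 2 5 + t2 * c 1 0 5 + t1 * c 2 4 5 = s],
     [/\ t1 * c 0 0 1 + t3 * c 0 2 5 - t2 * c 0 3 4 = s',
      t2 * c 0 0 5 - t3 * c 0 1 4 + t1 * c 0 2 3 = 0 &
      t3 * c 0 0 3 - t2 * c 0 1 2 + t1 * c 0 4 5 = 0],
     [/\ t1 * c 1 0 1 + t3 * c 1 2 5 - t2 * c 1 3 4 = 0,
      t2 * c 1 0 5 - t3 * c 1 1 4 + t1 * c 1 2 3 = s' &
      t3 * c 1 0 3 - t2 * c 1 1 2 + t1 * c 1 4 5 = 0] &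
     [/\ t1 * c 2 0 1 + t3 * c 2 2 5 - t2 * c 2 3 4 = 0,
      t2 * c 2 0 5 - t3 * c 2 1 4 + t1 * c 2 2 3 = 0 &
      t3 * c 2 0 3 - t2 * c 2 1 2 + t1 * c 2 4 5 = s']])] ->
  c 0 0 1 + c 1 2 3 + c 2 4 5 = 0 -> c 1 0 5 - c 0 3 4 - c 2 1 2 = 0 ->
  c 0 2 5 - c 1 1 4 + c 2 0 3 = 0 ->
  forall k i j, (k < 3)%N -> (i < j < 6)%N -> c k i j = 0.
Proof.
move=> h1 h2 h3 n12 n13 n23 D.
have m12 : t2 ^+ 3 != t1 ^+ 3 by rewrite eq_sym.
have m13 : t3 ^+ 3 != t1 ^+ 3 by rewrite eq_sym.
have m23 : t3 ^+ 3 != t2 ^+ 3 by rewrite eq_sym.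
move=> [[[eA11 eA12 eA13] [eA14 eA15 eA16] [eA21 eA22 eA23] [eA24 eA25 eA26] [eA31 eA32 eA33]] [[eA34
  eA35 eA36] [eA41 eA42 eA43] [eA44 eA45 eA46] [eA51 eA52 eA53] [eA54 eA55 eA56]] [[eA61 eA62 eA63]
  [eA64 eA65 eA66] [eB11 eB12 eB13] [eB21 eB22 eB23] [eB31 eB32 eB33]]] p1 p2 p3.
have [zw135 zw215 zw313] : [/\ c 0 2 4 = 0, - c 1 0 4 = 0 & - c 2 0 2 = 0].
  apply: (@cube_block F t2 t3 (c 0 2 4) (- c 1 0 4) (- c 2 0 2));
  [done | done | done | lin_from eA12 | lin_from eA34 | lin_from eA56].
move/eqP: zw215; rewrite oppr_eq0 => /eqP zw215.
move/eqP: zw313; rewrite oppr_eq0 => /eqP zw313.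
have [zw115 zw213 zw335] : [/\ c 0 0 4 = 0, - c 1 0 2 = 0 & c 2 2 4 = 0].
  apply: (@cube_block F t1 t2 (c 0 0 4) (- c 1 0 2) (c 2 2 4));
  [done | done | done | lin_from eA36 | lin_from eA52 | lin_from eA14].
move/eqP: zw213; rewrite oppr_eq0 => /eqP zw213.
have [zw113 zw315 zw235] : [/\ c 0 0 2 = 0, - c 2 0 4 = 0 & - c 1 2 4 = 0].
  apply: (@cube_block F t1 t3 (c 0 0 2) (- c 2 0 4) (- c 1 2 4));
  [done | done | done | lin_from eA54 | lin_from eA32 | lin_from eA16].
move/eqP: zw315; rewrite oppr_eq0 => /eqP zw315.
move/eqP: zw235; rewrite oppr_eq0 => /eqP zw235.
have [zw146 zw324 zw226] : [/\ c 0 3 5 = 0, c 2 1 3 = 0 & c 1 1 5 = 0].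
  apply: (@cube_block F t2 t3 (c 0 3 5) (c 2 1 3) (c 1 1 5));
  [done | done | done | lin_from eA21 | lin_from eA65 | lin_from eA43].
have [zw126 zw224 zw346] : [/\ c 0 1 5 = 0, - c 1 1 3 = 0 & c 2 3 5 = 0].
  apply: (@cube_block F t1 t3 (c 0 1 5) (- c 1 1 3) (c 2 3 5));
  [done | done | done | lin_from eA45 | lin_from eA61 | lin_from eA23].
move/eqP: zw224; rewrite oppr_eq0 => /eqP zw224.
have [zw124 zw326 zw246] : [/\ c 0 1 3 = 0, - c 2 1 5 = 0 & - c 1 3 5 = 0].
  apply: (@cube_block F t1 t2 (c 0 1 3) (- c 2 1 5) (- c 1 3 5));
  [done | done | done | lin_from eA63 | lin_from eA41 | lin_from eA25].
move/eqP: zw326; rewrite oppr_eq0 => /eqP zw326.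
move/eqP: zw246; rewrite oppr_eq0 => /eqP zw246.
have [[zw214 zw116 zw256] [zw312 zw336 zw223] [zw345 zw134 zw125]] : [/\ [/\ c 1 0 3 = 0, c 0 0 5 = 0 &
  c 1 4 5 = 0],
   [/\ c 2 0 1 = 0, c 2 2 5 = 0 & - c 1 1 2 = 0]
   & [/\ - c 2 3 4 = 0, c 0 2 3 = 0 & - c 0 1 4 = 0]].
  apply: (@torus9 F t1 t2 t3 (c 1 0 3) (c 0 0 5) (c 1 4 5) (c 2 0 1) (c 2 2 5) (- c 1 1 2) (- c 2 3 4)
    (c 0 2 3) (- c 0 1 4));
  [done
  |lin_from eA13
  |lin_from eA62
  |lin_from eB23
  |lin_from eB31
  |lin_from eA35
  |lin_from eA24
  |lin_from eA46
  |lin_from eB12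
  |lin_from eA51].
move/eqP: zw223; rewrite oppr_eq0 => /eqP zw223.
move/eqP: zw345; rewrite oppr_eq0 => /eqP zw345.
move/eqP: zw125; rewrite oppr_eq0 => /eqP zw125.
have [[zw316 zw212 zw236] [zw114 zw245 zw156] [zw334 zw325 zw123]] : [/\ [/\ c 2 0 5 = 0, c 1 0 1 = 0 &
  c 1 2 5 = 0],
   [/\ c 0 0 3 = 0, - c 1 3 4 = 0 & c 0 4 5 = 0]
   & [/\ c 2 2 3 = 0, - c 2 1 4 = 0 & - c 0 1 2 = 0]].
  apply: (@torus9 F t1 t2 t3 (c 2 0 5) (c 1 0 1) (c 1 2 5) (c 0 0 3) (- c 1 3 4) (c 0 4 5) (c 2 2 3) (-
    c 2 1 4) (- c 0 1 2));
  [done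
  |lin_from eA15
  |lin_from eB21
  |lin_from eA64
  |lin_from eA42
  |lin_from eA53
  |lin_from eB13
  |lin_from eB32
  |lin_from eA26
  |lin_from eA31].
move/eqP: zw245; rewrite oppr_eq0 => /eqP zw245.
move/eqP: zw325; rewrite oppr_eq0 => /eqP zw325.
move/eqP: zw123; rewrite oppr_eq0 => /eqP zw123.
have h3F : (3 : F) != 0 by rewrite pnatr_eq0.
have can t (x : F) : t != 0 -> t * x = 0 -> x = 0.
  by move=> t0 /eqP; rewrite mulf_eq0 (negPf t0) => /eqP.
have s0 : s = 0.
  apply: (can 3 _ h3F); transitivity (s + s + s); first by ring.
  rewrite -{1}eA11 -{1}eA33 -eA55.
  transitivity (t1 * (c 0 0 1 + c 1 2 3 + c 2 4 5) + t2 * (c 1 0 5 - c 0 3 4 - c 2 1 2)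
    + t3 * (c 0 2 5 - c 1 1 4 + c 2 0 3)); first by ring.
  by rewrite p1 p2 p3 !mulr0 !addr0.
have s0' : s' = 0.
  apply: (can 3 _ h3F); transitivity (s' + s' + s'); first by ring.
  rewrite -{1}eB11 -{1}eB22 -eB33.
  transitivity (t1 * (c 0 0 1 + c 1 2 3 + c 2 4 5) + t2 * (c 1 0 5 - c 0 3 4 - c 2 1 2)
    + t3 * (c 0 2 5 - c 1 1 4 + c 2 0 3)); first by ring.
  by rewrite p1 p2 p3 !mulr0 !addr0.
rewrite {}s0 {}s0' in eA11 eA22 eA33 eA44 eA55 eA66 eB11 eB22 eB33.
have zw112 : c 0 0 1 = 0.
  apply: (can (3 * t1)); first by rewrite mulf_neq0.
  transitivity ((t1 * c 0 0 1 + t2 * c 1 0 5 + t3 * c 2 0 3) + (t1 * c 0 0 1 - t3 * c 1 1 4 - t2 * c 2 1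
    2) + (t1 * c 0 0 1 + t3 * c 0 2 5 - t2 * c 0 3 4) - t2 * (c 1 0 5 - c 0 3 4 - c 2 1 2) - t3 * (c 0 2
    5 - c 1 1 4 + c 2 0 3)); first by ring.
  by rewrite eA11 eA22 eB11 ?p1 ?p2 ?p3 ?mulr0 ?subr0 ?addr0 ?oppr0.
have zw136 : c 0 2 5 = 0.
  apply: (can (3 * t3)); first by rewrite mulf_neq0.
  transitivity ((t3 * c 0 2 5 + t1 * c 1 2 3 - t2 * c 2 1 2) + (t3 * c 0 2 5 + t2 * c 1 0 5 + t1 * c 2 4
    5) + (t1 * c 0 0 1 + t3 * c 0 2 5 - t2 * c 0 3 4) - t1 * (c 0 0 1 + c 1 2 3 + c 2 4 5) - t2 * (c 1 0
    5 - c 0 3 4 - c 2 1 2)); first by ring.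
  by rewrite eA33 eA66 eB11 ?p1 ?p2 ?p3 ?mulr0 ?subr0 ?addr0 ?oppr0.
have zw145 : c 0 3 4 = 0.
  apply: (can (3 * t2)); first by rewrite mulf_neq0.
  transitivity (- ((- t2 * c 0 3 4 + t1 * c 1 2 3 + t3 * c 2 0 3) + (- t2 * c 0 3 4 - t3 * c 1 1 4 + t1
    * c 2 4 5) + (t1 * c 0 0 1 + t3 * c 0 2 5 - t2 * c 0 3 4) - t1 * (c 0 0 1 + c 1 2 3 + c 2 4 5) - t3
    * (c 0 2 5 - c 1 1 4 + c 2 0 3))); first by ring.
  by rewrite eA44 eA55 eB11 ?p1 ?p2 ?p3 ?mulr0 ?subr0 ?addr0 ?oppr0.
have zw216 : c 1 0 5 = 0.
  apply: (can (3 * t2)); first by rewrite mulf_neq0.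
  transitivity ((t1 * c 0 0 1 + t2 * c 1 0 5 + t3 * c 2 0 3) + (t3 * c 0 2 5 + t2 * c 1 0 5 + t1 * c 2 4
    5) + (t2 * c 1 0 5 - t3 * c 1 1 4 + t1 * c 1 2 3) - t1 * (c 0 0 1 + c 1 2 3 + c 2 4 5) - t3 * (c 0 2
    5 - c 1 1 4 + c 2 0 3)); first by ring.
  by rewrite eA11 eA66 eB22 ?p1 ?p2 ?p3 ?mulr0 ?subr0 ?addr0 ?oppr0.
have zw225 : c 1 1 4 = 0.
  apply: (can (3 * t3)); first by rewrite mulf_neq0.
  transitivity (- ((t1 * c 0 0 1 - t3 * c 1 1 4 - t2 * c 2 1 2) + (- t2 * c 0 3 4 - t3 * c 1 1 4 + t1 *
    c 2 4 5) + (t2 * c 1 0 5 - t3 * c 1 1 4 + t1 * c 1 2 3) - t1 * (c 0 0 1 + c 1 2 3 + c 2 4 5) - t2 *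
    (c 1 0 5 - c 0 3 4 - c 2 1 2))); first by ring.
  by rewrite eA22 eA55 eB22 ?p1 ?p2 ?p3 ?mulr0 ?subr0 ?addr0 ?oppr0.
have zw234 : c 1 2 3 = 0.
  apply: (can (3 * t1)); first by rewrite mulf_neq0.
  transitivity ((t3 * c 0 2 5 + t1 * c 1 2 3 - t2 * c 2 1 2) + (- t2 * c 0 3 4 + t1 * c 1 2 3 + t3 * c 2
    0 3) + (t2 * c 1 0 5 - t3 * c 1 1 4 + t1 * c 1 2 3) - t2 * (c 1 0 5 - c 0 3 4 - c 2 1 2) - t3 * (c 0
    2 5 - c 1 1 4 + c 2 0 3)); first by ring.
  by rewrite eA33 eA44 eB22 ?p1 ?p2 ?p3 ?mulr0 ?subr0 ?addr0 ?oppr0.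
have zw314 : c 2 0 3 = 0.
  apply: (can (3 * t3)); first by rewrite mulf_neq0.
  transitivity ((t1 * c 0 0 1 + t2 * c 1 0 5 + t3 * c 2 0 3) + (- t2 * c 0 3 4 + t1 * c 1 2 3 + t3 * c 2
    0 3) + (t3 * c 2 0 3 - t2 * c 2 1 2 + t1 * c 2 4 5) - t1 * (c 0 0 1 + c 1 2 3 + c 2 4 5) - t2 * (c 1
    0 5 - c 0 3 4 - c 2 1 2)); first by ring.
  by rewrite eA11 eA44 eB33 ?p1 ?p2 ?p3 ?mulr0 ?subr0 ?addr0 ?oppr0.
have zw323 : c 2 1 2 = 0.
  apply: (can (3 * t2)); first by rewrite mulf_neq0.
  transitivity (- ((t1 * c 0 0 1 - t3 * c 1 1 4 - t2 * c 2 1 2) + (t3 * c 0 2 5 + t1 * c 1 2 3 - t2 * c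
    2 1 2) + (t3 * c 2 0 3 - t2 * c 2 1 2 + t1 * c 2 4 5) - t1 * (c 0 0 1 + c 1 2 3 + c 2 4 5) - t3 * (c
    0 2 5 - c 1 1 4 + c 2 0 3))); first by ring.
  by rewrite eA22 eA33 eB33 ?p1 ?p2 ?p3 ?mulr0 ?subr0 ?addr0 ?oppr0.
have zw356 : c 2 4 5 = 0.
  apply: (can (3 * t1)); first by rewrite mulf_neq0.
  transitivity ((- t2 * c 0 3 4 - t3 * c 1 1 4 + t1 * c 2 4 5) + (t3 * c 0 2 5 + t2 * c 1 0 5 + t1 * c 2
    4 5) + (t3 * c 2 0 3 - t2 * c 2 1 2 + t1 * c 2 4 5) - t2 * (c 1 0 5 - c 0 3 4 - c 2 1 2) - t3 * (c 0
    2 5 - c 1 1 4 + c 2 0 3)); first by ring.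
  by rewrite eA55 eA66 eB33 ?p1 ?p2 ?p3 ?mulr0 ?subr0 ?addr0 ?oppr0.
move=> k i j kl /andP[ij jl]; have il := ltn_trans ij jl.
by case: k kl => [|[|[|?]]] // _; case: i il ij => [|[|[|[|[|[|?]]]]]] // _;
  case: j jl => [|[|[|[|[|[|?]]]]]].
Qed.

Definition cartsp (F : numFieldType) : {vspace W F} :=
  <<[:: cart 1 0 0; cart 0 1 0; cart 0 0 1]>>%VS.

Lemma cartE (F : numFieldType) (t1 t2 t3 : F) :
  cart t1 t2 t3 = t1 *: cart 1 0 0 + t2 *: cart 0 1 0 + t3 *: cart 0 0 1.
Proof. by rewrite /cart !scale1r !scale0r !addr0 !add0r. Qed.

Lemma cartspP (F : numFieldType) (w : W F) :
  reflect (exists t1 t2 t3, w = cart t1 t2 t3) (w \in cartsp F).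
Proof.
apply: (iffP idP) => [|[t1 [t2 [t3 ->]]]].
  rewrite /cartsp !span_cons span_nil addv0.
  case/memv_addP => _ /vlineP[t1 ->] [_ /memv_addP[_ /vlineP[t2 ->] [_ /vlineP[t3 ->] ->]] ->].
  by exists t1, t2, t3; rewrite addrA [RHS]cartE.
rewrite cartE; apply: rpredD; first apply: rpredD; apply: rpredZ; apply: memv_span.
- exact: mem_head.
- by apply/mem_behead/mem_head.
- by apply/mem_behead/mem_behead/mem_head.
Qed.

Lemma dim_cartsp (F : numFieldType) : \dim (cartsp F) = 3%N.
Proof.
suff fr : free [:: cart 1 0 0; cart 0 1 0; cart (0 : F) 0 1] by rewrite (eqP fr).
pose B := [tuple cart 1 0 0; cart 0 1 0; cart (0 : F) 0 1].
have -> : [:: cart 1 0 0; cart 0 1 0; cart (0 : F) 0 1] = B by [].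
apply/freeP => k; rewrite !big_ord_recl big_ord0 /= addr0 addrA -cartE => E i.
have := congr1 (fun w => wc w 0 0 1) E; have := congr1 (fun w => wc w 1 0 5) E.
have := congr1 (fun w => wc w 0 2 5) E; rewrite !wc_cart // !wc0 /= => e3 e2 e1.
have [] : [\/ i = ord0, i = lift ord0 ord0 | i = lift ord0 (lift ord0 ord0)].
  by case: i => [[|[|[|]]] il] //; [constructor 1 | constructor 2 | constructor 3]; apply: val_inj.
all: by move=> ->.
Qed.

Lemma cart_abelian (F : numFieldType) (t1 t2 t3 s1 s2 s3 : F) :
  cross (cart t1 t2 t3) (cart s1 s2 s3) = 0.
Proof.
apply: wc_inj => k i j kl /andP[ij jl]; have il := ltn_trans ij jl; rewrite wc0.
have [] := cross_cart t1 t2 t3 (cart s1 s2 s3); rewrite !wc_cart //=.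
move=> [[e112 e113 e114] [e115 e116 e123] [e124 e125 e126] [e134 e135 e136] [e145 e146 e156]] [[e212
  e213 e214] [e215 e216 e223] [e224 e225 e226] [e234 e235 e236] [e245 e246 e256]] [[e312 e313 e314]
  [e315 e316 e323] [e324 e325 e326] [e334 e335 e336] [e345 e346 e356]].
by case: k kl => [|[|[|?]]] // _; case: i il ij => [|[|[|[|[|[|?]]]]]] // _;
  case: j jl => [|[|[|[|[|[|?]]]]]] // _ _;
  [rewrite e112
  |rewrite e113
  |rewrite e114
  |rewrite e115
  |rewrite e116
  |rewrite e123
  |rewrite e124
  |rewrite e125
  |rewrite e126
  |rewrite e134
  |rewrite e135
  |rewrite e136
  |rewrite e145
  |rewrite e146
  |rewrite e156
  |rewrite e212
  |rewrite e213
  |rewrite e214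
  |rewrite e215
  |rewrite e216
  |rewrite e223
  |rewrite e224
  |rewrite e225
  |rewrite e226
  |rewrite e234
  |rewrite e235
  |rewrite e236
  |rewrite e245
  |rewrite e246
  |rewrite e256
  |rewrite e312
  |rewrite e313
  |rewrite e314
  |rewrite e315
  |rewrite e316
  |rewrite e323
  |rewrite e324
  |rewrite e325
  |rewrite e326
  |rewrite e334
  |rewrite e335
  |rewrite e336
  |rewrite e345
  |rewrite e346
  |rewrite e356]; ring.
Qed.

Lemma dotp_cart (F : numFieldType) (t1 t2 t3 : F) (x : W F) : let c := wc x in
  dotp (cart t1 t2 t3) x = 2 * (t1 * (c 0 0 1 + c 1 2 3 + c 2 4 5)
    + t2 * (c 1 0 5 - c 0 3 4 - c 2 1 2) + t3 * (c 0 2 5 - c 1 1 4 + c 2 0 3)).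
Proof.
move=> c; rewrite /cart /u1 /u2 /u3.
have e (a b : 'I_6) (d : 'I_3) n m p : n = a.+1 -> m = b.+1 -> p = d.+1 ->
    abk (stdb 6 F) (stdb 3 F) n m p = basisW F d a b.
  by move=> -> -> ->; exact: abk_stdb.
rewrite (e 0 1 0) // (e 2 3 1) // (e 4 5 2) // (e 4 3 0) // (e 0 5 1) // (e 2 1 2) //.
rewrite (e 2 5 0) // (e 4 1 1) // (e 0 3 2) //.
have D (y z : W F) : dotp (y + z) x = dotp y x + dotp z x.
  by rewrite -[y in y + z]scale1r dotp_linl mul1r.
rewrite !(D, dotpZl) ![dotp (basisW _ _ _ _) x]dotpC !dotp_basisW.
have E (k : 'I_3) (a b : 'I_6) : vsval (x k) a b = c k a b by rewrite /c /wc ent_val valZpK.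
rewrite !E /= {E}/c.
have -> : wc x 0 4 3 = - wc x 0 3 4 by exact: wc_alt.
have -> : wc x 2 2 1 = - wc x 2 1 2 by exact: wc_alt.
have -> : wc x 1 4 1 = - wc x 1 1 4 by exact: wc_alt.
by move: (wc x) => c; ring.
Qed.

Definition generic (F : numFieldType) (t1 t2 t3 : F) : Prop :=
  [/\ [/\ t1 != 0, t2 != 0 & t3 != 0],
      [/\ t1 ^+ 3 != t2 ^+ 3, t1 ^+ 3 != t3 ^+ 3 & t2 ^+ 3 != t3 ^+ 3] &
      (t1 ^+ 3 + t2 ^+ 3 + t3 ^+ 3) ^+ 3 - (3 * t1 * t2 * t3) ^+ 3 != 0].

Lemma mxtrace_sqr_sign (F : numFieldType) (M : 'M[F]_6) s :
  (forall i j, (i < 6)%N -> (j < 6)%N ->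
     ent M i j = if i == j then (if odd i then - s else s) else 0) ->
  \tr (M *m M) = 6 * s ^+ 2.
Proof.
move=> H; have H' (i j : 'I_6) : M i j = if i == j then (if odd i then - s else s) else 0.
  by rewrite -ent_val H.
have D (i : 'I_6) : (M *m M) i i = s ^+ 2.
  rewrite mxE (bigD1 i) //= big1 ?addr0 => [|j ji].
    by rewrite !H' eqxx; case: odd; rewrite ?mulrNN -expr2.
  by rewrite [M i j]H' eq_sym (negPf ji) mul0r.
rewrite /mxtrace; under eq_bigr do rewrite D.
by rewrite sumr_const card_ord mulr_natl.
Qed.

(* If [ad3 l w = 0] then [X = contr l (cross l w)] stabilizes [l] and is
   orthogonal to the stabilizer, so [X] is isotropic; but the stabilizer is
   spanned by [diag (1, -1, 1, -1, 1, -1)]. *)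
Lemma K3_cart (F : numFieldType) (t1 t2 t3 : F) : generic t1 t2 t3 ->
  K3 (cart t1 t2 t3) = cartsp F.
Proof.
case=> [[h1 h2 h3] [n12 n13 n23] D]; set l := cart t1 t2 t3.
apply/eqP; rewrite eqEsubv; apply/andP; split; apply/subvP => w; last first.
  move=> /cartspP[s1 [s2 [s3 ->]]]; apply: (subvP (Z1_sub_K3 l)).
  by rewrite memZ1 cart_abelian.
rewrite memK3 /ad3; set x := cross l w; set X := contr l x => /eqP Xl.
have [aE bE] := act_system h1 h2 h3 n12 n13 n23 D (act_cart Xl)
  (etrans (esym (sum_ord6 _)) (elimT (slvP _) (subvsP X.1)))
  (etrans (esym (sum_ord3 _)) (elimT (slvP _) (subvsP X.2))).
set a := ent (vsval X.1) in aE; set b := ent (vsval X.2) in bE.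
have X2 : vsval X.2 = 0.
  by apply/matrixP => i j; rewrite -[LHS]ent_val [LHS]bE // mxE.
have tX : \tr (vsval X.1 *m vsval X.1) = 6 * a 0%N 0%N ^+ 2.
  exact: mxtrace_sqr_sign aE.
(* Pairing X.l = 0 with [x] gives a vanishing trace of X.1 squared, that is, 6 times the square of
   [a 0 0]. *)
have := dotp_actW X l x; rewrite Xl dotp0l -/X tX X2 mul0mx mxtrace0 addr0 => /esym/eqP.
rewrite !mulf_eq0 !pnatr_eq0 /= orbb => /eqP a0.
have X0 : X = 0.
  rewrite (surjective_pairing X); congr (_, _); apply: val_inj; rewrite ?X2 ?(raddf0 vsval) //.
  apply/matrixP => i j; rewrite -[LHS]/(vsval X.1 i j) -ent_val [LHS]aE // a0 oppr0 if_same if_same.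
  by rewrite [RHS]mxE.
(* As [x] lies in the image of [cross l], it is orthogonal to the centralizer of [l], hence to c;
   this supplies the last three hypotheses of [contr_system]. *)
have perp s1 s2 s3 : dotp (cart s1 s2 s3) x = 0.
  by rewrite dotpC -/(tau _ _ _) tau_swap23 /tau cart_abelian dotp0l oppr0.
have two : (2 : F) != 0 by rewrite pnatr_eq0.
have [s [s' E]] := contr_cart X0.
have x0 : x = 0.
  apply: wc_inj => k i j kl ijl; rewrite wc0.
  apply: (contr_system h1 h2 h3 n12 n13 n23 D E) => //.
  - by apply: (mulfI two); rewrite mulr0 -[RHS](perp 1 0 0) dotp_cart; ring.
  - by apply: (mulfI two); rewrite mulr0 -[RHS](perp 0 1 0) dotp_cart; ring.
  - by apply: (mulfI two); rewrite mulr0 -[RHS](perp 0 0 1) dotp_cart; ring.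
apply/cartspP; exists (wc w 0 0 1), (wc w 1 0 5), (wc w 0 2 5).
apply: wc_inj => k i j kl /andP[ij jl]; have il := ltn_trans ij jl.
rewrite wc_cart //.
apply: (cross_system h1 h2 h3 n12 n13 n23 D) => //; last by rewrite ij.
have := cross_cart t1 t2 t3 w; rewrite -/l -/x x0 /= !wc0.
move=> [[[e112 e113 e114] [e115 e116 e123] [e124 e125 e126] [e134 e135 e136] [e145 e146 e156]] [[e212
  e213 e214] [e215 e216 e223] [e224 e225 e226] [e234 e235 e236] [e245 e246 e256]] [[e312 e313 e314]
  [e315 e316 e323] [e324 e325 e326] [e334 e335 e336] [e345 e346 e356]]].
by do !split; apply/esym.
Qed.

(** * Degenerate coefficients enlarge the kernel *)

Lemma nonzero_of_K3 (F : numFieldType) (t1 t2 t3 : F) :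
  \dim (K3 (cart t1 t2 t3)) = 3%N ->
  forall w, cross (cart t1 t2 t3) w = 0 -> exists s1 s2 s3, w = cart s1 s2 s3.
Proof.
move=> K3d w w0; apply/cartspP.
have ZK := Z1_sub_K3 (cart t1 t2 t3).
have cZ : (cartsp F <= Z1 (cart t1 t2 t3))%VS.
  by apply/subvP => _ /cartspP[s1 [s2 [s3 ->]]]; rewrite memZ1 cart_abelian.
(* The span c is contained in the centralizer, and that in the kernel; equality of dimensions makes
   all three coincide. *)
have /eqP -> : cartsp F == K3 (cart t1 t2 t3).
  by rewrite eqEdim dim_cartsp K3d leqnn (subv_trans cZ ZK).
by apply: (subvP ZK); rewrite memZ1 w0.
Qed.

Lemma alt_of_upper (F : numFieldType) (c : nat -> nat -> F) :
  (\matrix_(i, j) if (i < j)%N then c i j else if (j < i)%N then - c j i else 0)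
    \in altv F 6.
Proof.
apply/altvP/matrixP => i j; rewrite !mxE.
by case: ltngtP; rewrite ?opprK ?oppr0.
Qed.

Definition mkW (F : numFieldType) (c : nat -> nat -> nat -> F) : W F :=
  [ffun k : 'I_3 => Subvs (alt_of_upper (c k))].

Lemma wc_mkW (F : numFieldType) (c : nat -> nat -> nat -> F) k i j :
  (k < 3)%N -> (i < j < 6)%N -> wc (mkW c) k i j = c k i j.
Proof.
move=> kl /andP[ij jl]; have il := ltn_trans ij jl.
by rewrite /wc /ent ffunE /= mxE /= !modn_small // ij.
Qed.

(** Meant for refutations: a candidate for the kernel of [cross] is given by its coordinates, the 45
    equations are checked by computation, and the conclusion is contradicted at one coordinate. *)
Lemma cart_kernel_coef (F : numFieldType) (t1 t2 t3 : F) (c : nat -> nat -> nat -> F) :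
  \dim (K3 (cart t1 t2 t3)) = 3%N ->
  [/\ ([/\ [/\ - t1 * c 1 2 3 + t1 * c 2 4 5 = 0,
      t1 * c 1 1 3 - t3 * c 2 3 5 = 0 &
      - t1 * c 1 1 2 + t2 * c 1 4 5 + t3 * c 2 2 5 = 0],
     [/\ - t2 * c 1 3 5 - t1 * c 2 1 5 = 0,
      t2 * c 1 3 4 + t1 * c 2 1 4 - t3 * c 2 2 3 = 0 &
      - t1 * c 1 0 3 - t3 * c 1 4 5 + t2 * c 2 3 4 = 0],
     [/\ t1 * c 1 0 2 - t2 * c 2 2 4 = 0,
      t3 * c 1 2 5 + t1 * c 2 0 5 + t2 * c 2 2 3 = 0 &
      - t3 * c 1 2 4 - t1 * c 2 0 4 = 0],
     [/\ - t1 * c 1 0 1 - t3 * c 2 0 5 + t2 * c 2 1 4 = 0,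
      - t3 * c 1 1 5 - t2 * c 2 1 3 = 0 &
      t3 * c 1 1 4 + t3 * c 2 0 3 = 0] &
     [/\ t2 * c 1 0 5 + t2 * c 2 1 2 = 0,
      - t2 * c 1 0 4 - t3 * c 2 0 2 = 0 &
      t2 * c 1 0 3 - t3 * c 1 1 2 + t1 * c 2 0 1 = 0]]),
    ([/\ [/\ t1 * c 0 2 3 + t2 * c 2 2 5 - t3 * c 2 3 4 = 0,
      - t1 * c 0 1 3 - t2 * c 2 1 5 = 0 &
      t1 * c 0 1 2 - t2 * c 0 4 5 + t3 * c 2 1 4 = 0],
     [/\ t2 * c 0 3 5 - t3 * c 2 1 3 = 0,
      - t2 * c 0 3 4 + t2 * c 2 1 2 = 0 &
      t1 * c 0 0 3 + t3 * c 0 4 5 + t2 * c 2 0 5 = 0],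
     [/\ - t1 * c 0 0 2 - t3 * c 2 0 4 = 0,
      - t3 * c 0 2 5 + t3 * c 2 0 3 = 0 &
      t3 * c 0 2 4 - t2 * c 2 0 2 = 0],
     [/\ t1 * c 0 0 1 - t1 * c 2 4 5 = 0,
      t3 * c 0 1 5 + t1 * c 2 3 5 = 0 &
      - t3 * c 0 1 4 + t2 * c 2 0 1 - t1 * c 2 3 4 = 0] &
     [/\ - t2 * c 0 0 5 - t3 * c 2 0 1 - t1 * c 2 2 5 = 0,
      t2 * c 0 0 4 + t1 * c 2 2 4 = 0 &
      - t2 * c 0 0 3 + t3 * c 0 1 2 - t1 * c 2 2 3 = 0]]) &
    ([/\ [/\ - t1 * c 0 4 5 - t2 * c 1 2 5 + t3 * c 1 3 4 = 0,
      t3 * c 0 3 5 + t2 * c 1 1 5 = 0 &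
      - t3 * c 0 2 5 - t3 * c 1 1 4 = 0],
     [/\ t1 * c 0 1 5 + t3 * c 1 1 3 = 0,
      - t1 * c 0 1 4 + t3 * c 0 2 3 - t2 * c 1 1 2 = 0 &
      - t2 * c 0 3 4 - t2 * c 1 0 5 = 0],
     [/\ t2 * c 0 2 4 + t3 * c 1 0 4 = 0,
      - t1 * c 0 0 5 - t2 * c 0 2 3 - t3 * c 1 0 3 = 0 &
      t1 * c 0 0 4 + t2 * c 1 0 2 = 0],
     [/\ t3 * c 0 0 5 - t2 * c 0 1 4 + t1 * c 1 4 5 = 0,
      t2 * c 0 1 3 - t1 * c 1 3 5 = 0 &
      - t3 * c 0 0 3 - t2 * c 1 0 1 + t1 * c 1 3 4 = 0] &
     [/\ - t2 * c 0 1 2 + t3 * c 1 0 1 + t1 * c 1 2 5 = 0,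
      t3 * c 0 0 2 - t1 * c 1 2 4 = 0 &
      - t1 * c 0 0 1 + t1 * c 1 2 3 = 0]])] ->
  exists s1 s2 s3 : F, forall k i j, (k < 3)%N -> (i < j < 6)%N ->
    c k i j = cart_coef s1 s2 s3 k i j.
Proof.
move=> K3d [[[e112 e113 e114] [e115 e116 e123] [e124 e125 e126] [e134 e135 e136] [e145 e146 e156]]
  [[e212 e213 e214] [e215 e216 e223] [e224 e225 e226] [e234 e235 e236] [e245 e246 e256]] [[e312 e313
  e314] [e315 e316 e323] [e324 e325 e326] [e334 e335 e336] [e345 e346 e356]]].
have [|s1 [s2 [s3 E]]] := nonzero_of_K3 K3d (w := mkW c).
  apply: wc_inj => k i j kl /andP[ij jl]; have il := ltn_trans ij jl; rewrite wc0.
  have [] := cross_cart t1 t2 t3 (mkW c); rewrite !wc_mkW //.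
  move=> [[f112 f113 f114] [f115 f116 f123] [f124 f125 f126] [f134 f135 f136] [f145 f146 f156]] [[f212
    f213 f214] [f215 f216 f223] [f224 f225 f226] [f234 f235 f236] [f245 f246 f256]] [[f312 f313 f314]
    [f315 f316 f323] [f324 f325 f326] [f334 f335 f336] [f345 f346 f356]].
  by case: k kl => [|[|[|?]]] // _; case: i il ij => [|[|[|[|[|[|?]]]]]] // _;
    case: j jl => [|[|[|[|[|[|?]]]]]] // _ _;
    [rewrite f112
    |rewrite f113
    |rewrite f114
    |rewrite f115
    |rewrite f116
    |rewrite f123
    |rewrite f124
    |rewrite f125
    |rewrite f126
    |rewrite f134
    |rewrite f135
    |rewrite f136
    |rewrite f145
    |rewrite f146
    |rewrite f156
    |rewrite f212
    |rewrite f213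
    |rewrite f214
    |rewrite f215
    |rewrite f216
    |rewrite f223
    |rewrite f224
    |rewrite f225
    |rewrite f226
    |rewrite f234
    |rewrite f235
    |rewrite f236
    |rewrite f245
    |rewrite f246
    |rewrite f256
    |rewrite f312
    |rewrite f313
    |rewrite f314
    |rewrite f315
    |rewrite f316
    |rewrite f323
    |rewrite f324
    |rewrite f325
    |rewrite f326
    |rewrite f334
    |rewrite f335
    |rewrite f336
    |rewrite f345
    |rewrite f346
    |rewrite f356].
exists s1, s2, s3 => k i j kl /andP[ij jl]; have il := ltn_trans ij jl.
by rewrite -(wc_mkW c kl) ?ij // E wc_cart.
Qed.

(** A solution of the nine equations, placed on the coordinates of the first [torus9] block of
    [cross_system], gives an element of the kernel of [cross]. These coordinates vanish on c. *)
Lemma torus_kernel (F : numFieldType) (t1 t2 t3 x00 x01 x02 x10 x11 x12 x20 x21 x22 : F) :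
  \dim (K3 (cart t1 t2 t3)) = 3%N ->
  t1 * x00 + t2 * x10 + t3 * x01 = 0 -> t1 * x01 + t2 * x11 + t3 * x02 = 0 -> t1 * x02 + t2 * x12 + t3 *
    x00 = 0 ->
  t1 * x10 + t2 * x20 + t3 * x11 = 0 -> t1 * x11 + t2 * x21 + t3 * x12 = 0 -> t1 * x12 + t2 * x22 + t3 *
    x10 = 0 ->
  t1 * x20 + t2 * x00 + t3 * x21 = 0 -> t1 * x21 + t2 * x01 + t3 * x22 = 0 -> t1 * x22 + t2 * x02 + t3 *
    x20 = 0 ->
  x00 = 0.
Proof.
move=> K3d e00 e01 e02 e10 e11 e12 e20 e21 e22.
have [|s1 [s2 [s3 E]]] := @cart_kernel_coef F t1 t2 t3
    (fun k i j : nat => match k, i, j with | 2%N, 1%N, 4%N => x00 | 2%N, 2%N, 3%N => - x01 | 0%N, 1%N,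
    2%N => x02 | 1%N, 3%N, 4%N => x10 | 0%N, 0%N, 3%N => - x11 | 0%N, 4%N, 5%N => - x12 | 1%N, 0%N, 1%N
    => - x20 | 2%N, 0%N, 5%N => - x21 | 1%N, 2%N, 5%N => - x22 | _, _, _ => 0 end) K3d.
    do !split=> /=;
    [ring
    |ring
    |ring
    |ring
    |lin_from e00
    |ring
    |ring
    |lin_from e21
    |ring
    |lin_from e20
    |ring
    |ring
    |ring
    |ring
    |ring
    |ring
    |ring
    |lin_from e02
    |ring
    |ring
    |lin_from e11
    |ring
    |ring
    |ring
    |ring
    |ring
    |ring
    |ring
    |ring
    |lin_from e01
    |lin_from e12
    |ring
    |ring
    |ring
    |ring
    |ring
    |ring
    |ring
    |ring
    |ring
    |ring
    |lin_from e10
    |lin_from e22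
    |ring
    |ring].
by have := E 2 1 4 isT isT.
Qed.

(** The right-hand side is the determinant of the circulant matrix of x, y, z, and the three factors
    are its eigenvalues; [w] is a primitive cube root of unity. *)
Lemma hesse_factor (F : numFieldType) (w x y z : F) : w ^+ 2 + w + 1 = 0 ->
  (x + y + z) * ((x + w * y + w ^+ 2 * z) * (x + w ^+ 2 * y + w * z)) =
  x ^+ 3 + y ^+ 3 + z ^+ 3 - 3 * (x * y * z).
Proof.
move=> w0; transitivity (x ^+ 3 + y ^+ 3 + z ^+ 3 - 3 * (x * y * z) + (w ^+ 2 + w + 1) *
  ((x + y + z) * (x * y + x * z + y * z * (1 + w * (w - 1)) + (w - 1) * (y ^+ 2 + z ^+ 2)))).
  by ring.
by rewrite w0 mul0r addr0.
Qed.

(** The form of degree 9 is the product of the nine linear forms x + a y + b z with a, b cube roots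
    of 1. Factoring the difference of cubes gives S = c P with c^3 = 1; this says that x, y, c z are
    a zero of the cubic in [hesse_factor]. *)
Lemma hesse_root (F : numFieldType) (w x y z : F) : w ^+ 2 + w + 1 = 0 ->
  (x ^+ 3 + y ^+ 3 + z ^+ 3) ^+ 3 - (3 * x * y * z) ^+ 3 = 0 ->
  exists a b, [/\ a ^+ 3 = 1, b ^+ 3 = 1 & x + a * y + b * z = 0].
Proof.
move=> w0; have w3 : w ^+ 3 = 1.
  apply/eqP; rewrite -subr_eq0; apply/eqP; transitivity ((w ^+ 2 + w + 1) * (w - 1)); first by ring.
  by rewrite w0 mul0r.
set S := _ + z ^+ 3; set P := 3 * x * y * z => D.
have [c c3 cE] : exists2 c, c ^+ 3 = 1 & S = c * P.
  have : (S - P) * ((S - w * P) * (S - w ^+ 2 * P)) = 0.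
    transitivity (S ^+ 3 - P ^+ 3 + (w ^+ 2 + w + 1) * (S * P * (w * P - S) + P ^+ 3 * (1 - w))
      ); last by rewrite D w0 mul0r addr0.
    clearbody S P; ring.
  move/eqP; rewrite !mulf_eq0 !subr_eq0 => /or3P[] /eqP->.
  - by exists 1; rewrite ?expr1n ?mul1r.
  - by exists w.
  - by exists (w ^+ 2) => //; rewrite exprAC w3 expr1n.
have : (x + y + c * z) * ((x + w * y + w ^+ 2 * (c * z)) * (x + w ^+ 2 * y + w * (c * z))) = 0.
  rewrite hesse_factor // exprMn c3 mul1r -/S cE /P.
  apply/eqP; rewrite subr_eq0; apply/eqP; ring.
have w6 : (w ^+ 2) ^+ 3 = 1 by rewrite exprAC w3 expr1n.
move/eqP; rewrite !mulf_eq0 => /or3P[] /eqP H.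
- by exists 1, c; rewrite expr1n mul1r.
- exists w, (w ^+ 2 * c); split=> //; first by rewrite exprMn w6 mul1r.
  by rewrite -H; ring.
- exists (w ^+ 2), (w * c); split=> //; first by rewrite exprMn w3 mul1r.
  by rewrite -H; ring.
Qed.

(* If a condition fails, some explicit element of the kernel of [cross] is not
   in [cartsp]. *)
Lemma cart_generic (F : numFieldType) (w t1 t2 t3 : F) : w ^+ 2 + w + 1 = 0 ->
  \dim (K3 (cart t1 t2 t3)) = 3%N -> generic t1 t2 t3.
Proof.
move=> w0 K3d.
have one : (1 : F) != 0 by rewrite oner_eq0.
have h1 : t1 != 0.
  apply: contra_neq one => t0; rewrite {}t0 in K3d.
  (* The coordinate (0, 0, 1) occurs in the equations only with the factor [t1], so for t1 = 0 it is
     free, whereas elements of c have equal coordinates at (0, 0, 1) and (2, 4, 5). *)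
  have [|s1 [s2 [s3 E]]] := cart_kernel_coef
    (c := (fun k i j : nat => match k, i, j with | 0%N, 0%N, 1%N => 1 | _, _, _ => 0 end)) K3d.
    by do !split=> /=; ring.
  exact: etrans (E 0%N 0%N 1%N isT isT) (esym (E 2%N 4%N 5%N isT isT)).
have h2 : t2 != 0.
  apply: contra_neq one => t0; rewrite {}t0 in K3d.
  have [|s1 [s2 [s3 E]]] := cart_kernel_coef
    (c := (fun k i j : nat => match k, i, j with | 1%N, 0%N, 5%N => 1 | _, _, _ => 0 end)) K3d.
    by do !split=> /=; ring.
  have /= /esym/eqP := E 0 3 4 isT isT; rewrite oppr_eq0 => /eqP s20.
  exact: etrans (E 1%N 0%N 5%N isT isT) s20.
have h3 : t3 != 0.
  apply: contra_neq one => t0; rewrite {}t0 in K3d.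
  have [|s1 [s2 [s3 E]]] := cart_kernel_coef
    (c := (fun k i j : nat => match k, i, j with | 0%N, 2%N, 5%N => 1 | _, _, _ => 0 end)) K3d.
    by do !split=> /=; ring.
  have /= /esym/eqP := E 1 1 4 isT isT; rewrite oppr_eq0 => /eqP s30.
  exact: etrans (E 0%N 2%N 5%N isT isT) s30.
have n12 : t1 ^+ 3 != t2 ^+ 3.
  apply/negP => /eqP eq3; have H : t1 ^+ 3 - t2 ^+ 3 = 0 by rewrite eq3 subrr.
  (* A null vector of one of the blocks of type [cube_block], whose determinant vanishes when the
     two cubes agree. The next two cases use the blocks of the other pairs. *)
  have [|s1 [s2 [s3 E]]] := cart_kernel_coef
    (c := (fun k i j : nat => match k, i, j with | 2%N, 2%N, 4%N => t1 * t2 | 0%N, 0%N, 4%N => - (t1 ^+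
    2) | 1%N, 0%N, 2%N => t2 ^+ 2 | _, _, _ => 0 end)) K3d.
    by do !split=> /=; first [ring | lin_from H].
  have /= /eqP := E 2 2 4 isT isT; rewrite mulf_eq0.
  by rewrite (negPf h1) (negPf h2).
have n13 : t1 ^+ 3 != t3 ^+ 3.
  apply/negP => /eqP eq3; have H : t1 ^+ 3 - t3 ^+ 3 = 0 by rewrite eq3 subrr.
  have [|s1 [s2 [s3 E]]] := cart_kernel_coef
    (c := (fun k i j : nat => match k, i, j with | 2%N, 0%N, 4%N => t1 * t3 | 1%N, 2%N, 4%N => - (t1 ^+
    2) | 0%N, 0%N, 2%N => - (t3 ^+ 2) | _, _, _ => 0 end)) K3d.
    by do !split=> /=; first [ring | lin_from H].
  have /= /eqP := E 2 0 4 isT isT; rewrite mulf_eq0.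
  by rewrite (negPf h1) (negPf h3).
have n23 : t2 ^+ 3 != t3 ^+ 3.
  apply/negP => /eqP eq3; have H : t2 ^+ 3 - t3 ^+ 3 = 0 by rewrite eq3 subrr.
  have [|s1 [s2 [s3 E]]] := cart_kernel_coef
    (c := (fun k i j : nat => match k, i, j with | 2%N, 0%N, 2%N => t2 * t3 | 1%N, 0%N, 4%N => - (t3 ^+
    2) | 0%N, 2%N, 4%N => t2 ^+ 2 | _, _, _ => 0 end)) K3d.
    by do !split=> /=; first [ring | lin_from H].
  have /= /eqP := E 2 0 2 isT isT; rewrite mulf_eq0.
  by rewrite (negPf h2) (negPf h3).
split=> //; apply/eqP => /(hesse_root w0)[a [b [a3 b3 H]]].
(* The array a^p b^q is an eigenvector of both shifts, with eigenvalues a and b, so the operator of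
   [torus_diag] multiplies it by t1 + a t2 + b t3 = 0. *)
have K p q : t1 * (a ^+ p * b ^+ q) + t2 * (a ^+ p.+1 * b ^+ q) + t3 * (a ^+ p * b ^+ q.+1) = 0.
  transitivity (a ^+ p * b ^+ q * (t1 + a * t2 + b * t3)); last by rewrite H mulr0.
  by rewrite !exprS; move: (a ^+ p) (b ^+ q) => *; ring.
have := @torus_kernel F t1 t2 t3
  (a ^+ 0 * b ^+ 0) (a ^+ 0 * b ^+ 1) (a ^+ 0 * b ^+ 2) (a ^+ 1 * b ^+ 0) (a ^+ 1 * b ^+ 1)
  (a ^+ 1 * b ^+ 2) (a ^+ 2 * b ^+ 0) (a ^+ 2 * b ^+ 1) (a ^+ 2 * b ^+ 2) K3d.
have Ka q : a ^+ 0 * b ^+ q = a ^+ 3 * b ^+ q by rewrite a3 expr0.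
have Kb p : a ^+ p * b ^+ 0 = a ^+ p * b ^+ 3 by rewrite b3 expr0.
move=> T; have : a ^+ 0 * b ^+ 0 = 0.
  by apply: T; [exact: K | exact: K | rewrite (Kb 0%N); exact: K
    |exact: K | exact: K | rewrite (Kb 1%N); exact: K
    |rewrite (Ka 0%N); exact: K | rewrite (Ka 1%N); exact: K
    |rewrite (Ka 2%N) (Kb 2%N); exact: K].
by move/eqP; rewrite !expr0 mulr1 (negPf one).
Qed.

(** * Connecting regular elements *)

Lemma dim_lker_matrix (F : fieldType) (V U : vectType F) (f : {linear V -> U}) :
  \dim (lker (linfun f)) =
  (dim V - \rank (lin1_mx (v2r \o f \o r2v) : 'M_(dim V, dim U)))%N.
Proof.
have -> : lin1_mx (v2r \o f \o r2v) = f2mx (linfun f).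
  apply/row_matrixP => i; rewrite !rowE; apply: r2v_inj; rewrite mul_rV_lin1 /= v2rK.
  by rewrite -(lfunE f) unlock /= r2vK.
by rewrite -mxrank_ker /lker /dimv mxrank_gen.
Qed.

Definition poly_family (F : fieldType) m n (M : F -> 'M[F]_(m, n)) :=
  exists P : 'M[{poly F}]_(m, n), forall t, M t = map_mx (horner_eval t) P.

Lemma poly_family_affine (F : fieldType) m n (M : F -> 'M[F]_(m, n)) A B :
  (forall t, M t = A + t *: B) -> poly_family M.
Proof.
move=> H; exists (map_mx polyC A + 'X *: map_mx polyC B) => t.
by apply/matrixP => i j; rewrite H !mxE /horner_eval !hornerE.
Qed.

Lemma poly_family_mul (F : fieldType) m n p (M : F -> 'M[F]_(m, n)) (N : F -> 'M[F]_(n, p)) :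
  poly_family M -> poly_family N -> poly_family (fun t => M t *m N t).
Proof.
by move=> [P MP] [Q NQ]; exists (P *m Q) => t; rewrite map_mxM -MP -NQ.
Qed.

(* [p] is a minor of [M t] of maximal size at [t0], up to a change of bases. *)
Lemma rank_semicontinuous (F : fieldType) m n (M : F -> 'M[F]_(m, n)) t0 :
  poly_family M -> exists2 p : {poly F}, p.[t0] != 0 &
    forall t, p.[t] != 0 -> (\rank (M t0) <= \rank (M t))%N.
Proof.
move=> [P MP]; set r := \rank (M t0).
pose L : 'M[F]_(r, m) := pid_mx r *m invmx (col_ebase (M t0)).
pose N : 'M[F]_(n, r) := invmx (row_ebase (M t0)) *m pid_mx r.
have E t : (\det (map_mx polyC L *m P *m map_mx polyC N)).[t] = \det (L *m M t *m N).
  have C k l (A : 'M[F]_(k, l)) : map_mx (horner_eval t) (map_mx polyC A) = A.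
    by apply/matrixP => i j; rewrite !mxE /horner_eval hornerC.
  by rewrite -[LHS]/(horner_eval t _) -det_map_mx !map_mxM -MP !C.
exists (\det (map_mx polyC L *m P *m map_mx polyC N)) => [|t]; rewrite E.
  rewrite -[M t0 in X in _ *m X *m _]mulmx_ebase /L /N -!mulmxA.
  rewrite (mulKmx (col_ebase_unit _)) (mulKVmx (row_ebase_unit _)).
  rewrite !pid_mx_id ?rank_leq_row ?rank_leq_col //; last first.
  by rewrite pid_mx_1 det1 oner_eq0.
rewrite -unitfE -unitmxE -row_free_unit => /eqP <-.
exact: leq_trans (mxrankM_maxl _ _) (mxrankM_maxr _ _).
Qed.

(** Among the distinct numbers e / (k + 2), one more of them than the length of [s], some number is
    not in [s]. *)
Lemma avoid_seq (R : realType) (s : seq R) (e : R) : 0 < e ->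
  exists x, [/\ 0 < x, x < e & x \notin s].
Proof.
move=> e0; pose f (k : nat) : R := e / k.+2%:R.
have f0 k : 0 < f k by rewrite divr_gt0.
have fe k : f k < e by rewrite ltr_pdivrMr // ltr_pMr // ltr1n.
case: (boolP (all (fun k => f k \in s) (iota 0 (size s).+1))) => [/allP H|/allPn[k _ ks]].
  have : (size [seq f k | k <- iota 0 (size s).+1] <= size s)%N.
    apply: uniq_leq_size => [|_ /mapP[k /H ks ->] //].
    rewrite map_inj_uniq ?iota_uniq // => i j /(mulfI (lt0r_neq0 e0)) /invr_inj /eqP.
    by rewrite eqr_nat => /eqP[].
  by rewrite size_map size_iota ltnn.
by exists (f k).
Qed.

Lemma complex_roots (R : rcfType) (p : {poly R[i]}) : p != 0 ->
  exists s : seq R[i], forall z, (p.[z] == 0) = (z \in s).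
Proof.
move=> p0; have [s sE] := closed_field_poly_normal p; exists s => z.
by rewrite -/(root p z) [in LHS]sE rootZ ?lead_coef_eq0 // root_prod_XsubC.
Qed.

Lemma crossDl (F : numFieldType) c (x y w : W F) :
  cross (c *: x + y) w = c *: cross x w + cross y w.
Proof.
by apply: (@dotp_inj F) => z; rewrite (@dotp_linl F) -!/(tau _ _ _) tau_lin1.
Qed.

Lemma cross_alt (F : numFieldType) (w : W F) : cross w w = 0.
Proof.
apply: (@dotp_inj F) => z; rewrite dotp0l -/(tau _ _ _).
apply/eqP; have /eqP := tau_swap12 w w z.
by rewrite -addr_eq0 -mulr2n mulrn_eq0.
Qed.

Lemma lin1_mx_comp (F : fieldType) (V U T : vectType F) (f : V -> U) (g : {linear U -> T}) :
  lin1_mx (v2r \o (g \o f) \o r2v) =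
  (lin1_mx (v2r \o f \o r2v) : 'M_(dim V, dim U)) *m (lin1_mx (v2r \o g \o r2v) : 'M_(dim U, dim T)).
Proof.
apply/row_matrixP => i; rewrite row_mul; apply/rowP => j.
by rewrite mul_rV_lin1 !mxE /= (_ : row _ _ = v2r (f (r2v (delta_mx 0 i)))) ?v2rK //;
  apply/rowP => k; rewrite !mxE.
Qed.

Lemma poly_family_lin1 (F : fieldType) (V U : vectType F) (f : F -> V -> U) (f0 f1 : V -> U) :
  (forall t w, f t w = f0 w + t *: f1 w) ->
  poly_family (fun t => lin1_mx (v2r \o f t \o r2v) : 'M_(dim V, dim U)).
Proof.
move=> H; apply: (poly_family_affine (A := lin1_mx (v2r \o f0 \o r2v))
  (B := lin1_mx (v2r \o f1 \o r2v))) => t.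
by apply/matrixP => i j; rewrite !mxE /= H linearD linearZ /= !mxE.
Qed.

Definition contrl (F : numFieldType) (l : W F) (x : Wd F) : h0 F := contr l x.
Lemma contrl_is_linear (F : numFieldType) (l : W F) : linear (contrl l).
Proof. by move=> c x y; exact: contrDr. Qed.
HB.instance Definition _ (F : numFieldType) (l : W F) :=
  GRing.isLinear.Build F (Wd F) (h0 F) _ (contrl l) (@contrl_is_linear F l).

Lemma Z1_poly (F : numFieldType) (l v : W F) :
  exists2 p : {poly F}, p.[0] != 0 &
    forall t, p.[t] != 0 -> (\dim (Z1 (l + t *: v)%R) <= \dim (Z1 l))%N.
Proof.
pose M t := lin1_mx (v2r \o (cross (l + t *: v) : W F -> W F) \o r2v).
have MP : poly_family M.
  apply: (poly_family_lin1 (f0 := cross l) (f1 := cross v)) => t w.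
  by rewrite addrC crossDl addrC.
have [p p0 pP] := rank_semicontinuous 0 MP; exists p => // t /pP.
have E (x : W F) : \dim (Z1 x) = (dim (W F) - \rank (lin1_mx (v2r \o (cross x : W F -> W F) \o r2v)))%N
  by exact: dim_lker_matrix.
by rewrite !E /M scale0r addr0; exact: leq_sub2l.
Qed.

(** [ad3 l] is a composite of three maps, each linear in [l], so along a line its matrix is a
    product of three matrices affine in the parameter. *)
Lemma K3_poly (F : numFieldType) (l v : W F) :
  exists2 p : {poly F}, p.[0] != 0 &
    forall t, p.[t] != 0 -> (\dim (K3 (l + t *: v)%R) <= \dim (K3 l))%N.
Proof.
pose M t := lin1_mx (v2r \o ad3 (l + t *: v) \o r2v).
have MP : poly_family M.
  have E t : M t = lin1_mx (v2r \o (cross (l + t *: v) : W F -> Wd F) \o r2v)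
      *m lin1_mx (v2r \o contrl (l + t *: v) \o r2v) *m lin1_mx (v2r \o orbmap (l + t *: v) \o r2v).
    by rewrite -!lin1_mx_comp.
  have [|||P PE] := poly_family_mul (poly_family_mul
    (@poly_family_lin1 F _ _ (fun t => cross (l + t *: v) : W F -> Wd F) (cross l) (cross v) _)
    (@poly_family_lin1 F _ _ (fun t => contrl (l + t *: v)) (contrl l) (contrl v) _))
    (@poly_family_lin1 F _ _ (fun t => orbmap (l + t *: v)) (orbmap l) (orbmap v) _).
  - by move=> t w; rewrite addrC crossDl addrC.
  - by move=> t w; rewrite /contrl addrC contrDl addrC.
  - by move=> t w; rewrite /orbmap addrC (actW_is_linear w) addrC.
  by exists P => t; rewrite E PE.
have [p p0 pP] := rank_semicontinuous 0 MP; exists p => // t /pP.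
have E (x : W F) : \dim (K3 x) = (dim (W F) - \rank (lin1_mx (v2r \o ad3 x \o r2v)))%N
  by exact: dim_lker_matrix.
by rewrite !E /M scale0r addr0; exact: leq_sub2l.
Qed.

(** * Translates of c under GL_6 x GL_3 *)

Lemma actSK (F : numFieldType) (g : 'M[F]_6) (h : 'M[F]_3) (w : W F) :
  g \in unitmx -> h \in unitmx -> actS (invmx g) (invmx h) (actS g h w) = w.
Proof. by move=> gU hU; rewrite actS_comp !mulVmx // actS1. Qed.

Lemma actSKV (F : numFieldType) (g : 'M[F]_6) (h : 'M[F]_3) (w : W F) :
  g \in unitmx -> h \in unitmx -> actS g h (actS (invmx g) (invmx h) w) = w.
Proof. by move=> gU hU; rewrite actS_comp !mulmxV // actS1. Qed.

Lemma actS_eq0 (F : numFieldType) (g : 'M[F]_6) (h : 'M[F]_3) (w : W F) :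
  g \in unitmx -> h \in unitmx -> (actS g h w == 0) = (w == 0).
Proof.
move=> gU hU; apply/eqP/eqP => [w0|->]; last exact: linear0.
by rewrite -(actSK w gU hU) w0 linear0.
Qed.

Lemma dim_actS (F : numFieldType) (g : 'M[F]_6) (h : 'M[F]_3) (U V : {vspace W F}) :
  g \in unitmx -> h \in unitmx -> (forall w, (actS g h w \in V) = (w \in U)) ->
  \dim V = \dim U.
Proof.
move=> gU hU UV; have E w : linfun (actS g h) w = actS g h w := lfunE _ w.
have -> : V = (linfun (actS g h) @: U)%VS.
  apply/vspaceP => v; apply/idP/memv_imgP => [vV|[w wU ->]]; last by rewrite E UV.
  by exists (actS (invmx g) (invmx h) v); rewrite ?E ?actSKV // -UV actSKV.
apply: limg_dim_eq; apply/eqP; rewrite -subv0; apply/subvP => w /memv_capP[_].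
by rewrite memv_ker E actS_eq0 // memv0.
Qed.

Lemma det_unit_neq0 (F : numFieldType) (g : 'M[F]_6) (h : 'M[F]_3) :
  g \in unitmx -> h \in unitmx -> \det g * \det h != 0.
Proof. by rewrite !unitmxE !unitfE => g0 h0; rewrite mulf_neq0. Qed.

Lemma K3_actS (F : numFieldType) (g : 'M[F]_6) (h : 'M[F]_3) (l w : W F) :
  g \in unitmx -> h \in unitmx -> (actS g h w \in K3 (actS g h l)) = (w \in K3 l).
Proof.
move=> gU hU; rewrite !memK3 ad3_actS // scaler_eq0 (negPf (det_unit_neq0 gU hU)).
exact: actS_eq0.
Qed.

Lemma Z1_actS (F : numFieldType) (g : 'M[F]_6) (h : 'M[F]_3) (l w : W F) :
  g \in unitmx -> h \in unitmx -> (actS g h w \in Z1 (actS g h l)) = (w \in Z1 l).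
Proof.
move=> gU hU; rewrite !memZ1 cross_actS // scaler_eq0 (negPf (det_unit_neq0 gU hU)).
by apply: actS_eq0; rewrite unitmx_tr unitmx_inv.
Qed.

Definition cart_orbit (F : numFieldType) (w : W F) : Prop :=
  exists g h k, [/\ g \in unitmx, h \in unitmx, k \in cartsp F & w = actS g h k].

Lemma dim_Z1_cart_orbit (F : numFieldType) (w : W F) :
  cart_orbit w -> (3 <= \dim (Z1 w))%N.
Proof.
move=> [g [h [k [gU hU /cartspP[t1 [t2 [t3 ->]]] ->]]]].
rewrite (dim_actS gU hU (U := Z1 (cart t1 t2 t3))) => [|w']; last exact: Z1_actS.
rewrite -(dim_cartsp F) dimvS //; apply/subvP => _ /cartspP[s1 [s2 [s3 ->]]].
by rewrite memZ1 cart_abelian.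
Qed.

(** Gives the base point in c of all deformations. The last condition holds because 1 + 8 + 27 = 36
    and 3 * 1 * 2 * 3 = 18 have different cubes. *)
Lemma generic123 (F : numFieldType) : generic (1 : F) 2 3.
Proof.
have n (k m : nat) : k != m -> (k%:R : F) != m%:R by rewrite eqr_nat.
split; [split | split |].
- exact: oner_neq0.
- by rewrite pnatr_eq0.
- by rewrite pnatr_eq0.
- by rewrite expr1n -natrX (n 1%N).
- by rewrite expr1n -natrX (n 1%N).
- by rewrite -!natrX n.
rewrite subr_eq0 mulr1 (_ : 1 ^+ 3 + 2 ^+ 3 + 3 ^+ 3 = 36%:R); last by ring.
rewrite (_ : 3 * 2 * 3 = 18%:R); last by ring.
rewrite -!natrX n //.
Qed.

Lemma eqv_of_dim (F : fieldType) (V : vectType F) (U U' : {vspace V}) n :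
  (U <= U')%VS -> \dim U' = n -> (n <= \dim U)%N -> U = U'.
Proof. by move=> UU' <- dU; apply/eqP; rewrite eqEdim UU'. Qed.

Section Complex.
Variable R : realType.
Notation C := R[i].
Implicit Types l w : W C.

Let cart0 : W C := cart 1 2 3.

Lemma dim_K3_cart0 : \dim (K3 cart0) = 3%N.
Proof. by rewrite K3_cart ?dim_cartsp //; exact: generic123. Qed.

Lemma cart0_in : cart0 \in cartsp C.
Proof. by apply/cartspP; exists 1, 2, 3. Qed.

Lemma cart_orbit_sp w : w \in cartsp C -> cart_orbit w.
Proof. by move=> wc; exists 1%:M, 1%:M, w; rewrite !unitmx1 actS1. Qed.

Lemma cart_orbit_near :
  exists2 d : R, 0 < d & forall w, nrm (w - cart0) < d -> cart_orbit w.
Proof.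
have Z3 : (3 <= \dim (Z1 cart0))%N by apply/dim_Z1_cart_orbit/cart_orbit_sp/cart0_in.
have [|d d0 dP] := orbit_local cart0_in; last first.
  by exists d => // w /dP[g [h [k [gU hU kc ->]]]]; exists g, h, k.
move=> w; have [X [k [kZ ->]]] := regular_decomp dim_K3_cart0 Z3 w.
exists X, k; split=> //; rewrite -(K3_cart (generic123 C)).
exact: subvP (Z1_sub_K3 _) _ kZ.
Qed.

Lemma dim_Z1_ge3 l : (3 <= \dim (Z1 l))%N.
Proof.
have [d d0 dP] := cart_orbit_near; pose v := cart0 - l.
have [p p0 pP] := Z1_poly l v.
have [s sP] : exists s : seq C, forall z, (p.[z] == 0) = (z \in s).
  by apply: complex_roots; apply: contraNneq p0 => ->; rewrite horner0.
have N0 : 0 < nrm v + 1 by rewrite ltr_wpDl // nrm_ge0.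
(* The parameter 1 - x is close to 1, where the line from [l] reaches [cart0], and is not a root of
   [p]. The 1 added to [nrm v] keeps the quotient defined when v = 0. *)
have [x [x0 xd xs]] := avoid_seq [seq complex.Re (1 - z) | z <- s] (divr_gt0 d0 N0).
apply: leq_trans (pP (1 - x%:C%C) _); last first.
  rewrite sP; apply: contra xs => xs; apply/mapP; exists (1 - x%:C%C) => //.
  by rewrite subKr.
apply/dim_Z1_cart_orbit/dP.
have -> : l + (1 - x%:C%C) *: v - cart0 = - (x%:C%C *: v).
  by rewrite scalerBl scale1r /v addrA (addrC l) subrK addrAC subrr add0r.
rewrite nrmN nrmZ nc_real gtr0_norm //.
apply: (@lt_trans _ _ (x * (nrm v + 1))); first by rewrite ltr_pM2l // ltrDl.
by rewrite -ltr_pdivlMr.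
Qed.

Lemma omega_exists : exists w : C, w ^+ 2 + w + 1 = 0.
Proof.
have [w /eqP wE] : exists w : C, root ('X^2 + 'X + 1) w.
  apply: closed_rootP; rewrite -addrA size_polyDl size_polyXn // size_polyDl ?size_polyX //.
  by rewrite size_poly1.
by exists w; move: wE; rewrite !hornerE.
Qed.

Lemma cart_generic_C (t1 t2 t3 : C) : \dim (K3 (cart t1 t2 t3)) = 3%N -> generic t1 t2 t3.
Proof. by have [w wE] := omega_exists; exact: cart_generic wE. Qed.

Lemma cart_000 : cart 0 0 0 = 0 :> W C.
Proof. by rewrite /cart !scale0r !addr0. Qed.

(* Near [l] both points are moved into the abelian subspace [Z1 l], which is
   the kernel of both, so the subspace conjugate to [cartsp] is the same. *)
Lemma cart_orbit_locally_constant l : \dim (K3 l) = 3%N ->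
  exists2 e : R, 0 < e & forall w w', \dim (K3 w) = 3%N -> \dim (K3 w') = 3%N ->
    nrm (w - l) < e -> nrm (w' - l) < e -> cart_orbit w -> cart_orbit w'.
Proof.
move=> l3; have l0 : l != 0.
  apply/eqP => l00; move: l3; rewrite l00 -cart_000 => /cart_generic_C[[z0 _ _] _ _].
  by rewrite eqxx in z0.
have Z3 := dim_Z1_ge3 l.
have lZ : l \in Z1 l by rewrite memZ1 cross_alt.
have [e e0 eP] := orbit_local lZ (regular_decomp l3 Z3).
have KE k : k \in Z1 l -> \dim (K3 k) = 3%N -> K3 k = Z1 l.
  move=> kZ k3; apply/esym/(eqv_of_dim _ k3 Z3).
  apply: subv_trans (Z1_sub_K3 k); apply/subvP => k' kZ'.
  by rewrite memZ1 (regular_abelian l0 l3 Z3).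
exists e => // w w' w3 w3' /eP[g [h [k [gU hU kZ wE]]]] /eP[g' [h' [k' [gU' hU' kZ' ->]]]].
rewrite {w}wE in w3 *; move=> [g0 [h0 [m [gU0 hU0 mc E]]]].
have k3 : \dim (K3 k) = 3%N by rewrite -w3; apply/esym/(dim_actS gU hU) => x; exact: K3_actS.
have m3 : \dim (K3 m) = 3%N by rewrite -w3 E; apply/esym/(dim_actS gU0 hU0) => x; exact: K3_actS.
have Km : K3 m = cartsp C.
  by case/cartspP: mc m3 => t1 [t2 [t3 ->]] /cart_generic_C/K3_cart.
(* Both [k] and [k'] have been reduced to [Z1 l], the kernel of [k]. Transporting [k'] by g, h and
   back by g0, h0 therefore puts it in the kernel of [m], which is c. *)
have : actS g h k' \in K3 (actS g h k) by rewrite (K3_actS _ _ gU hU) (KE k kZ k3).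
rewrite E -{1}(actSKV (actS g h k') gU0 hU0) (K3_actS _ _ gU0 hU0) Km => m'c.
exists (g' *m (invmx g *m g0)), (h' *m (invmx h *m h0)), (actS (invmx g0) (invmx h0) (actS g h k')).
split=> //; first by rewrite !unitmx_mul unitmx_inv gU' gU gU0.
  by rewrite !unitmx_mul unitmx_inv hU' hU hU0.
by rewrite -!actS_comp actSKV // actSK.
Qed.

(** Let c be the supremum of the points where [G] holds. Comparison with such a point near c gives
    [G] at c and, if c < 1, slightly beyond c. *)
Lemma unit_interval_connected (G : R -> Prop) :
  (forall s, 0 <= s <= 1 -> exists2 d : R, 0 < d & forall u v,
     0 <= u <= 1 -> 0 <= v <= 1 -> `|u - s| < d -> `|v - s| < d -> G u -> G v) ->
  G 0 -> G 1.
Proof.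
move=> loc G0; pose E := [set s | 0 <= s <= 1 /\ G s]%classic.
have Eub : ubound E 1 by move=> s [/andP[]].
have Ee : (E !=set0)%classic by exists 0; split=> //; rewrite lexx ler01.
have E0 : E 0 by split=> //; rewrite lexx ler01.
pose c := sup E.
have supE : has_sup E by split=> //; exists 1.
have c0 : 0 <= c by apply: ub_le_sup E0; exists 1.
have c1 : c <= 1 by exact: ge_sup.
have [|d d0 dP] := loc c; first by rewrite c0.
have [u [u01 Gu] cu] := sup_adherent d0 supE.
have uc : u <= c by apply: ub_le_sup; [exists 1 | split].
have uP : `|u - c| < d by rewrite ler0_norm ?subr_le0 // opprB ltrBlDr -ltrBlDl.
suff : ~~ (c < 1).
  rewrite -leNgt => ge1; apply: (dP u) => //; first by rewrite ler01 lexx.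
  by rewrite (_ : 1 - c = 0) ?normr0 //; apply/eqP; rewrite subr_eq0 eq_le ge1 c1.
apply/negP => lt1; pose v := Num.min 1 (c + d / 2).
have d2 : 0 < d / 2 by rewrite divr_gt0.
have cv : c < v by rewrite lt_min lt1 ltrDl.
have vd : v <= c + d / 2 by rewrite ge_min lexx orbT.
have v01 : 0 <= v <= 1 by rewrite (le_trans c0 (ltW cv)) ge_min lexx.
have : v <= c.
  apply: ub_le_sup; [by exists 1 | split=> //].
  apply: (dP u) => //; rewrite gtr0_norm ?subr_gt0 // ltrBlDl.
  by apply: le_lt_trans vd _; rewrite ltrD2l gtr_pMr // invf_lt1 // ltr1n.
by rewrite leNgt cv.
Qed.

Lemma parabola_lipschitz (m u x : R) : 0 < m -> 0 <= u <= 1 -> 0 <= x <= 1 ->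
  nc ((u +i* (m * (u * (1 - u))))%C - (x +i* (m * (x * (1 - x))))%C) <= (1 + m) * `|u - x|.
Proof.
move=> m0 u01 x01; apply: le_trans (nc_le _) _; rewrite /= mulrDl mul1r lerD2l.
rewrite (_ : m * (u * (1 - u)) - m * (x * (1 - x)) = m * (1 - u - x) * (u - x)); last by ring.
rewrite normrM ler_wpM2r // normrM gtr0_norm // ger_pMr // ler_norml.
by move: u01 x01 => /andP[? ?] /andP[? ?]; apply/andP; split; lra.
Qed.

Lemma regular_cart_orbit l : \dim (K3 l) = 3%N -> cart_orbit l.
Proof.
move=> l3; pose v := l - cart0.
have [p p0 pP] := K3_poly cart0 v.
have [s sP] : exists s : seq C, forall z, (p.[z] == 0) = (z \in s).
  by apply: complex_roots; apply: contraNneq p0 => ->; rewrite horner0.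
(* The path from 0 to 1 is the arc Im z = m Re z (1 - Re z). A root with real part strictly between
   0 and 1 lies on exactly one such parabola, so only finitely many values of [m] are excluded. *)
have [m [m0 _ ms]] := avoid_seq
  [seq complex.Im z / (complex.Re z * (1 - complex.Re z)) | z <- s] (@ltr01 R).
pose t (x : R) : C := (x +i* (m * (x * (1 - x))))%C.
have t0 : t 0 = 0 by rewrite /t mul0r mulr0.
have t1 : t 1 = 1 by rewrite /t subrr !mulr0.
pose f x := cart0 + t x *: v.
have f0 : f 0 = cart0 by rewrite /f t0 scale0r addr0.
have f1 : f 1 = l by rewrite /f t1 scale1r addrC subrK.
have f3 x : 0 <= x <= 1 -> \dim (K3 (f x)) = 3%N.
  move=> /andP[]; rewrite le_eqVlt => /predU1P[<- _|x0]; first by rewrite f0 dim_K3_cart0.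
  rewrite le_eqVlt => /predU1P[->|x1]; first by rewrite f1.
  (* The lower bound comes from the centralizer; the upper one from semicontinuity, as the arc
     avoids the roots of [p]. *)
  apply/eqP; rewrite eqn_leq (leq_trans (dim_Z1_ge3 _) (dimvS (Z1_sub_K3 _))) andbT.
  rewrite -dim_K3_cart0; apply: pP; rewrite sP; apply: contra ms => ts.
  apply/mapP; exists (t x); first exact: ts.
  rewrite -[complex.Im _]/(m * (x * (1 - x))) -[complex.Re _]/x.
  apply/esym/mulfK/mulf_neq0; apply: lt0r_neq0; first exact: x0.
  by rewrite subr_gt0; exact: x1.
rewrite -f1; apply: (unit_interval_connected (G := fun x => cart_orbit (f x))); last first.
  by rewrite f0; apply/cart_orbit_sp/cart0_in.
move=> x x01; have [e e0 eP] := cart_orbit_locally_constant (f3 x x01).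
have N0 : 0 < (1 + m) * (nrm v + 1).
  apply: mulr_gt0; first exact: addr_gt0 ltr01 m0.
  exact: ltr_wpDl (nrm_ge0 v) ltr01.
have near u : 0 <= u <= 1 -> `|u - x| < e / ((1 + m) * (nrm v + 1)) -> nrm (f u - f x) < e.
  move=> u01; rewrite (ltr_pdivlMr _ _ N0); apply: le_lt_trans.
  have -> : f u - f x = (t u - t x) *: v.
    by rewrite /f opprD addrACA subrr add0r -scalerBl.
  rewrite nrmZ mulrA; apply: (ler_pM (nc_ge0 _) (nrm_ge0 v)); last by rewrite lerDl ler01.
  by rewrite mulrC; exact: (parabola_lipschitz m0 u01 x01).
exists (e / ((1 + m) * (nrm v + 1))); first exact: divr_gt0 e0 N0.
by move=> u w u01 w01 /(near u u01) uP /(near w w01) wP; exact: eP (f3 u u01) (f3 w w01) uP wP.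
Qed.
End Complex.

(** * The first family *)

Lemma e7_br_inW (F : numFieldType) (l z : W F) (xi : Wd F) (X : h0 F) :
  e7_br (inW l) (xi, X, z) = (cross l z, contr l xi, - actW X l).
Proof.
have B n (A : sl F n) : sl_br 0 A = 0.
  by apply/val_inj; rewrite /= mul0mx mulmx0 subrr.
have c0 (x : Wd F) : cross 0 x = 0.
  by have := @crossDl F (-1) 0 0 x; rewrite scaler0 addr0 scaleN1r addNr.
have d0 (Y : h0 F) : actWd Y 0 = 0.
  by have := actWd_is_linear Y (-1) 0 0; rewrite scaler0 addr0 scaleN1r addNr.
have d1 (x : Wd F) : actWd (0 : h0 F) x = 0.
  by have := actWdDl (-1) (0 : h0 F) 0 x; rewrite scaler0 addr0 scaleN1r addNr.
have c1 (x : Wd F) : cross (0 : Wd F) x = 0 by exact: c0.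
rewrite /e7_br /inW; congr (_, _, _).
- by rewrite d0 d1 addr0 subr0.
- by rewrite contr0r subr0 /h0_br !B add0r.
- by rewrite c1 actW0l oppr0 !add0r.
Qed.

Lemma sigma3_inW (F : numFieldType) (l w : W F) : sigma3 l (inW w) = inW (- ad3 l w).
Proof.
have S x : sigma l x = e7_br (inW l) x := lfunE _ x.
have l0 : cross l (0 : W F) = 0 :> Wd F.
  by have := cross_is_linear l (-1) 0 0; rewrite scaler0 addr0 scaleN1r addNr.
have E1 : e7_br (inW l) (inW w) = (cross l w, 0, 0).
  by apply: etrans (e7_br_inW l w 0 0) _; rewrite contr0r actW0l oppr0.
have E2 (x : Wd F) : e7_br (inW l) (x, 0, 0) = (0, contr l x, 0).
  by apply: etrans (e7_br_inW l 0 x 0) _; rewrite l0 actW0l oppr0.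
have E3 (X : h0 F) : e7_br (inW l) (0, X, 0) = (0, 0, - actW X l).
  by apply: etrans (e7_br_inW l 0 0 X) _; rewrite l0 contr0r.
by rewrite /sigma3 !comp_lfunE !S E1 E2 E3.
Qed.

Lemma inW_inj (F : numFieldType) : injective (@inW F).
Proof. by move=> w z []. Qed.

Lemma dim_ker_sigma3 (F : numFieldType) (l : W F) :
  \dim (lker (sigma3 l) :&: h1 F) = \dim (K3 l).
Proof.
have E w : linfun (@inW F) w = inW w := lfunE _ w.
have -> : (lker (sigma3 l) :&: h1 F)%VS = (linfun (@inW F) @: K3 l)%VS.
  apply/vspaceP => x; apply/memv_capP/memv_imgP => [[xk /memv_imgP[w _ xE]]|[w wK ->]].
    exists w => //; move: xk; rewrite xE E memv_ker sigma3_inW memK3.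
    by rewrite -(linear0 (@inW F)) (inj_eq (@inW_inj F)) oppr_eq0.
  split; last by apply/memv_img/memvf.
  by move: wK; rewrite E memv_ker sigma3_inW memK3 => /eqP ->; rewrite oppr0 linear0.
apply: limg_dim_eq; apply/eqP; rewrite -subv0; apply/subvP => w /memv_capP[_].
rewrite memv_ker E -(linear0 (@inW F)) (inj_eq (@inW_inj F)) => /eqP ->.
exact: mem0v.
Qed.

(** * Arbitrary bases and normalization of determinants *)

Definition colmx (F : numFieldType) n (a : n.-tuple 'cV[F]_n) : 'M[F]_n :=
  \matrix_(i, j) a`_j i 0.

Lemma colmx_unit (F : numFieldType) n (a : n.-tuple 'cV[F]_n) :
  basis_of fullv a -> colmx a \in unitmx.
Proof.
move=> /basis_free/freeP fa; rewrite -unitmx_tr unitmxE unitfE; apply/det0P => -[v v0 vP].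
apply/negP: v0; rewrite negbK; apply/eqP/rowP => j; rewrite [RHS]mxE.
apply: (fa (fun j => v 0 j)); apply/colP => i; rewrite summxE [RHS]mxE.
have /rowP/(_ i) := vP; rewrite !mxE => E; rewrite -[RHS]E; apply: eq_bigr => k _.
by rewrite !mxE.
Qed.

Lemma nth_colmx (F : numFieldType) n (a : n.-tuple 'cV[F]_n) (i : 'I_n) :
  a`_i = colmx a *m (stdb n F)`_i.
Proof.
rewrite nth_stdb -colE; apply/colP => j; by rewrite !mxE.
Qed.

Lemma actS_tensor (F : numFieldType) (g : 'M[F]_6) (h : 'M[F]_3) (x y : 'cV[F]_6) (v : 'cV[F]_3) :
  actS g h (tensor (wedge x y) v) = tensor (wedge (g *m x) (g *m y)) (h *m v).
Proof.
have T (p q : 'cV[F]_6) (u : 'cV[F]_3) k :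
    vsval (tensor (wedge p q) u k) = u k 0 *: (p *m q^T - q *m p^T) by rewrite ffunE linearZ.
apply/ffunP => k; apply: val_inj => /=; rewrite actSE T mxE scaler_suml.
apply: eq_bigr => m _; rewrite T -scalemxAr -scalemxAl scalerA; congr (_ *: _).
by rewrite !trmx_mul mulmxBr mulmxBl !mulmxA.
Qed.

Lemma abk_actS (F : numFieldType) (a : 6.-tuple 'cV[F]_6) (b : 3.-tuple 'cV[F]_3)
    (i j : 'I_6) (k : 'I_3) :
  abk a b i.+1 j.+1 k.+1 = actS (colmx a) (colmx b) (abk (stdb 6 F) (stdb 3 F) i.+1 j.+1 k.+1).
Proof. by rewrite /abk actS_tensor -!nth_colmx. Qed.

(** The given bases are the images of the standard ones under [colmx a] and [colmx b], so up to GL_6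
    x GL_3 the choice of bases is immaterial. *)
Lemma cart_basis (F : numFieldType) (a : 6.-tuple 'cV[F]_6) (b : 3.-tuple 'cV[F]_3) t1 t2 t3 :
  t1 *: u1 a b + t2 *: u2 a b + t3 *: u3 a b = actS (colmx a) (colmx b) (cart t1 t2 t3).
Proof.
have e (x y : 'I_6) (z : 'I_3) n m p : n = x.+1 -> m = y.+1 -> p = z.+1 ->
    abk a b n m p = actS (colmx a) (colmx b) (abk (stdb 6 F) (stdb 3 F) n m p).
  by move=> -> -> ->; exact: abk_actS.
have D (x y : W F) : actS (colmx a) (colmx b) (x + y)
    = actS (colmx a) (colmx b) x + actS (colmx a) (colmx b) y.
  exact: (linearD (actS (colmx a) (colmx b))).
have Z c (x : W F) : actS (colmx a) (colmx b) (c *: x) = c *: actS (colmx a) (colmx b) x.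
  by have := actS_is_linear (colmx a) (colmx b) c x 0; rewrite addr0 [actS _ _ 0]linear0 addr0.
have D3 (x y z : W F) : actS (colmx a) (colmx b) x + actS (colmx a) (colmx b) y
    + actS (colmx a) (colmx b) z = actS (colmx a) (colmx b) (x + y + z) by rewrite 2!D.
have U1 : u1 a b = actS (colmx a) (colmx b) (u1 (stdb 6 F) (stdb 3 F)).
  rewrite {1}/u1 (e 0 1 0 1%N 2%N 1%N erefl erefl erefl) (e 2 3 1 3%N 4%N 2%N erefl erefl erefl) (e 4 5
    2 5%N 6%N 3%N erefl erefl erefl).
  exact: D3.
have U2 : u2 a b = actS (colmx a) (colmx b) (u2 (stdb 6 F) (stdb 3 F)).
  rewrite {1}/u2 (e 4 3 0 5%N 4%N 1%N erefl erefl erefl) (e 0 5 1 1%N 6%N 2%N erefl erefl erefl) (e 2 1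
    2 3%N 2%N 3%N erefl erefl erefl).
  exact: D3.
have U3 : u3 a b = actS (colmx a) (colmx b) (u3 (stdb 6 F) (stdb 3 F)).
  rewrite {1}/u3 (e 2 5 0 3%N 6%N 1%N erefl erefl erefl) (e 4 1 1 5%N 2%N 2%N erefl erefl erefl) (e 0 3
    2 1%N 4%N 3%N erefl erefl erefl).
  exact: D3.
by rewrite U1 U2 U3 -3!Z; exact: D3.
Qed.

Lemma genericZ (F : numFieldType) c (t1 t2 t3 : F) : c != 0 ->
  generic t1 t2 t3 -> generic (c * t1) (c * t2) (c * t3).
Proof.
move=> c0 [[h1 h2 h3] [n12 n13 n23] D].
have c3 : c ^+ 3 != 0 by rewrite expf_neq0.
split; [by rewrite !mulf_neq0 | by rewrite !exprMn !(inj_eq (mulfI c3)) |].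
rewrite (_ : _ - _ = c ^+ 9 * ((t1 ^+ 3 + t2 ^+ 3 + t3 ^+ 3) ^+ 3 - (3 * t1 * t2 * t3) ^+ 3)).
  by rewrite mulf_neq0 // expf_neq0.
ring.
Qed.

Lemma cartZ (F : numFieldType) c (t1 t2 t3 : F) :
  c *: cart t1 t2 t3 = cart (c * t1) (c * t2) (c * t3).
Proof. by rewrite /cart 2!scalerDr 3!scalerA. Qed.

Lemma actSZ (F : numFieldType) c d (g : 'M[F]_6) (h : 'M[F]_3) (w : W F) :
  actS (c *: g) (d *: h) w = (c ^+ 2 * d) *: actS g h w.
Proof.
apply/ffunP => k; apply: val_inj; rewrite [LHS]actSE.
transitivity ((c ^+ 2 * d) *: vsval (actS g h w k)); last by rewrite [in RHS]ffunE linearZ.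
rewrite actSE scaler_sumr.
have -> : (c *: g)^T = c *: g^T by rewrite linearZ.
apply: eq_bigr => m _; rewrite -!scalemxAl -scalemxAr mxE !scalerA; congr (_ *: _).
ring.
Qed.

Lemma normalize_det (F : numClosedFieldType) n (g : 'M[F]_n.+1) : g \in unitmx ->
  exists2 c : F, c != 0 & \det (c *: g) = 1.
Proof.
rewrite unitmxE unitfE => g0; pose r := n.+1.-root (\det g).
have rE : r ^+ n.+1 = \det g by rewrite rootCK.
have r0 : r != 0 by apply: contraNneq g0 => r0; rewrite -rE r0 expr0n.
by exists r^-1; rewrite ?invr_eq0 // detZ exprVn rE mulVf.
Qed.

(** Over an algebraically closed field, scalars c and d bring both determinants to 1. They multiply
    the action by c^2 d, which is compensated by dividing the coefficients t_i by c^2 d; by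
    homogeneity these remain generic. *)
Lemma first_familyP (F : numClosedFieldType) (a : 6.-tuple 'cV[F]_6) (b : 3.-tuple 'cV[F]_3)
    (l : W F) : basis_of fullv a -> basis_of fullv b ->
  first_family a b l <-> exists g h t1 t2 t3, [/\ g \in unitmx, h \in unitmx,
    generic t1 t2 t3 & l = actS g h (cart t1 t2 t3)].
Proof.
move=> /colmx_unit aU /colmx_unit bU; split.
  move=> [t1 [t2 [t3 [h1 h2 h3 [g [h [dg dh ->]]]]]]].
  exists (g *m colmx a), (h *m colmx b), t1, t2, t3; split.
  - by rewrite unitmx_mul aU unitmxE dg unitr1.
  - by rewrite unitmx_mul bU unitmxE dh unitr1.
  - by split.
  by rewrite cart_basis actS_comp.
move=> [g [h [t1 [t2 [t3 [gU hU gen lE]]]]]].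
have [|c c0 cE] := @normalize_det F 5 (g *m invmx (colmx a)).
  by rewrite unitmx_mul gU unitmx_inv.
have [|d d0 dE] := @normalize_det F 2 (h *m invmx (colmx b)).
  by rewrite unitmx_mul hU unitmx_inv.
pose e := (c ^+ 2 * d)^-1.
have e0 : e != 0 by rewrite invr_eq0 mulf_neq0 // expf_neq0.
have [H1 H2 H3] := genericZ e0 gen.
exists (e * t1), (e * t2), (e * t3); split=> //.
exists (c *: (g *m invmx (colmx a))), (d *: (h *m invmx (colmx b))); split; [exact: cE | exact: dE |].
rewrite cart_basis actSZ actS_comp !mulmxKV // -cartZ linearZ /= scalerA /e mulfV; last first.
  by rewrite mulf_neq0 // expf_neq0.
by rewrite scale1r.
Qed.

Theorem theorem4p10 (R : realType)
    (a : 6.-tuple 'cV[R[i]]_6) (ha : basis_of fullv a)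
    (b : 3.-tuple 'cV[R[i]]_3) (hb : basis_of fullv b)
    (l : W R[i]) :
  (sigma3 l @: h1 R[i] <= h1 R[i])%VS /\
  (\dim (lker (sigma3 l) :&: h1 R[i]) = 3%N <-> first_family a b l).
Proof.
have E w : linfun (@inW R[i]) w = inW w := lfunE _ w.
split.
  apply/subvP => _ /memv_imgP[_ /memv_imgP[w _ ->] ->].
  by rewrite E sigma3_inW -E; apply/memv_img/memvf.
rewrite dim_ker_sigma3 (first_familyP l ha hb); split.
  move=> l3; have [g [h [_ [gU hU /cartspP[t1 [t2 [t3 ->]]] lE]]]] := regular_cart_orbit l3.
  exists g, h, t1, t2, t3; split=> //; apply: cart_generic_C; rewrite -l3 lE.
  by apply/esym/(dim_actS gU hU) => w; exact: K3_actS.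
move=> [g [h [t1 [t2 [t3 [gU hU gen ->]]]]]].
rewrite (dim_actS gU hU (U := K3 (cart t1 t2 t3))) => [|w]; last exact: K3_actS.
by rewrite K3_cart // dim_cartsp.
Qed.
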